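(* Let $k$ be a positive integer, let $\Lambda^{(k)}=\mathbb Q[h_1,\dots,h_k]$ and let $\mathcal I_k$ be the ideal of $\Lambda^{(k)}$ generated by the Schur functions $s_{\ell^{k+1-\ell}}[X]$, $\ell=1,\dots,k$. Then the images of the irreducible $k$-Schur functions $s^{(k)}_\lambda[X]$ (with $\lambda$ ranging over the $k$-irreducible partitions) form a basis of the quotient ring $\Lambda^{(k)}/\mathcal I_k$.
   Context: $h_i$ are the complete homogeneous symmetric functions. A partition $\lambda$ is $k$-irreducible if $\lambda_1\le k$ and, for each $i=0,\dots,k-1$, $\lambda$ has at most $i$ parts equal to $k-i$. $k$-Schur functions: for $n\in\mathbb Z$, $B_n=\sum_{i\ge0}s_{i+n}[X]\,s_i[X(t-1)]^\perp$ acting on symmetric functions over $\mathbb Q(q,t)$ ($f^\perp$ adjoint to multiplication by $f$ for the Hall scalar product; $s_i[X(t-1)]$ the plethystic substitution $p_n\mapsto(t^n-1)p_n$); for a partition $\rho$ of length $L$, $B_\rho=\prod_{1\le a<b\le L}(1-te_{ab})B_{\rho_1}\cdots B_{\rho_L}$ with $e_{ab}$ raising the $a$-th index by one and lowering the $b$-th by one. $\Lambda^{(k)}_t$ is the span of $H_\rho[X;t]=B_{\rho_1}\cdots B_{\rho_{\ell(\rho)}}\cdot1$ with $\rho_1\le k$. Main hook-length $h_M(\rho)=\rho_1+\ell(\rho)-1$; the $k$-split $\rho^{\to k}=(\rho^{(1)},\dots,\rho^{(s)})$ of a partition with $\rho_1\le k$ cuts $\rho$ (without rearranging, from the largest parts)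 into consecutive blocks of rows with $h_M(\rho^{(i)})=k$ for $i<s$. The $k$-split polynomials $G^{(k)}_{()}=1$, $G^{(k)}_\rho=B_{\rho^{(1)}}G^{(k)}_{(\rho^{(2)},\dots)}$ form a basis of $\Lambda^{(k)}_t$; $T^{(k)}_j$ is the linear operator with $T^{(k)}_jG^{(k)}_\rho=G^{(k)}_\rho$ if $\rho_1=j$ and $0$ otherwise. The $k$-Schur functions are $s^{(k)}_{()}=1$, $s^{(k)}_\rho[X;t]=T^{(k)}_{\rho_1}B_{\rho_1}s^{(k)}_{(\rho_2,\rho_3,\dots)}[X;t]$ for $\rho_1\le k$, and $s^{(k)}_\rho[X]$ is the specialization at $t=1$, an element of $\Lambda^{(k)}$. The irreducible $k$-Schur functions are those $s^{(k)}_\lambda[X]$ with $\lambda$ $k$-irreducible. *)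

(* Defs.v *)
From HB Require Import structures.
From mathcomp Require Import all_boot all_order all_algebra.
From mathcomp Require Import finmap.
From mathcomp.multinomials Require Import monalg.
From Stdlib Require Import ClassicalEpsilon.

Set Implicit Arguments.
Unset Strict Implicit.
Unset Printing Implicit Defensive.

Import GRing.Theory.

Local Open Scope ring_scope.

(* The ring of symmetric functions over F (a field of characteristic 0 in all
   uses below), as the polynomial ring F[p_1, p_2, ...] in the power sums: the
   variable of index i : nat is p_(i+1), and the monomial m stands for p_lambda,
   where lambda has exactly m i parts equal to i + 1. *)
Notation sym F := {malg F[{cmonom nat}]}.

Definition is_part (la : seq nat) : bool := sorted geq la && (0%N \notin la).

Definition kbounded (k : nat) (la : seq nat) : bool :=
  is_part la && (head 0%N la <= k)%N.

Definition kirreducible (k : nat) (la : seq nat) : bool :=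
  kbounded k la && [forall i : 'I_k, (count_mem (k - i)%N la <= i)%N].

Definition mainhook (la : seq nat) : nat := (head 0%N la + size la).-1.

(* A block whose first row is a has main hook length k exactly when it has
   k + 1 - a rows; see ksplitP.  The first argument is fuel. *)
Fixpoint ksplit_rec (n k : nat) (la : seq nat) : seq (seq nat) :=
  match n, la with
  | n'.+1, a :: _ =>
      take (k.+1 - a) la :: ksplit_rec n' k (drop (k.+1 - a) la)
  | _, _ => [::]
  end.

Definition ksplit (k : nat) (la : seq nat) : seq (seq nat) :=
  ksplit_rec (size la) k la.

Lemma ksplitP (k : nat) (la : seq nat) : kbounded k la ->
  [/\ flatten (ksplit k la) = la, all (fun b => b != [::]) (ksplit k la)
    & forall b c s1 s2, ksplit k la = s1 ++ b :: c :: s2 -> mainhook b = k].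
Proof.
move=> kla; have {kla} : all (geq k) la.
  case: la kla => //= a la /andP[/andP[/= pla _] le_ak]; rewrite le_ak /=.
  have /allP ge_a : all (geq a) la.
    by apply: order_path_min pla => x y z /= xy yz; exact: leq_trans yz xy.
  by apply/allP => b /ge_a /= /leq_trans; apply.
rewrite /ksplit; have := leqnn (size la); move: {2 3 4 5}(size la) => n.
elim: n la => [|n IH] [|a la] //= le_n; try by split=> // b c [].
case/andP=> le_ak lak.
set d := drop _ _; set b0 := take _ _.
have Eb0 : b0 ++ d = a :: la by rewrite cat_take_drop.
have dk : all (geq k) d.
  have : all (geq k) (b0 ++ d) by rewrite Eb0 /= le_ak.
  by rewrite all_cat => /andP[].
have dn : (size d <= n)%N by rewrite size_drop subSn //= subSS (leq_trans (leq_subr _ _)).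
have [IH1 IH2 IH3] := IH d dn dk.
have b0N : b0 != [::] by rewrite /b0 subSn.
split; [by rewrite /= IH1 | by rewrite /= b0N | ].
move=> b c [|b1 s1] s2 /= [Eb Es]; last exact: IH3 Es.
rewrite -Eb; have dN : d != [::] by apply: contra_eq_neq Es => ->; case: (n).
have : (k.+1 - a < size (a :: la))%N.
  by move: dN; rewrite -size_eq0 size_drop subn_eq0 -ltnNge.
rewrite /mainhook /b0 => lt_s; rewrite size_takel 1?ltnW // subSn //=.
by rewrite addnS subnKC.
Qed.

Section SymmetricFunctions.
Variable F : fieldType.

(* p_n, for n > 0. *)
Definition psum (n : nat) : sym F := << ucm n.-1 >>.

(* z_lambda *)
Definition zcm (m : {cmonom nat}) : nat :=
  (\prod_(i <- finsupp m) (i.+1 ^ m i * (m i)`!))%N.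

Lemma zcm_gt0 (m : {cmonom nat}) : (0 < zcm m)%N.
Proof. by apply: prodn_gt0 => i; rewrite muln_gt0 expn_gt0 fact_gt0. Qed.

(* |lambda| *)
Definition cmwgt (m : {cmonom nat}) : nat :=
  (\sum_(i <- finsupp m) m i * i.+1)%N.

Definition symdeg (f : sym F) : nat := (\max_(m <- msupp f) cmwgt m)%N.

(* h_n is the sum of p_lambda / z_lambda over the partitions lambda of n; here
   lambda has exactly m i parts equal to i + 1. *)
Definition hsym (n : nat) : sym F :=
  \sum_(m : {ffun 'I_n -> 'I_n.+1} | (\sum_(i < n) m i * i.+1)%N == n)
    ((\prod_(i < n) (i.+1 ^ m i * (m i)`!))%N%:R)^-1
      *: \prod_(i < n) psum i.+1 ^+ m i.

Definition hsymz (n : int) : sym F := if n is Posz m then hsym m else 0.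

(* Jacobi-Trudi *)
Definition schur (la : seq nat) : sym F :=
  \det (\matrix_(i < size la, j < size la)
          hsymz ((nth 0%N la i)%:Z + (j : nat)%:Z - (i : nat)%:Z)).

(* The Hall scalar product: <p_lambda, p_mu> is z_lambda if lambda = mu, and 0
   otherwise. *)
Definition hall (f g : sym F) : F :=
  \sum_(m <- msupp f) (zcm m)%:R * f@_m * g@_m.

(* f^perp in the power sum basis; see perpP for the adjunction. *)
Definition perp (f g : sym F) : sym F :=
  \sum_(m <- msupp g) \sum_(n <- msupp f | mulcm n (divcm m n) == m)
    << f@_n * g@_m * (zcm m)%:R / (zcm (divcm m n))%:R *g divcm m n >>.

Lemma perpP (f g w : sym F) :
  [pchar F] =i pred0 -> hall (perp f g) w = hall g (f * w).
Proof.
move=> /pcharf0P F0.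
have hallE (u v : sym F) : hall u v = mmap idfun (fun m => (zcm m)%:R * v@_m) u.
  by rewrite /mmap; apply: eq_bigr => m _; rewrite /= mulrCA mulrA.
have coefM m : (f * w)@_m =
    \sum_(n <- msupp f | mulcm n (divcm m n) == m) f@_n * w@_(divcm m n).
  rewrite mcoeffMl [RHS]big_mkcond; apply: eq_bigr => n _ /=.
  have -> : \sum_(k <- msupp w) f@_n * w@_k *+ (mulcm n k == m) =
            \sum_(k <- msupp w | k == divcm m n)
               (if mulcm n (divcm m n) == m then f@_n * w@_k else 0).
    rewrite [RHS]big_mkcond; apply: eq_bigr => k _.
    have [->|kN] := eqVneq k (divcm m n); first by rewrite mulrb.
    case: eqP => // E; case/eqP: kN; apply/eqP/cmP => i.
    by rewrite -E divcmE mulcmE addKn.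
  case: ifP => _; last by rewrite big1.
  have [wk|wk] := boolP (divcm m n \in msupp w).
    rewrite big_mkcond (bigD1_seq _ wk) ?fset_uniq //= eqxx big1 ?addr0 //.
    by move=> k /negPf->.
  rewrite (mcoeff_outdom wk) mulr0 big1_seq // => k /andP[/eqP ->].
  by rewrite (negPf wk).
rewrite hallE raddf_sum; apply: eq_bigr => m _ /=.
rewrite raddf_sum coefM mulr_sumr; apply: eq_bigr => n _ /=.
rewrite mmapU /=. rewrite [LHS]mulrA mulfVK; last by rewrite F0 -lt0n zcm_gt0.
by rewrite [f@_n * g@_m]mulrC -[LHS]mulrA mulrACA [g@_m * _]mulrC.
Qed.
(* F[h_1, ..., h_k] *)
Definition symk (k : nat) (f : sym F) : Prop :=
  exists P : {malg F['X_{1..k}]},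
    f = mmap (@malgC {cmonom nat} F)
             (fun m : 'X_{1..k} => \prod_(i < k) hsym i.+1 ^+ m i) P.

Definition rect_ideal (k : nat) (f : sym F) : Prop :=
  exists2 a : nat -> sym F, (forall l, symk k (a l)) &
    f = \sum_(1 <= l < k.+1) a l * schur (nseq (k.+1 - l) l).

Section VertexOperators.
Variable t : F.

(* f |-> f[X(t-1)] *)
Definition pleth (f : sym F) : sym F :=
  mmap (@malgC {cmonom nat} F)
    (fun m : {cmonom nat} =>
       \prod_(i <- finsupp m) ((t ^+ i.+1 - 1) *: psum i.+1) ^+ m i) f.

(* B_n; the terms with i > deg f vanish on f. *)
Definition bern (n : int) (f : sym F) : sym F :=
  \sum_(i < (symdeg f).+1) hsymz ((i : nat)%:Z + n) * perp (pleth (hsym i)) f.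

(* The index of the c-th factor after applying e_ab for all (a, b) in S. *)
Definition raise (la : seq nat) (S : {set 'I_(size la) * 'I_(size la)})
    (c : 'I_(size la)) : int :=
  (nth 0%N la c)%:Z + #|[set ab in S | ab.1 == c]|%:Z
                    - #|[set ab in S | ab.2 == c]|%:Z.

(* B_la for a partition la: the product of the 1 - t e_ab is expanded over the
   sets S of pairs a < b. *)
Definition bpart (la : seq nat) (f : sym F) : sym F :=
  \sum_(S : {set 'I_(size la) * 'I_(size la)}
          | [forall ab in S, (ab.1 < ab.2)%N])
    (- t) ^+ #|S| *: foldr bern f [seq raise S c | c <- enum 'I_(size la)].

Definition hlpoly (la : seq nat) : sym F :=
  foldr (fun r f => bern r%:Z f) 1 la.

(* Lambda_t^(k) *)
Definition symkt (k : nat) (f : sym F) : Prop :=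
  exists2 l : seq (F * seq nat), all (fun x => kbounded k x.2) l &
    f = \sum_(x <- l) x.1 *: hlpoly x.2.

Definition ksplit_poly (k : nat) (la : seq nat) : sym F :=
  foldr bpart 1 (ksplit k la).

(* T is T_j^(k) on Lambda_t^(k); its values elsewhere are arbitrary. *)
Definition is_ktop (k j : nat) (T : sym F -> sym F) : Prop :=
  (forall (a : F) (f g : sym F), symkt k f -> symkt k g ->
     T (a *: f + g) = a *: T f + T g) /\
  (forall la, kbounded k la ->
     T (ksplit_poly k la) =
       if head 0%N la == j then ksplit_poly k la else 0).

Definition ktop (k j : nat) : sym F -> sym F :=
  epsilon (inhabits id) (is_ktop k j).

Definition kschur_t (k : nat) (la : seq nat) : sym F :=
  foldr (fun r f => ktop k r (bern r%:Z f)) 1 la.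

End VertexOperators.
End SymmetricFunctions.

Notation Qq := {fraction {poly rat}}.

(* Q(q, t), as Q(q)(t) *)
Notation Qqt := {fraction {poly Qq}}.

Definition tvar : Qqt := tofrac 'X.

Definition has_value_at_t1 (r : Qqt) (c : rat) : Prop :=
  exists n d : {poly Qq},
    [/\ d.[1] != 0, r = tofrac n / tofrac d & n.[1] / d.[1] = ratr c].

(* Unspecified when r has a pole at t = 1 or a value there outside of Q. *)
Definition at_t1 (r : Qqt) : rat := epsilon (inhabits 0) (has_value_at_t1 r).

Definition kschur (k : nat) (la : seq nat) : sym rat :=
  let f := kschur_t tvar k la in
  \sum_(m <- msupp f) << at_t1 f@_m *g m >>.

(* The classes of the b i, for i in J, form a basis of the quotient A / I, where
   I is a subspace of A. *)
Definition basis_of_quotient (K : fieldType) (V : lmodType K) (X : eqType)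
    (A I : V -> Prop) (J : pred X) (b : X -> V) : Prop :=
  [/\ forall i, J i -> A (b i),
      forall (s : seq X) (c : X -> K), uniq s -> all J s ->
        I (\sum_(i <- s) c i *: b i) -> forall i, i \in s -> c i = 0
    & forall f, A f -> exists (s : seq X) (c : X -> K),
        all J s /\ I (f - \sum_(i <- s) c i *: b i)].

(* Main.v *)
(* At t = 1 the operator B_n is multiplication by h_n, so G_rho is a product of
   Schur functions and T_j is the projection onto the G_rho with rho_1 = j.
   Order the monomials h_rho lexicographically, largest parts first.  By the
   determinant expansion, G_rho, the rectangular Schur functions, and hence, by
   induction, the k-Schur functions at t = 1 have the form h_rho + (higher
   k-bounded terms).  This form is multiplicative, so the products of rectangular
   Schur functions with irreducible k-Schur functions form a basis of
   Lambda^(k) indexed by all k-bounded partitions; multiplication by a rectangle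
   maps this basis to itself, and the ideal is spanned by the elements that
   involve at least one rectangle.
   To specialize T_j at t = 1 one needs the G_rho to be a basis of Lambda_t^(k).
   Let q_n = h_n[X(1-t)] and let A be the space of the f killed by q_n^perp for
   all n > k.  The commutation of q_n^perp with B_m shows that B_m preserves A
   for m <= k, so A contains all H_rho and G_rho with rho k-bounded.  An f in A is
   determined by its pairings with the products q_rho, rho k-bounded, and both
   families are independent because they are so at t = 1; by dimension both are
   bases of A, and the coordinates of an element of A which is finite at t = 1
   are themselves finite there. *)
Require Import Defs.
From mathcomp Require Import all_boot all_order all_algebra.
From mathcomp Require Import fingroup perm finmap.
From mathcomp.multinomials Require Import monalg.
From mathcomp Require Import zify ring.
From Stdlib Require Import Classical ClassicalEpsilon.

Set Implicit Arguments.
Unset Strict Implicit.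
Unset Printing Implicit Defensive.

Import Order.TTheory GRing.Theory Num.Theory.

Local Open Scope ring_scope.

(** Independence passes from t = 1 to generic t, because a determinant that is nonzero at t = 1 is
    nonzero; spanning does not. Hence the dimension bound at generic t through A: as no 1 - t^r
    vanishes, the q_n generate the whole ring, and a product with a factor q_n, n > k, is orthogonal
    to A. The same determinant is a unit of the valuation ring at t = 1, so Cramer's formula makes
    coordinates finite. The basis property also yields that T_j exists, without which the [epsilon]
    defining it would carry no information. At t = 1 the computations take place before the ring map
    p_i -> h_i, called [Phi]: a polynomial in the h_i becomes a polynomial in free variables, and
    its leading form a statement about exponents. Injectivity of [Phi] brings the results back to
    symmetric functions. Evaluation at t = 1 is only partially defined on rational functions, so it
    appears as a relation, the graph of the residue map of a place. *)

Notation mon := {cmonom nat}.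

(** * Additive weights of monomials *)

Section WeightedSums.
Implicit Types m n : mon.

(** The weights [succn] give the degree [cmwgt]; the weights [W ^ i] give the numerical key that
    orders monomials. *)
Definition wsum (w : nat -> nat) (m : mon) : nat :=
  (\sum_(i <- finsupp m) m i * w i)%N.

Lemma wsumEw (d : {fset nat}) w m :
  (finsupp m `<=` d)%fset -> wsum w m = (\sum_(i <- d) m i * w i)%N.
Proof.
move=> sub; rewrite /wsum (big_fset_incl _ sub) // => i _.
by rewrite -cmE_eq0 => /eqP ->.
Qed.

Lemma wsumM w m n : wsum w (mulcm m n) = (wsum w m + wsum w n)%N.
Proof.
rewrite (@wsumEw (finsupp m `|` finsupp n)%fset) ?(mdomD m n) //.
rewrite (@wsumEw (finsupp m `|` finsupp n)%fset w m) ?fsubsetUl //.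
rewrite (@wsumEw (finsupp m `|` finsupp n)%fset w n) ?fsubsetUr //.
by rewrite -big_split /=; apply: eq_bigr => i _; rewrite mulcmE mulnDl.
Qed.

Lemma wsum1 w : wsum w (onecm nat) = 0%N.
Proof. by rewrite /wsum (_ : finsupp _ = fset0) ?big_seq_fset0 // (@mdom1 nat). Qed.

Lemma wsumU w i : wsum w (ucm i) = w i.
Proof. by rewrite /wsum mdomU big_seq_fset1 ucmE eqxx mul1n. Qed.

Lemma wsum_ge w m i : (m i * w i <= wsum w m)%N.
Proof.
have [im|im] := boolP (i \in finsupp m); last by move: im; rewrite -cmE_eq0 => /eqP ->.
by rewrite /wsum (big_fsetD1 i) //= leq_addr.
Qed.

Lemma cmwgtM m n : cmwgt (mulcm m n) = (cmwgt m + cmwgt n)%N.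
Proof. exact: (wsumM succn). Qed.

Lemma cmwgtU i : cmwgt (ucm i) = i.+1.
Proof. exact: (wsumU succn). Qed.

Lemma cmwgt1 : cmwgt (onecm nat) = 0%N.
Proof. exact: (wsum1 succn). Qed.

Lemma mulIcm (n m1 m2 : mon) : mulcm m1 n = mulcm m2 n -> m1 = m2.
Proof.
move=> E; apply/eqP/cmP => i; have := congr1 (fun m : mon => m i) E.
by rewrite !mulcmE => /addIn.
Qed.

Lemma cmwgt_eq0 m : (cmwgt m == 0%N) = (m == onecm nat).
Proof.
apply/eqP/eqP => [m0|->]; last exact: cmwgt1.
by apply/eqP/cmP => i; have := @wsum_ge succn m i; rewrite onecmE {1}/wsum -/(cmwgt m) m0; lia.
Qed.

End WeightedSums.

(* Conversion on finitely supported functions is intractable, so all the work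
   takes place in an opaque isomorphic copy of the ring of symmetric functions. *)
Record symCopy (F : fieldType) := SymCopy {
  copy :> comAlgType F;
  into : sym F -> copy;
  out : copy -> sym F;
  intoK : cancel into out;
  outK : cancel out into;
  outZD : forall a f g, out (a *: f + g) = a *: out f + out g;
  outM : forall f g, out (f * g) = out f * out g;
  out1 : out 1 = 1;
  cf : mon -> copy -> F;
  cfE : forall m f, cf m f = (out f)@_m;
  supp : copy -> {fset mon};
  suppE : forall f, supp f = msupp (out f);
  X : mon -> copy;
  XE : forall m, X m = into << m >>;
  ip : copy -> copy -> F;
  ipE : forall f g, ip f g = hall (out f) (out g);
  adj : copy -> copy -> copy;
  adjE : forall f g, adj f g = into (perp (out f) (out g)) }.
Arguments into {F s}.
Arguments out {F s}.
Arguments cf {F s}.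
Arguments X {F s}.
Arguments ip {F s}.
Arguments adj {F s}.
Arguments supp {F s}.

Lemma symCopy_exists (F : fieldType) : symCopy F.
Proof.
by exists ({malg F[{cmonom nat}]} : comAlgType F) id id
  (fun m f => f@_m) (@msupp mon F) (fun m => << m >>) (@hall F) (@perp F).
Qed.

(** * Coefficients in the copy of the ring *)

Section Coefficients.
Implicit Types m n : mon.
Variables (F : fieldType) (S : symCopy F).
Implicit Types f g h u : S.

Local Notation inS := (@into F S).
Local Notation outS := (@out F S).
Lemma inSK : cancel inS outS. Proof. exact: intoK. Qed.
Lemma outSK : cancel outS inS. Proof. exact: outK. Qed.

Lemma outS1 : outS 1 = 1. Proof. exact: out1. Qed.
Lemma outSM f g : outS (f * g) = outS f * outS g. Proof. exact: outM. Qed.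
Lemma outSZD a f g : outS (a *: f + g) = a *: outS f + outS g.
Proof. exact: outZD. Qed.
Lemma outSD f g : outS (f + g) = outS f + outS g.
Proof. by have := outSZD 1 f g; rewrite !scale1r. Qed.
Lemma outS0 : outS 0 = 0.
Proof. by apply: (addIr (outS 0)); rewrite -outSD !add0r. Qed.
Lemma outSZ a f : outS (a *: f) = a *: outS f.
Proof. by have := outSZD a f 0; rewrite !addr0 outS0 addr0. Qed.
Lemma outS_sum (I : Type) (r : seq I) (P : pred I) (G : I -> S) :
  outS (\sum_(i <- r | P i) G i) = \sum_(i <- r | P i) outS (G i).
Proof. exact: (big_morph _ outSD outS0). Qed.
Lemma inS1 : inS 1 = 1. Proof. by rewrite -outS1 outSK. Qed.
Lemma inS0 : inS 0 = 0. Proof. by rewrite -outS0 outSK. Qed.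
Lemma inSM (f g : sym F) : inS (f * g) = inS f * inS g.
Proof. by apply: (can_inj outSK); rewrite outSM !inSK. Qed.
Lemma inSD (f g : sym F) : inS (f + g) = inS f + inS g.
Proof. by apply: (can_inj outSK); rewrite outSD !inSK. Qed.
Lemma inSZ a (f : sym F) : inS (a *: f) = a *: inS f.
Proof. by apply: (can_inj outSK); rewrite outSZ !inSK. Qed.
Lemma inS_sum (I : Type) (r : seq I) (P : pred I) (G : I -> sym F) :
  inS (\sum_(i <- r | P i) G i) = \sum_(i <- r | P i) inS (G i).
Proof. exact: (big_morph _ inSD inS0). Qed.
Lemma inS_prod (I : Type) (r : seq I) (P : pred I) (G : I -> sym F) :
  inS (\prod_(i <- r | P i) G i) = \prod_(i <- r | P i) inS (G i).
Proof. exact: (big_morph _ inSM inS1). Qed.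
Lemma inSX (f : sym F) (n : nat) : inS (f ^+ n) = inS f ^+ n.
Proof. by elim: n => [|n IH]; rewrite ?inS1 // !exprS inSM IH. Qed.

Lemma cfD m f g : cf m (f + g) = cf m f + cf m g.
Proof. by rewrite !cfE outSD mcoeffD. Qed.
Lemma cfZ m c f : cf m (c *: f) = c * cf m f.
Proof. by rewrite !cfE outSZ mcoeffZ. Qed.
Lemma cf0 m : cf m (0 : S) = 0.
Proof. by rewrite !cfE outS0 mcoeff0. Qed.
Lemma cfX m n : cf m (X n : S) = (n == m)%:R.
Proof. by rewrite cfE XE inSK mcoeffU1. Qed.
Lemma cfP f g : (forall m, cf m f = cf m g) -> f = g.
Proof. by move=> E; apply: (can_inj outSK); apply/malgP => m; rewrite -!cfE. Qed.
Lemma supp_cf f m : (m \in supp f) = (cf m f != 0).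
Proof. by rewrite suppE cfE mcoeff_neq0. Qed.
Lemma cf_notin f m : m \notin supp f -> cf m f = 0.
Proof. by rewrite supp_cf negbK => /eqP. Qed.
Lemma cfN m f : cf m (- f) = - cf m f.
Proof. by rewrite -scaleN1r cfZ mulN1r. Qed.
Lemma cf_sum (I : Type) (r : seq I) (P : pred I) (G : I -> S) m :
  cf m (\sum_(i <- r | P i) G i) = \sum_(i <- r | P i) cf m (G i).
Proof. exact: (big_morph _ (cfD m) (cf0 m)). Qed.

Lemma X1 : X (onecm nat) = 1 :> S. Proof. by rewrite XE inS1. Qed.
Lemma XM m n : X (mulcm m n) = X m * X n :> S.
Proof. by rewrite !XE -inSM malgM_def fgmulUU mulr1. Qed.

Lemma cfM_neq0 m f g : cf m (f * g) != 0 ->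
  exists n l, [/\ cf n f != 0, cf l g != 0 & m = mulcm n l].
Proof.
rewrite !cfE outSM mcoeff_neq0 => /msuppM_le [n [l []]].
by rewrite -!mcoeff_neq0 -!cfE => nf lg ->; exists n, l.
Qed.

Lemma ipEw (d : {fset mon}) f g : (supp f `<=` d)%fset ->
  ip f g = \sum_(m <- d) (zcm m)%:R * cf m f * cf m g.
Proof.
rewrite suppE => sub; rewrite ipE /hall (big_fset_incl _ sub).
  by apply: eq_bigr => m _; rewrite !cfE.
by move=> m _ /mcoeff_outdom ->; rewrite mulr0 mul0r.
Qed.

Lemma adjP f g u : [pchar F] =i pred0 -> ip (adj f g) u = ip g (f * u).
Proof. by move=> F0; rewrite !ipE adjE outSM inSK perpP. Qed.

End Coefficients.

(** * The Hall pairing and its adjoints *)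

Section HallAdjoint.
Implicit Types m n : mon.
Variables (F : fieldType) (S : symCopy F).
Implicit Types f g h u : S.

Lemma expandX f : f = \sum_(m <- supp f) cf m f *: X m.
Proof.
apply: cfP => m; rewrite cf_sum.
have [mf|mf] := boolP (m \in supp f).
  rewrite (bigD1_seq m) ?fset_uniq //= cfZ cfX eqxx mulr1 big1 ?addr0 // => l /negPf lm.
  by rewrite cfZ cfX lm mulr0.
rewrite big1_seq => [|l /andP[_ lf]]; first exact: cf_notin.
rewrite cfZ cfX; case: eqP => [E|_]; rewrite ?mulr0 //.
by rewrite -E lf in mf.
Qed.

Lemma symind (P : S -> Prop) : P 0 ->
  (forall c m f, P f -> P (c *: X m + f)) -> forall f, P f.
Proof.
move=> P0 PD f; rewrite [f]expandX; elim: (enum_fset _) => [|m s IH].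
  by rewrite big_nil.
by rewrite big_cons; apply: PD.
Qed.

Lemma cfMX f n m : cf (mulcm m n) (f * X n) = cf m f.
Proof.
elim/symind: f => [|c l f IH]; first by rewrite mul0r !cf0.
rewrite mulrDl !cfD IH -scalerAl -XM !cfZ !cfX; congr (_ * _%:R + _).
by congr (nat_of_bool _); apply/eqP/eqP => [/mulIcm|->].
Qed.

Lemma cfD_neq0 m f g : cf m (f + g) != 0 -> cf m f != 0 \/ cf m g != 0.
Proof.
rewrite cfD; have [->|] := eqVneq (cf m f) 0; last by left.
by rewrite add0r; right.
Qed.

Lemma cf_sum_neq0 (I : eqType) (r : seq I) (P : pred I) (G : I -> S) m :
  cf m (\sum_(i <- r | P i) G i) != 0 ->
  exists i, [/\ i \in r, P i & cf m (G i) != 0].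
Proof.
rewrite cf_sum => /eqP H; apply: NNPP => N; apply: H.
rewrite big1_seq // => i /andP[Pi ir]; apply/eqP; apply/negPn/negP => H.
by apply: N; exists i.
Qed.

Lemma ipC f g : ip f g = ip g f.
Proof.
rewrite (@ipEw _ _ (supp f `|` supp g)%fset) ?fsubsetUl //.
rewrite (@ipEw _ _ (supp f `|` supp g)%fset g) ?fsubsetUr //.
by apply: eq_bigr => m _; rewrite -!mulrA [cf m f * _]mulrC.
Qed.

Lemma ip_neq0 f g : ip f g != 0 -> exists2 m, cf m f != 0 & cf m g != 0.
Proof.
rewrite (ipEw _ (fsubset_refl _)) => /eqP H; apply: NNPP => N; apply: H.
rewrite big1_seq // => m /andP[_]; rewrite supp_cf => mf.
have [->|mg] := eqVneq (cf m g) 0; first by rewrite mulr0.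
by case: N; exists m.
Qed.

Lemma ipDr f g h : ip f (g + h) = ip f g + ip f h.
Proof.
rewrite !(ipEw _ (fsubset_refl _)) -big_split.
by apply: eq_bigr => m _; rewrite cfD mulrDr.
Qed.
Lemma ipZr c f g : ip f (c *: g) = c * ip f g.
Proof.
rewrite !(ipEw _ (fsubset_refl _)) mulr_sumr.
by apply: eq_bigr => m _; rewrite cfZ mulrCA.
Qed.
Lemma ip0r f : ip f 0 = 0.
Proof. by rewrite -(scale0r (0 : S)) ipZr mul0r. Qed.
Lemma ipDl f g h : ip (f + g) h = ip f h + ip g h.
Proof. by rewrite ![ip _ h]ipC ipDr. Qed.
Lemma ipZl c f g : ip (c *: f) g = c * ip f g.
Proof. by rewrite ![ip _ g]ipC ipZr. Qed.
Lemma ip0l f : ip 0 f = 0.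
Proof. by rewrite ipC ip0r. Qed.

Lemma ipX f m : ip f (X m) = (zcm m)%:R * cf m f.
Proof.
rewrite ipC (@ipEw _ _ [fset m]%fset) ?big_seq_fset1.
  by rewrite cfX eqxx mulr1.
apply/fsubsetP => l; rewrite supp_cf cfX in_fset1.
by rewrite [m == l]eq_sym; case: (l == m) => //; rewrite eqxx.
Qed.

Section Adjoint.
Hypothesis F0 : [pchar F] =i pred0.

Lemma natF0 (n : nat) : (n%:R == 0 :> F) = (n == 0%N).
Proof. by move: n; apply/pcharf0P. Qed.

Lemma zcmF0 m : (zcm m)%:R != 0 :> F.
Proof. by rewrite natF0 -lt0n zcm_gt0. Qed.

(** The power sum products are orthogonal with norms z_m, nonzero in characteristic 0. Nondegeneracy
    reduces identities between adjoints to identities between products. *)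
Lemma ip_inj f g : (forall u, ip f u = ip g u) -> f = g.
Proof.
move=> E; apply: cfP => m; have := E (X m).
by rewrite !ipX; apply: mulfI; apply: zcmF0.
Qed.

Lemma adjDr f g h : adj f (g + h) = adj f g + adj f h.
Proof. by apply: ip_inj => u; rewrite ipDl !(adjP _ _ _ F0) ipDl. Qed.
Lemma adjZr c f g : adj f (c *: g) = c *: adj f g.
Proof. by apply: ip_inj => u; rewrite ipZl !(adjP _ _ _ F0) ipZl. Qed.
Lemma adjDl f g h : adj (f + g) h = adj f h + adj g h.
Proof. by apply: ip_inj => u; rewrite ipDl !(adjP _ _ _ F0) mulrDl ipDr. Qed.
Lemma adjZl c f g : adj (c *: f) g = c *: adj f g.
Proof. by apply: ip_inj => u; rewrite ipZl !(adjP _ _ _ F0) -scalerAl ipZr. Qed.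
Lemma adj0l f : adj 0 f = 0.
Proof. by apply: ip_inj => u; rewrite (adjP _ _ _ F0) mul0r ip0r ip0l. Qed.
Lemma adj0r f : adj f 0 = 0.
Proof. by apply: ip_inj => u; rewrite (adjP _ _ _ F0) !ip0l. Qed.
Lemma adj_sumr f (I : Type) (r : seq I) (P : pred I) (G : I -> S) :
  adj f (\sum_(i <- r | P i) G i) = \sum_(i <- r | P i) adj f (G i).
Proof. exact: (big_morph _ (adjDr f) (adj0r f)). Qed.
Lemma adj_suml f (I : Type) (r : seq I) (P : pred I) (G : I -> S) :
  adj (\sum_(i <- r | P i) G i) f = \sum_(i <- r | P i) adj (G i) f.
Proof. by elim/big_rec2: _ => [|i y x _ <-]; rewrite ?adj0l ?adjDl. Qed.
Lemma adjM f g h : adj (f * g) h = adj g (adj f h).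
Proof. by apply: ip_inj => u; rewrite !(adjP _ _ _ F0) mulrA. Qed.
Lemma adjC f g h : adj f (adj g h) = adj g (adj f h).
Proof. by rewrite -!adjM mulrC. Qed.
Lemma adj1l f : adj 1 f = f.
Proof. by apply: ip_inj => u; rewrite (adjP _ _ _ F0) mul1r. Qed.

Lemma cf_adj m f g : cf m (adj f g) = ip g (f * X m) / (zcm m)%:R.
Proof. by rewrite -(adjP _ _ _ F0) ipX mulrC mulKf // zcmF0. Qed.

Lemma cf_adj_neq0 f g w : cf w (adj f g) != 0 ->
  exists m n, [/\ cf n f != 0, cf m g != 0 & m = mulcm n w].
Proof.
rewrite cf_adj mulf_eq0 negb_or => /andP[/ip_neq0[m mg /cfM_neq0[n [l [nf + +]]]] _].
by rewrite cfX; have [<- _ E|_] := eqVneq w l; rewrite ?eqxx //; exists m, n.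
Qed.

Lemma zcmMU r m : zcm (mulcm m (ucm r)) = (zcm m * (r.+1 * (m r).+1))%N.
Proof.
have zcmEw (d : {fset nat}) (n : mon) : (finsupp n `<=` d)%fset ->
    zcm n = (\prod_(i <- d) (i.+1 ^ n i * (n i)`!))%N.
  move=> sub; rewrite /zcm (big_fset_incl _ sub) // => i _.
  by rewrite -cmE_eq0 => /eqP ->.
rewrite (zcmEw (r |` finsupp m)%fset); last first.
  by rewrite (mdomD m (ucm r)) mdomU fsetUC.
rewrite (zcmEw (r |` finsupp m)%fset m) ?fsubsetU1 //.
rewrite [LHS](big_fsetD1 r) ?fset1U1 // [in RHS](big_fsetD1 r) ?fset1U1 //.
rewrite mulcmE ucmE eqxx addn1.
rewrite [X in (_ * X = _)%N](eq_big_seq (fun i => (i.+1 ^ m i * (m i)`!)%N)); last first.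
  by move=> i; rewrite in_fsetD1 => /andP[/negPf ir _]; rewrite mulcmE ucmE eq_sym ir addn0.
rewrite expnS factS /=; move: (\prod_(_ <- _) _)%N => q; nia.
Qed.

(** Coefficientwise this is p_n^perp = n d/dp_n for n = r + 1; the factor is the quotient of
    z-numbers from [zcmMU]. *)
Lemma cf_adjX r f m :
  cf m (adj (X (ucm r)) f) = (r.+1 * (m r).+1)%:R * cf (mulcm m (ucm r)) f.
Proof.
rewrite cf_adj mulrC [X in ip _ X]mulrC -XM ipX zcmMU natrM -!mulrA mulKf ?zcmF0 //.
Qed.

End Adjoint.
End HallAdjoint.

(** * Power sum substitutions and complete homogeneous functions *)

Section MonomialSupport.
Implicit Types m n : mon.

Lemma big_finsupp_ord (R : Type) (idx : R) (op : Monoid.com_law idx)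
    (G : nat -> R) (m : mon) (n : nat) :
  (forall i, m i != 0%N -> (i < n)%N) -> (forall i, m i = 0%N -> G i = idx) ->
  \big[op/idx]_(i <- finsupp m) G i = \big[op/idx]_(i < n) G i.
Proof.
move=> mn G0; rewrite -(big_mkord xpredT G).
rewrite (bigID (fun i => m i == 0%N)) /= big1 => [|i /eqP]; last exact: G0.
rewrite [RHS](bigID (fun i => m i == 0%N)) /= [X in _ = op X _]big1 => [|i /eqP]; last exact: G0.
congr (op _ _); rewrite -big_filter -[RHS]big_filter (perm_big [seq i <- index_iota 0 n | m i != 0%N]) //.
apply: uniq_perm.
- by rewrite filter_uniq ?fset_uniq.
- by rewrite filter_uniq ?iota_uniq.
move=> i; rewrite !mem_filter mem_index_iota leq0n /=.
case: eqVneq => //= mi; rewrite (mn i mi).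
by rewrite -cmE_neq0 mi.
Qed.

Lemma wsum_ord w m (n : nat) : (forall i, m i != 0%N -> (i < n)%N) ->
  wsum w m = (\sum_(i < n) m i * w i)%N.
Proof. by move=> mn; rewrite /wsum (big_finsupp_ord _ mn) // => i ->. Qed.

Lemma cmwgt_lt m i : m i != 0%N -> (i < cmwgt m)%N.
Proof. by move=> mi; apply: leq_trans (wsum_ge succn m i); rewrite leq_pmull ?lt0n. Qed.

Lemma cm_le_cmwgt m i : (m i <= cmwgt m)%N.
Proof. by apply: leq_trans (wsum_ge succn m i); rewrite leq_pmulr. Qed.

Lemma cmD_ucm m r : m r != 0%N -> exists n, m = mulcm n (ucm r).
Proof.
move=> mr; exists (divcm m (ucm r)); apply/eqP/cmP => i.
rewrite mulcmE divcmE ucmE; case: eqVneq => [<-|_] /=; last by rewrite addn0 subn0.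
by rewrite subnK // lt0n.
Qed.

Lemma cm_ind (P : mon -> Prop) : P (onecm nat) ->
  (forall m i, P m -> P (mulcm m (ucm i))) -> forall m, P m.
Proof.
move=> P1 PM m; have [w] := ubnP (cmwgt m); elim: w m => // w IH m.
have [/eqP|] := eqVneq (cmwgt m) 0%N; first by rewrite cmwgt_eq0 => /eqP ->.
move=> m0; have [i mi] : exists i, m i != 0%N.
  apply: NNPP => N; case/eqP: m0; apply/eqP; rewrite cmwgt_eq0; apply/cmP => i.
  by rewrite onecmE; apply/eqP/negPn/negP => H; apply: N; exists i.
have [n ->] := cmD_ucm mi; rewrite cmwgtM cmwgtU => le_w.
by apply: PM; apply: IH; lia.
Qed.

End MonomialSupport.

Section Complete.
Implicit Types m n : mon.
Variables (F : fieldType) (S : symCopy F).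
Hypothesis F0 : [pchar F] =i pred0.
Implicit Types f g u : S.

Definition expm (x : nat -> S) m : S := \prod_(i <- finsupp m) x i ^+ m i.

Lemma expm1 x : expm x (onecm nat) = 1.
Proof. by rewrite /expm (_ : finsupp _ = fset0) ?big_seq_fset0 // (@mdom1 nat). Qed.

Lemma expm_ord x m (n : nat) : (forall i, m i != 0%N -> (i < n)%N) ->
  expm x m = \prod_(i < n) x i ^+ m i.
Proof. by move=> mn; rewrite /expm (big_finsupp_ord _ mn) // => i ->. Qed.

Lemma expmM x m n : expm x (mulcm m n) = expm x m * expm x n.
Proof.
have H (l : mon) (i : nat) : l i != 0%N -> (cmwgt l <= cmwgt m + cmwgt n)%N ->
    (i < cmwgt m + cmwgt n)%N.
  by move=> /cmwgt_lt /leq_trans; apply.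
rewrite !(@expm_ord x _ (cmwgt m + cmwgt n)); first last.
- by move=> i /H; apply; rewrite cmwgtM.
- by move=> i /H; apply; rewrite leq_addr.
- by move=> i /H; apply; rewrite leq_addl.
by rewrite -big_split; apply: eq_bigr => i _; rewrite mulcmE exprD.
Qed.

Lemma expmU x i : expm x (ucm i) = x i.
Proof. by rewrite /expm mdomU big_seq_fset1 ucmE eqxx. Qed.

Lemma expmX m : expm (fun i => X (ucm i)) m = X m.
Proof.
elim/cm_ind: m => [|m i IH]; first by rewrite expm1 X1.
by rewrite expmM expmU IH XM.
Qed.

Section Linear.
Variables (V : lmodType F) (E : mon -> V).

(** Besides extending a map on monomials linearly, [lin] encodes linear combinations: for a family
    [E] indexed by monomials, f is the coordinate vector of [lin E f]. *)
Definition lin f : V := \sum_(m <- supp f) cf m f *: E m.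

Lemma linEw (d : {fset mon}) f : (supp f `<=` d)%fset ->
  lin f = \sum_(m <- d) cf m f *: E m.
Proof.
move=> sub; rewrite /lin (big_fset_incl _ sub) // => m _ /cf_notin ->.
by rewrite scale0r.
Qed.

Lemma linD f g : lin (f + g) = lin f + lin g.
Proof.
set d := (supp f `|` supp g `|` supp (f + g))%fset.
rewrite !(@linEw d) ?fsubsetUr // /d; first last.
- by rewrite -fsetUA fsubsetUl.
- by rewrite fsetUAC fsubsetUr.
by rewrite -big_split; apply: eq_bigr => m _; rewrite cfD scalerDl.
Qed.

Lemma linZ c f : lin (c *: f) = c *: lin f.
Proof.
rewrite (@linEw (supp f)) ?scaler_sumr.
  by apply: eq_bigr => m _; rewrite cfZ scalerA.
by apply/fsubsetP => m; rewrite !supp_cf cfZ mulf_eq0 negb_or => /andP[].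
Qed.

Lemma lin0 : lin 0 = 0.
Proof. by rewrite -(scale0r (0 : S)) linZ scale0r. Qed.

Lemma lin_sum (I : Type) (r : seq I) (P : pred I) (G : I -> S) :
  lin (\sum_(i <- r | P i) G i) = \sum_(i <- r | P i) lin (G i).
Proof. exact: (big_morph _ linD lin0). Qed.

Lemma linX m : lin (X m) = E m.
Proof.
rewrite (@linEw [fset m]%fset) ?big_seq_fset1 ?cfX ?eqxx ?scale1r //.
apply/fsubsetP => l; rewrite supp_cf cfX in_fset1 [l == m]eq_sym.
by case: (m == l) => //; rewrite eqxx.
Qed.
End Linear.

Definition subst (x : nat -> S) : S -> S := lin (expm x).

Lemma substD x f g : subst x (f + g) = subst x f + subst x g.
Proof. exact: linD. Qed.
Lemma substZ x c f : subst x (c *: f) = c *: subst x f.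
Proof. exact: linZ. Qed.
Lemma subst0 x : subst x 0 = 0.
Proof. exact: lin0. Qed.
Lemma subst_sum x (I : Type) (r : seq I) (P : pred I) (G : I -> S) :
  subst x (\sum_(i <- r | P i) G i) = \sum_(i <- r | P i) subst x (G i).
Proof. exact: lin_sum. Qed.
Lemma substX x m : subst x (X m) = expm x m.
Proof. exact: linX. Qed.

Lemma subst1 x : subst x 1 = 1.
Proof. by rewrite -[X in subst x X]X1 substX expm1. Qed.

Lemma substM x f g : subst x (f * g) = subst x f * subst x g.
Proof.
elim/symind: f => [|c m f IH]; first by rewrite mul0r subst0 mul0r.
rewrite mulrDl !substD IH mulrDl; congr (_ + _).
rewrite -scalerAl !substZ -scalerAl; congr (_ *: _).
elim/symind: g {IH} => [|d n g IH]; first by rewrite mulr0 subst0 mulr0.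
rewrite mulrDr !substD IH mulrDr; congr (_ + _).
by rewrite -scalerAr !substZ -XM !substX expmM -scalerAr.
Qed.

Lemma subst_prod x (I : Type) (r : seq I) (P : pred I) (G : I -> S) :
  subst x (\prod_(i <- r | P i) G i) = \prod_(i <- r | P i) subst x (G i).
Proof. exact: (big_morph _ (substM x) (subst1 x)). Qed.

Lemma substXn x f (n : nat) : subst x (f ^+ n) = subst x f ^+ n.
Proof. by elim: n => [|n IH]; rewrite ?subst1 // !exprS substM IH. Qed.

Definition hS (n : nat) : S := into (hsym F n).

Lemma cf_h (n : nat) m :
  cf m (hS n) = if cmwgt m == n then (zcm m)%:R^-1 else 0.
Proof.
(* The monomial with exponents e; it turns the finite sum defining h_n into a sum over monomials of
   degree n. *)
pose phi (e : {ffun 'I_n -> 'I_n.+1}) : mon :=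
  \big[@mulcm nat/onecm nat]_(i < n) iter (e i) (mulcm (ucm (i : nat))) (onecm nat).
have phiE e (j : 'I_n) : phi e j = e j.
  rewrite /phi (big_morph (fun l : mon => l j) (id1 := 0%N) (op1 := addn)); first last.
  - by rewrite onecmE.
  - by move=> a b; rewrite mulcmE.
  have it (i : nat) (c : nat) : iter c (mulcm (ucm (i : nat))) (onecm nat) j = (c * (i == j))%N.
    by elim: c => [|c IH]; rewrite ?onecmE //= mulcmE IH ucmE mulSn.
  rewrite (bigD1 j) //= it eqxx muln1 big1 ?addn0 // => i /negPf ij.
  by rewrite it (_ : _ == _ = false) ?muln0.
have phi_out e j : (n <= j)%N -> phi e j = 0%N.
  move=> nj; rewrite /phi (big_morph (fun l : mon => l j) (id1 := 0%N) (op1 := addn)); first last.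
  - by rewrite onecmE.
  - by move=> a b; rewrite mulcmE.
  apply: big1 => i _; elim: (nat_of_ord (e i)) => [|c IH]; rewrite ?onecmE //= mulcmE IH ucmE.
  by rewrite addn0; case: eqP => // E; have := ltn_ord i; rewrite E ltnNge nj.
have phi_lt e i : phi e i != 0%N -> (i < n)%N.
  by apply: contraNT; rewrite -leqNgt => /phi_out ->.
have phi_wgt e : cmwgt (phi e) = (\sum_(i < n) e i * i.+1)%N.
  rewrite [LHS](wsum_ord succn (@phi_lt e)).
  by apply: eq_bigr => i _; rewrite phiE.
have -> : hS n = \sum_(e : {ffun 'I_n -> 'I_n.+1} | cmwgt (phi e) == n)
    (zcm (phi e))%:R^-1 *: X (phi e).
  rewrite /hS /hsym inS_sum; apply: eq_big => [e|e _]; first by rewrite phi_wgt.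
  rewrite inSZ; congr (_%:R^-1 *: _).
    rewrite /zcm (big_finsupp_ord _ (@phi_lt e)); last by move=> i ->; rewrite expn0 fact0.
    by apply: eq_bigr => i _; rewrite phiE.
  rewrite -expmX (expm_ord _ (@phi_lt e)) inS_prod.
  by apply: eq_bigr => i _; rewrite inSX phiE XE.
rewrite cf_sum; case: eqP => [wm|wm].
  (* A monomial of degree n has variables of index below n and exponents at most n, so [inord] loses
     nothing. *)
  pose e0 := [ffun i : 'I_n => inord (m i) : 'I_n.+1].
  have Em : phi e0 = m.
    apply/eqP/cmP => i; have [ni|ni] := leqP n i.
      rewrite phi_out //; apply/esym/eqP; apply: contraLR ni => /cmwgt_lt.
      by rewrite wm -ltnNge.
    have := phiE e0 (Ordinal ni); rewrite ffunE /= inordK => [->|] //.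
    by rewrite ltnS -wm cm_le_cmwgt.
  rewrite (bigD1 e0) /=; last by rewrite Em wm.
  rewrite cfZ cfX Em eqxx mulr1 big1 ?addr0 // => e /andP[_ ne].
  rewrite cfZ cfX; case: eqP => [E|_]; last by rewrite mulr0.
  case/eqP: ne; apply/ffunP => i; apply: val_inj => /=.
  by rewrite -phiE E -Em phiE.
apply: big1 => e /eqP we; rewrite cfZ cfX; case: eqP => [E|_]; last by rewrite mulr0.
by case: wm; rewrite -E.
Qed.

Lemma hS0 : hS 0 = 1.
Proof.
apply: cfP => m; rewrite cf_h -X1 cfX cmwgt_eq0 eq_sym.
case: eqP => // <-; rewrite /zcm (_ : finsupp _ = fset0) ?big_seq_fset0 ?invr1 //.
by rewrite (@mdom1 nat).
Qed.

(* This recursion characterizes the family h_n[cX], where p_r[cX] = c_(r-1) p_r. *)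
Definition newton (c : nat -> F) (x : nat -> S) : Prop :=
  x 0%N = 1 /\ forall n : nat, n%:R *: x n =
    \sum_(r < n) c r *: (X (ucm (r : nat)) * x (n - r.+1)%N).

(** For m of degree n, the coefficient on the right is the sum over r of (r + 1) (m r) / z_m, that
    is n / z_m. *)
Lemma newton_h : newton (fun _ => 1) hS.
Proof.
split=> [|n]; first exact: hS0.
apply: cfP => m; rewrite cfZ cf_h cf_sum.
have -> : \sum_(r < n) cf m (1 *: (X (ucm (r : nat)) * hS (n - r.+1)%N)) =
   \sum_(r < n) if cmwgt m == n then (m r * r.+1)%:R / (zcm m)%:R else 0.
  apply: eq_bigr => r _; rewrite scale1r.
  have [mr|/cmD_ucm[l El]] := eqVneq (m r) 0%N.
    rewrite mr mul0n mul0r; case: ifP => _; apply/eqP/negPn/negP;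
      move=> /cfM_neq0[a [b []]]; rewrite cfX;
      have [<- _ _ E|_] := eqVneq (ucm _) a; rewrite ?eqxx //;
      by move: mr; rewrite E mulcmE ucmE eqxx.
  rewrite mulrC El cfMX cf_h cmwgtM cmwgtU.
  have -> : (cmwgt l == n - r.+1)%N = (cmwgt l + r.+1 == n)%N.
    by apply/eqP/eqP; have := ltn_ord r; lia.
  case: eqP => // _; rewrite zcmMU mulcmE ucmE eqxx addn1 [((l r).+1 * _)%N]mulnC.
  rewrite [(zcm l * _)%:R]natrM invfM mulrCA mulfV ?mulr1 //.
  by rewrite natF0.
case: eqP => [wm|_]; last by rewrite mulr0 big1.
rewrite -mulr_suml -natr_sum -{1}wm [cmwgt m](wsum_ord succn (n := n)) //.
by move=> i /cmwgt_lt; rewrite wm.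
Qed.

Lemma newton_subst c x d : newton d x ->
  newton (fun r => c r * d r) (fun n : nat => subst (fun i : nat => c i *: X (ucm i)) (x n)).
Proof.
move=> [x0 xn]; split=> [|n]; first by rewrite x0 subst1.
rewrite -substZ xn subst_sum; apply: eq_bigr => r _.
by rewrite substZ substM substX expmU -scalerAl scalerA mulrC.
Qed.

Definition pderiv (r : nat) : S -> S := adj (X (ucm r)).

Lemma pderivM r f g : pderiv r (f * g) = pderiv r f * g + f * pderiv r g.
Proof.
(* The truncated division is harmless: if variable r is absent from m, the scalar is 0. *)
have dX1 m : pderiv r (X m) = (r.+1 * m r)%:R *: X (divcm m (ucm r)).
  apply: cfP => l; rewrite cf_adjX // cfX cfZ cfX.
  have [Em|mN] := eqVneq m _.
    have -> : divcm m (ucm r) = l.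
      by apply/eqP/cmP => i; rewrite divcmE Em mulcmE addnK.
    by rewrite Em eqxx mulcmE ucmE eqxx addn1.
  rewrite mulr0; have [->|/cmD_ucm[n En]] := eqVneq (m r) 0%N; first by rewrite muln0 mul0r.
  case: eqP => [El|_]; last by rewrite mulr0.
  case/eqP: mN; rewrite -El; apply/eqP/cmP => i.
  by rewrite En mulcmE divcmE mulcmE addnK.
have dXM m n : pderiv r (X m * X n) = pderiv r (X m) * X n + X m * pderiv r (X n).
  rewrite -XM !dX1 mulcmE mulnDr natrD scalerDl -scalerAl -scalerAr -!XM.
  congr (_ + _).
    have [->|/cmD_ucm[l ->]] := eqVneq (m r) 0%N; first by rewrite muln0 !scale0r.
    by congr (_ *: X _); apply/eqP/cmP => i; rewrite !divcmE !mulcmE ?divcmE ?mulcmE addnAC !addnK.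
  have [->|/cmD_ucm[l ->]] := eqVneq (n r) 0%N; first by rewrite muln0 !scale0r.
  by congr (_ *: X _); apply/eqP/cmP => i; rewrite !divcmE !mulcmE ?divcmE ?mulcmE addnA !addnK.
have [D0 [DD DZ]] : pderiv r 0 = 0 /\ {morph pderiv r : x y / x + y} /\
    forall c x, pderiv r (c *: x) = c *: pderiv r x.
  by split; [exact: adj0r | split; [move=> x y; exact: adjDr | move=> c x; exact: adjZr]].
elim/symind: f => [|c m f IH]; first by rewrite mul0r D0 !mul0r add0r.
rewrite mulrDl !DD IH !mulrDl addrACA; congr (_ + _).
rewrite -scalerAl !DZ -!scalerAl -scalerDr; congr (_ *: _).
elim/symind: g {IH} => [|d n g IH]; first by rewrite mulr0 D0 !mulr0 addr0.
rewrite mulrDr !DD IH !mulrDr addrACA; congr (_ + _).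
by rewrite -scalerAr !DZ -!scalerAr -scalerDr dXM.
Qed.

Lemma pderiv_h r (n : nat) :
  pderiv r (hS n) = if (r < n)%N then hS (n - r.+1)%N else 0.
Proof.
apply: cfP => m; rewrite cf_adjX // cf_h cmwgtM cmwgtU zcmMU.
have [rn|rn] := ltnP r n; last first.
  rewrite cf0 (_ : _ == _ = false) ?mulr0 //.
  by apply/eqP; lia.
rewrite cf_h.
have -> : (cmwgt m == n - r.+1)%N = (cmwgt m + r.+1 == n)%N by apply/eqP/eqP; lia.
case: ifP => _; last by rewrite mulr0.
by rewrite [(zcm m * _)%:R]natrM invfM mulrCA mulfV ?mulr1 // natF0.
Qed.

End Complete.

(** * The operators q_n^perp and B_m *)

Section Reindex.
Variable V : nmodType.

Lemma sum_diag (M : nat) (T : nat -> nat -> V) :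
  \sum_(i < M) \sum_(l < M - i) T i l = \sum_(s < M) \sum_(i < s.+1) T i (s - i)%N.
Proof.
elim: M => [|M IH]; first by rewrite !big_ord0.
rewrite big_ord_recr [RHS]big_ord_recr -IH /= subSnn big_ord1.
rewrite [X in _ = _ + X]big_ord_recr /= subnn addrA -big_split /=.
congr (_ + _); apply: eq_bigr => i _.
by rewrite subSn ?big_ord_recr // ltnW.
Qed.

Lemma sum_antidiag (n : nat) (T : nat -> nat -> V) :
  \sum_(i < n) \sum_(l < n - i) T i l = \sum_(l < n) \sum_(i < n - l) T i l.
Proof.
transitivity (\sum_(i < n) \sum_(l < n | (l < n - i)%N) T i l).
  by apply: eq_bigr => i _; rewrite (big_ord_widen n (T i)) ?leq_subr.
rewrite (exchange_big_dep xpredT) //=; apply: eq_bigr => l _.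
rewrite (big_ord_widen n (T^~ l)) ?leq_subr //.
by apply: eq_bigl => i; rewrite !ltn_subRL addnC.
Qed.

Lemma sum_shift (n : nat) (T : nat -> nat -> nat -> V) :
  \sum_(i < n.+1) \sum_(r < i) T r (i - r.+1)%N (n - i)%N =
  \sum_(r < n) \sum_(i < n - r) T r i (n - r.+1 - i)%N.
Proof.
rewrite big_ord_recl big_ord0 add0r.
transitivity (\sum_(i < n) \sum_(r < i.+1) T r (i - r)%N (n - i.+1)%N) => //.
transitivity (\sum_(s < n) \sum_(i < s.+1) (fun r i => T r i (n - (r + i).+1)%N) (i : nat) (s - i)%N).
  by apply: eq_bigr => s _; apply: eq_bigr => i _; rewrite subnKC // -ltnS.
rewrite -(sum_diag n (fun r i => T r i (n - (r + i).+1)%N)).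
by apply: eq_bigr => r _; apply: eq_bigr => i _; rewrite -subnDA addSn.
Qed.
End Reindex.

(** Multiply the term (i, j) with i + j = n by i + j and use one recursion for each summand. An
    abstract [B] covers products of two families as well as products of their adjoints. *)
Lemma conv_newton (F : fieldType) (V : lmodType F) (B : nat -> nat -> V)
    (A1 A2 : nat -> nat -> nat -> V) :
  (forall i j : nat, i%:R *: B i j = \sum_(r < i) A1 r (i - r.+1)%N j) ->
  (forall i j : nat, j%:R *: B i j = \sum_(r < j) A2 r i (j - r.+1)%N) ->
  forall n : nat, n%:R *: (\sum_(i < n.+1) B i (n - i)%N) =
    \sum_(r < n) \sum_(i < n - r) (A1 r i (n - r.+1 - i)%N + A2 r i (n - r.+1 - i)%N).
Proof.
move=> E1 E2 n; rewrite scaler_sumr.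
transitivity (\sum_(i < n.+1) (\sum_(r < i) A1 r (i - r.+1)%N (n - i)%N +
    \sum_(r < n - i) A2 r i (n - i - r.+1)%N)).
  apply: eq_bigr => i _; rewrite -E1 -E2 -scalerDl -natrD subnKC //.
  by rewrite -ltnS.
rewrite big_split sum_shift /=; under [RHS]eq_bigr do rewrite big_split.
rewrite big_split /=; congr (_ + _).
rewrite big_ord_recr /= subnn big_ord0 addr0.
rewrite (sum_antidiag n (fun i r => A2 r i (n - i - r.+1)%N)).
by apply: eq_bigr => r _; apply: eq_bigr => i _; rewrite subnAC.
Qed.

Section NewtonFamilies.
Variables (F : fieldType) (S : symCopy F).
Hypothesis F0 : [pchar F] =i pred0.
Implicit Types (f g u : S) (m : mon).

Lemma natZ_inj (n : nat) : (0 < n)%N -> injective (fun f : S => n%:R *: f).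
Proof. by move=> n0 f g /= /scalerI; apply; rewrite natF0 // -lt0n. Qed.

Lemma newton_adj c (x : nat -> S) : newton c x -> forall (n : nat) f,
  n%:R *: adj (x n) f = \sum_(r < n) c r *: adj (x (n - r.+1)%N) (pderiv r f).
Proof.
move=> [_ xn] n f; rewrite -adjZl // xn adj_suml //; apply: eq_bigr => r _.
by rewrite adjZl // adjM.
Qed.

Lemma newton_conv c d (x y : nat -> S) : newton c x -> newton d y ->
  newton (fun r => c r + d r) (fun n => \sum_(i < n.+1) x i * y (n - i)%N).
Proof.
move=> [x0 xn] [y0 yn]; split=> [|n]; first by rewrite big_ord1 x0 y0 mulr1.
rewrite (@conv_newton F S (fun i j => x i * y j)
  (fun r i j => c r *: (X (ucm r) * (x i * y j)))
  (fun r i j => d r *: (X (ucm r) * (x i * y j)))).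
- apply: eq_bigr => r _; rewrite mulr_sumr scaler_sumr -subSn //.
  by apply: eq_bigr => i _; rewrite scalerDl.
- move=> i j; rewrite scalerAl xn mulr_suml; apply: eq_bigr => r _.
  by rewrite -scalerAl mulrA.
- move=> i j; rewrite scalerAr yn mulr_sumr; apply: eq_bigr => r _.
  by rewrite -scalerAr mulrCA.
Qed.

(** This expresses the coproduct of x_n as the sum of the x_i tensor x_(n-i). It follows from
    Newton's recursion by induction on n, since each [pderiv r] is a derivation. *)
Lemma newton_leibniz c (x : nat -> S) : newton c x -> forall (n : nat) f g,
  adj (x n) (f * g) = \sum_(i < n.+1) adj (x i) f * adj (x (n - i)%N) g.
Proof.
move=> xN n; have [x0 _] := xN; have xa := newton_adj xN.
have [N] := ubnP n; elim: N n => // N IH [|n] nN f g.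
  by rewrite big_ord1 subnn x0 !adj1l.
apply: (@natZ_inj n.+1) => //; rewrite xa.
rewrite (@conv_newton F S (fun i j => adj (x i) f * adj (x j) g)
  (fun r i j => c r *: (adj (x i) (pderiv r f) * adj (x j) g))
  (fun r i j => c r *: (adj (x i) f * adj (x j) (pderiv r g)))).
- apply: eq_bigr => r _; rewrite pderivM // adjDr // !IH; first last.
  - by rewrite subSS; apply: leq_ltn_trans (leq_subr _ _) _.
  - by rewrite subSS; apply: leq_ltn_trans (leq_subr _ _) _.
  rewrite -big_split scaler_sumr subSS -subSn -1?ltnS //.
  by apply: eq_bigr => i _; rewrite scalerDr.
- move=> i j; rewrite scalerAl xa mulr_suml.
  by apply: eq_bigr => r _; rewrite -scalerAl.
- move=> i j; rewrite scalerAr xa mulr_sumr.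
  by apply: eq_bigr => r _; rewrite -scalerAr.
Qed.

Definition hom (d : nat) f : Prop := forall m, cf m f != 0 -> cmwgt m = d.

Lemma homD d f g : hom d f -> hom d g -> hom d (f + g).
Proof. by move=> hf hg m /cfD_neq0[/hf|/hg]. Qed.
Lemma homZ d c f : hom d f -> hom d (c *: f).
Proof. by move=> hf m; rewrite cfZ mulf_eq0 negb_or => /andP[_ /hf]. Qed.
Lemma hom0 d : hom d 0.
Proof. by move=> m; rewrite cf0 eqxx. Qed.
Lemma homM d e f g : hom d f -> hom e g -> hom (d + e) (f * g).
Proof. by move=> hf hg m /cfM_neq0[n [l [/hf <- /hg <- ->]]]; rewrite cmwgtM. Qed.
Lemma homX m : hom (cmwgt m) (X m).
Proof. by move=> n; rewrite cfX; have [->|] := eqVneq m n; rewrite ?eqxx. Qed.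
Lemma hom1 : hom 0 (1 : S).
Proof. by rewrite -X1 -(cmwgt1); exact: homX. Qed.
Lemma hom_sum d (I : eqType) (r : seq I) (P : pred I) (G : I -> S) :
  (forall i, i \in r -> P i -> hom d (G i)) -> hom d (\sum_(i <- r | P i) G i).
Proof. by move=> hG m /cf_sum_neq0[i [ir Pi /(hG i ir Pi)]]. Qed.
Lemma hom_newton c (x : nat -> S) : newton c x -> forall n, hom n (x n).
Proof.
move=> [x0 xn] n; have [N] := ubnP n; elim: N n => // N IH [|n] nN.
  by rewrite x0; exact: hom1.
have : hom n.+1 (n.+1%:R *: x n.+1).
  rewrite xn; apply: hom_sum => r _ _; apply: homZ.
  rewrite {1}(_ : n.+1 = r.+1 + (n.+1 - r.+1))%N; last by rewrite subnKC.
  apply: homM; first by rewrite -[r.+1](cmwgtU r); exact: homX.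
  by apply: IH; rewrite subSS; apply: leq_ltn_trans (leq_subr _ _) _.
move=> H m xm; apply: H; rewrite cfZ mulf_neq0 //.
by rewrite natF0.
Qed.

Lemma hom_h (n : nat) : hom n (hS S n).
Proof. exact: hom_newton (newton_h S F0) n. Qed.

Lemma hom_adj d e f g : hom d f -> hom e g ->
  forall m, cf m (adj f g) != 0 -> (d + cmwgt m)%N = e.
Proof. by move=> hf hg m /(cf_adj_neq0 F0)[a [b [/hf <- /hg <- ->]]]; rewrite cmwgtM. Qed.

Lemma ip_hom d e f g : hom d f -> hom e g -> d <> e -> ip f g = 0.
Proof. move=> hf hg de; have [//|/ip_neq0[m /hf E1 /hg E2]] := eqVneq (ip f g) 0.
by case: de; rewrite -E1 -E2. Qed.

Section Bern.
Variable t : F.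

(* h_n[X(t-1)] and h_n[X(1-t)]. *)
Definition aS (n : nat) : S := into (pleth t (hsym F n)).
Definition qS (n : nat) : S := subst (fun i : nat => (1 - t ^+ i.+1) *: X (ucm i)) (hS S n).
Definition hz (z : int) : S := into (hsymz F z).
Definition bernS (z : int) f : S := into (bern t z (out f)).

Lemma plethE f : into (pleth t (out f)) = subst (fun i : nat => (t ^+ i.+1 - 1) *: X (ucm i)) f.
Proof.
rewrite /pleth /mmap inS_sum /subst /lin suppE; apply: eq_bigr => m _.
rewrite mul_malgC inSZ cfE inS_prod; congr (_ *: _); apply: eq_bigr => i _.
by rewrite inSX inSZ XE.
Qed.

Lemma newton_a : newton (fun r => t ^+ r.+1 - 1) aS.
Proof.
have [a0 an] := newton_subst (fun r => t ^+ r.+1 - 1) (newton_h S F0).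
have E n : aS n = subst (fun i : nat => (t ^+ i.+1 - 1) *: X (ucm i)) (hS S n).
  by rewrite -plethE inSK.
split=> [|n]; rewrite E ?a0 // an; apply: eq_bigr => r _.
by rewrite E mulr1.
Qed.

Lemma newton_q : newton (fun r => 1 - t ^+ r.+1) qS.
Proof.
have [a0 an] := newton_subst (fun r => 1 - t ^+ r.+1) (newton_h S F0).
split=> [|n]; first exact: a0.
by rewrite an; apply: eq_bigr => r _; rewrite mulr1.
Qed.

(** The two generating series are inverse to each other: the parameters t^r - 1 and 1 - t^r cancel
    in the recursion of the convolution. *)
Lemma conv_aq (n : nat) : \sum_(i < n.+1) aS i * qS (n - i)%N = (n == 0%N)%:R.
Proof.
have [c0 cn] := newton_conv newton_a newton_q.
case: n => [|n] /=; first exact: c0.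
apply: (@natZ_inj n.+1) => //; rewrite cn scaler0 big1 // => r _.
by rewrite -opprB addNr scale0r.
Qed.

Lemma adj_q_h (n a : nat) :
  adj (qS n.+1) (hS S a) = if (n < a)%N then (1 - t) *: hS S (a - n.+1)%N else 0.
Proof.
have [q0 _] := newton_q; have qa := newton_adj newton_q.
have [N] := ubnP n; elim: N n a => // N IH n a nN.
apply: (@natZ_inj n.+1) => //; rewrite qa.
(* The term r = n carries q_0 = 1; for every other r the induction hypothesis supplies a further
   factor 1 - t. The c r add up to (n + 1) (1 - t). *)
pose c (r : nat) := if (r < n)%N then (1 - t ^+ r.+1) * (1 - t) else 1 - t ^+ r.+1.
transitivity (\sum_(r < n.+1) if (n < a)%N then c r *: hS S (a - n.+1)%N else 0).
  apply: eq_bigr => r _; rewrite pderiv_h // /c subSS.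
  have := ltn_ord r; rewrite ltnS leq_eqVlt => /orP[/eqP ->|rn].
    rewrite subnn q0 adj1l // ltnn; case: ifP => _ //; exact: scaler0.
  rewrite rn; case: (ltnP r a) => [ra|ar]; last first.
    by rewrite adj0r // scaler0 ltnNge (leq_trans ar (ltnW rn)).
  have -> : (n - r = (n - r.+1).+1)%N by rewrite -subSn.
  rewrite IH; last first.
    rewrite -ltnS; apply: leq_ltn_trans nN.
    by rewrite ltn_subrL (leq_ltn_trans (leq0n r) rn).
  have -> : (n - r.+1 < a - r.+1)%N = (n < a)%N by apply/idP/idP; lia.
  case: ifP => _; last exact: scaler0.
  by rewrite scalerA; congr (_ *: hS S _); lia.
case: ifP => _; last by rewrite big1 // scaler0.
rewrite -scaler_suml scalerA; congr (_ *: _).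
rewrite big_ord_recr /= {2}/c ltnn.
transitivity (\sum_(r < n) (1 - t ^+ r.+1) * (1 - t) + (1 - t ^+ n.+1)).
  by congr (_ + _); apply: eq_bigr => r _; rewrite /c ltn_ord.
rewrite -mulr_suml; elim: (n) => [|p IHp].
  by rewrite big_ord0 mul0r add0r mul1r expr1.
rewrite big_ord_recr /= mulrDl -[p.+2]addn1 natrD [in RHS]mulrDl -IHp.
rewrite addn1 !exprS; ring.
Qed.

Lemma hzE (z : int) : hz z = if z is Posz n then hS S n else 0.
Proof. by case: z => n //; rewrite /hz inS0. Qed.

Lemma adj_q_hz (n : nat) z : adj (qS n.+1) (hz z) = (1 - t) *: hz (z - n.+1%:Z).
Proof.
rewrite !hzE; case: z => a; last first.
  by rewrite (_ : Negz a - _ = Negz (a + n.+1)) ?adj0r ?scaler0 //; lia.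
rewrite adj_q_h; case: ltnP => na; first by rewrite subzn.
by rewrite (_ : a%:Z - _ = Negz (n - a)) ?scaler0 //; lia.
Qed.

Lemma adj_a_eq0 (D i : nat) f : (forall m, cf m f != 0 -> (cmwgt m < D)%N) ->
  (D <= i)%N -> adj (aS i) f = 0.
Proof.
move=> fD Di; apply: cfP => m; rewrite cf0; apply/eqP/negPn/negP.
move=> /(cf_adj_neq0 F0)[a [b [/(hom_newton newton_a) Hb /fD + E]]].
by rewrite E cmwgtM Hb ltnNge (leq_trans Di) ?leq_addr.
Qed.

(** The cut-off in [bern] depends on its argument; a common bound for several arguments gives the
    linearity of [bernS]. *)
Lemma bernSE (D : nat) z f : (forall m, cf m f != 0 -> (cmwgt m < D)%N) ->
  bernS z f = \sum_(i < D) hz (i%:Z + z) * adj (aS i) f.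
Proof.
move=> fD; have fs m : cf m f != 0 -> (cmwgt m < (symdeg (out f)).+1)%N.
  by rewrite -supp_cf suppE ltnS /symdeg => mf; apply: leq_bigmax_seq.
have ext (D1 D2 : nat) : (forall m, cf m f != 0 -> (cmwgt m < D1)%N) -> (D1 <= D2)%N ->
    \sum_(i < D1) hz (i%:Z + z) * adj (aS i) f =
    \sum_(i < D2) hz (i%:Z + z) * adj (aS i) f.
  move=> f1 D12; rewrite (big_ord_widen D2 (fun i => hz (i%:Z + z) * adj (aS i) f)) //.
  rewrite big_mkcond; apply: eq_bigr => i _; case: ltnP => // Di.
  by rewrite (adj_a_eq0 f1 Di) mulr0.
rewrite (ext _ _ fD (leq_maxl D (symdeg (out f)).+1)).
rewrite -(ext _ _ fs (leq_maxr D (symdeg (out f)).+1)).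
rewrite /bernS /bern inS_sum; apply: eq_bigr => i _.
by rewrite inSM adjE inSK.
Qed.

Lemma wgt_bound f : exists D : nat, forall m, cf m f != 0 -> (cmwgt m < D)%N.
Proof.
exists (symdeg (out f)).+1 => m.
by rewrite -supp_cf suppE ltnS /symdeg => mf; apply: leq_bigmax_seq.
Qed.

Lemma bernSD z c f g : bernS z (c *: f + g) = c *: bernS z f + bernS z g.
Proof.
have [D1 f1] := wgt_bound f; have [D2 g2] := wgt_bound g.
have H u : (forall m, cf m u != 0 -> cf m f != 0 \/ cf m g != 0) ->
    forall m, cf m u != 0 -> (cmwgt m < maxn D1 D2)%N.
  by move=> uH m /uH[/f1|/g2]; rewrite leq_max => ->; rewrite ?orbT.
rewrite !(@bernSE (maxn D1 D2)); first last.
- apply: H => m /cfD_neq0[|]; last by right.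
  by rewrite cfZ mulf_eq0 negb_or => /andP[]; left.
- by apply: H; left.
- by apply: H; right.
rewrite scaler_sumr -big_split; apply: eq_bigr => i _.
by rewrite adjDr // adjZr // mulrDr scalerAr.
Qed.

Lemma hom_bernS (d : nat) z f : hom d f ->
  forall m, cf m (bernS z f) != 0 -> (cmwgt m)%:Z = d%:Z + z.
Proof.
move=> hf m; rewrite (@bernSE d.+1); last by move=> n /hf ->.
move=> /cf_sum_neq0[i [_ _ /cfM_neq0[a [b [Ha Hb ->]]]]]; rewrite cmwgtM.
move: Ha; rewrite hzE; case E: (i%:Z + z) => [c|c]; last by rewrite cf0 eqxx.
move=> /hom_h Ha; have Hb' := hom_adj (hom_newton newton_a (n := i)) hf Hb.
by rewrite Ha; lia.
Qed.

(* Lambda_t^(k) will turn out to be the space of these f. *)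
Definition qbounded (k : nat) f : Prop := forall n, (k < n)%N -> adj (qS n) f = 0.

(** Apply the Leibniz rule for q_n^perp. The term with q_n^perp on f is 0; the others regroup by s =
    i + l into h_(s+z-n) times the adjoint of the sum of the a_i q_(s-i), which is 0 for s > 0. What
    remains has the factor h_(z-n) = 0, as z <= k < n. *)
Lemma qbounded_bern (k : nat) (z : int) f : z <= k%:Z -> qbounded k f -> qbounded k (bernS z f).
Proof.
move=> zk fk n kn; have [D fD] := wgt_bound f.
have [n' En] : exists n', n = n'.+1 by case: (n) kn => // n' _; exists n'.
rewrite (bernSE z fD) adj_sumr //.
pose T i l := hz ((i + l)%N%:Z + z - n%:Z) * adj (aS i * qS l) f.
have T0 i l : (D <= i)%N || (n <= l)%N -> T i l = 0.
  rewrite /T; case/orP => H.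
    by rewrite mulrC [aS i * _]mulrC adjM // adjC // (adj_a_eq0 fD H) adj0r ?mul0r.
  by rewrite mulrC adjM // adjC // fk ?adj0r ?mul0r // (leq_trans kn H).
transitivity ((1 - t) *: \sum_(i < D) \sum_(l < n) T i l).
  rewrite scaler_sumr; apply: eq_bigr => i _.
  rewrite (newton_leibniz newton_q) big_ord_recl subn0 adjC // fk // adj0r // mulr0 add0r.
  rewrite scaler_sumr (reindex_inj rev_ord_inj) /=; apply: eq_bigr => l _.
  rewrite /bump /= add1n adj_q_hz -scalerAl /T; congr (_ *: (hz _ * _)).
    by have := ltn_ord l; lia.
  rewrite adjM // (_ : (n - (n - l.+1).+1)%N = l) //.
  by have := ltn_ord l; lia.
(* Terms with i >= D or l >= n vanish, so the rectangle of indices may be replaced by the triangle i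
   + l < D + n that contains it. *)
pose M := (D + n)%N.
have -> : \sum_(i < D) \sum_(l < n) T i l = \sum_(i < M) \sum_(l < M - i) T i l.
  transitivity (\sum_(i < M) \sum_(l < n) T i l).
    rewrite (big_ord_widen M (fun i => \sum_(l < n) T i l)) ?leq_addr // big_mkcond.
    apply: eq_bigr => i _; case: ltnP => // Di.
    by rewrite big1 // => l _; rewrite T0 ?Di.
  apply: eq_bigr => i _.
  rewrite (big_ord_widen (M + n) (T i)) ?leq_addl //.
  rewrite (big_ord_widen (M + n) (T i)); last by rewrite (leq_trans (leq_subr _ _)) ?leq_addr.
  rewrite big_mkcond [RHS]big_mkcond; apply: eq_bigr => l _.
  case: (ltnP l n) => ln; case: (ltnP l (M - i)) => lM //; last by rewrite T0 ?ln ?orbT.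
  rewrite T0 //; apply/orP; left; rewrite -(leq_add2r n) -[(D + n)%N]/M.
  by apply: (@leq_trans (i + l)); [rewrite -leq_subLR | rewrite leq_add2l ltnW].
rewrite sum_diag big1 ?scaler0 // => s _.
transitivity (hz (s%:Z + z - n%:Z) * adj (\sum_(i < s.+1) aS i * qS (s - i)%N) f).
  rewrite adj_suml // mulr_sumr; apply: eq_bigr => i _.
  by rewrite /T subnKC // -ltnS.
rewrite conv_aq; case: (nat_of_ord s) => [|s'] /=; last by rewrite adj0l // mulr0.
by rewrite hzE add0r; case E: (z - n%:Z) => [c|c]; rewrite ?mul0r //; lia.
Qed.

End Bern.
End NewtonFamilies.

(** * Specialization at t = 1 *)

(* The residue map of a valuation ring of F with residue field K, as a graph. *)
Record place (F K : fieldType) := Place {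
  res :> F -> K -> Prop;
  res1 : res 1 1;
  resD : forall a b c d, res a c -> res b d -> res (a + b) (c + d);
  resN : forall a c, res a c -> res (- a) (- c);
  resM : forall a b c d, res a c -> res b d -> res (a * b) (c * d);
  resV : forall a c, c != 0 -> res a c -> res a^-1 c^-1;
  res_fun : forall a c d, res a c -> res a d -> c = d;
  res_surj : forall c, exists a, res a c }.

Section Place.
Variables (F K : fieldType) (pl : place F K).

Lemma res0 : pl 0 0.
Proof. by have := resD (res1 pl) (resN (res1 pl)); rewrite !subrr. Qed.

Lemma res_sum (I : Type) (r : seq I) (P : pred I) (a : I -> F) (c : I -> K) :
  (forall i, P i -> pl (a i) (c i)) ->
  pl (\sum_(i <- r | P i) a i) (\sum_(i <- r | P i) c i).
Proof.
move=> H; apply: (big_rec2 (fun a c => pl a c)); first exact: res0.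
by move=> i x y Pi; apply: resD; apply: H.
Qed.

Lemma res_prod (I : Type) (r : seq I) (P : pred I) (a : I -> F) (c : I -> K) :
  (forall i, P i -> pl (a i) (c i)) ->
  pl (\prod_(i <- r | P i) a i) (\prod_(i <- r | P i) c i).
Proof.
move=> H; apply: (big_rec2 (fun a c => pl a c)); first exact: res1.
by move=> i x y Pi; apply: resM; apply: H.
Qed.

Lemma resX a c (n : nat) : pl a c -> pl (a ^+ n) (c ^+ n).
Proof. by move=> H; elim: n => [|n IH]; [exact: res1 | rewrite !exprS; exact: resM]. Qed.

Lemma res_nat (n : nat) : pl n%:R n%:R.
Proof.
elim: n => [|n IH]; first exact: res0.
by rewrite -addn1 !natrD; apply: resD => //; exact: res1.
Qed.

Lemma res_natV (n : nat) : [pchar K] =i pred0 -> (0 < n)%N -> pl n%:R^-1 n%:R^-1.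
Proof. by move=> K0 n0; apply: resV; [rewrite natF0 // -lt0n | exact: res_nat]. Qed.

Lemma res_det N (A : 'M[F]_N) (B : 'M[K]_N) :
  (forall i j, pl (A i j) (B i j)) -> pl (\det A) (\det B).
Proof.
move=> H; rewrite /determinant; apply: res_sum => s _; apply: resM.
  by apply: resX; apply: resN; exact: res1.
by apply: res_prod => i _; exact: H.
Qed.

Definition finite (a : F) : Prop := exists c, pl a c.

Lemma finite_det N (A : 'M[F]_N) : (forall i j, finite (A i j)) -> finite (\det A).
Proof.
move=> H; pose c i j := proj1_sig (constructive_indefinite_description _ (H i j)).
exists (\det (\matrix_(i, j) c i j)); apply: res_det => i j; rewrite mxE.
exact: (proj2_sig (constructive_indefinite_description _ (H i j))).
Qed.

(** A determinant with nonzero residue has a finite inverse, so the adjugate formula stays in the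
    valuation ring. In the default branch [invmx] returns A itself, whose entries are finite by
    hypothesis. *)
Lemma finite_invmx N (A : 'M[F]_N) c : (forall i j, finite (A i j)) ->
  pl (\det A) c -> c != 0 -> forall i j, finite (invmx A i j).
Proof.
move=> H Ac c0 i j; rewrite /invmx; case: ifP => // _.
rewrite !mxE.
have [d Hd] : finite (cofactor A j i).
  rewrite /cofactor.
  have [d Hd] : finite (\det (row' j (col' i A))).
    by apply: finite_det => a b; rewrite !mxE.
  exists ((-1) ^+ (j + i) * d); apply: resM => //.
  by apply: resX; apply: resN; exact: res1.
by exists (c^-1 * d); apply: resM => //; exact: resV.
Qed.

Variables (S : symCopy F) (T : symCopy K).
Implicit Types (f u : S) (g w : T).
Hypothesis F0 : [pchar F] =i pred0.
Hypothesis K0 : [pchar K] =i pred0.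

Definition spec f g : Prop := forall m, pl (cf m f) (cf m g).

Lemma spec_fun f g w : spec f g -> spec f w -> g = w.
Proof. by move=> H1 H2; apply: cfP => m; apply: res_fun (H1 m) (H2 m). Qed.
Lemma spec0 : spec 0 0.
Proof. by move=> m; rewrite !cf0; exact: res0. Qed.
Lemma specD f u g w : spec f g -> spec u w -> spec (f + u) (g + w).
Proof. by move=> H1 H2 m; rewrite !cfD; apply: resD. Qed.
Lemma specZ a c f g : pl a c -> spec f g -> spec (a *: f) (c *: g).
Proof. by move=> H1 H2 m; rewrite !cfZ; apply: resM. Qed.
Lemma spec_sum (I : Type) (r : seq I) (P : pred I) (f : I -> S) (g : I -> T) :
  (forall i, P i -> spec (f i) (g i)) ->
  spec (\sum_(i <- r | P i) f i) (\sum_(i <- r | P i) g i).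
Proof. by move=> H m; rewrite !cf_sum; apply: res_sum => i Pi; apply: H. Qed.
Lemma spec_sum0 (I : Type) (r : seq I) (P : pred I) (f : I -> S) :
  (forall i, P i -> spec (f i) 0) -> spec (\sum_(i <- r | P i) f i) 0.
Proof.
move=> H; rewrite (_ : 0 = \sum_(i <- r | P i) (0 : T)); last by rewrite big1.
exact: spec_sum.
Qed.
Lemma specZ0 a f g : pl a 0 -> spec f g -> spec (a *: f) 0.
Proof. by move=> Ha Hf; rewrite -(scale0r g); exact: specZ. Qed.
Lemma specX m : spec (X m) (X m).
Proof. by move=> n; rewrite !cfX; exact: res_nat. Qed.
Lemma spec1 : spec 1 1.
Proof. by rewrite -!X1; exact: specX. Qed.

Lemma spec_expand f g : spec f g -> exists d : {fset mon},
  f = \sum_(m <- d) cf m f *: X m /\ g = \sum_(m <- d) cf m g *: X m.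
Proof.
move=> H; exists (supp f `|` supp g)%fset; split.
  rewrite {1}[f]expandX (big_fset_incl _ (fsubsetUl _ (supp g))) // => m _.
  by move=> /cf_notin ->; rewrite scale0r.
rewrite {1}[g]expandX (big_fset_incl _ (fsubsetUr (supp f) _)) // => m _.
by move=> /cf_notin ->; rewrite scale0r.
Qed.

Lemma specM f u g w : spec f g -> spec u w -> spec (f * u) (g * w).
Proof.
move=> Hf Hu; have [d [-> ->]] := spec_expand Hf; have [e [-> ->]] := spec_expand Hu.
rewrite !mulr_suml; apply: spec_sum => m _; rewrite -!scalerAl; apply: specZ => //.
rewrite !mulr_sumr; apply: spec_sum => n _; rewrite -!scalerAr; apply: specZ => //.
by rewrite -!XM; exact: specX.
Qed.

Lemma spec_h (n : nat) : spec (hS S n) (hS T n).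
Proof.
move=> m; rewrite !cf_h //; case: ifP => _; last exact: res0.
by apply: res_natV; rewrite ?zcm_gt0.
Qed.

Lemma spec_hz z : spec (hz S z) (hz T z).
Proof. by rewrite !hzE; case: z => n; [exact: spec_h | exact: spec0]. Qed.

(** Meant for u = a_i with i > 0, which dies at t = 1: a coefficient of the adjoint is a finite sum
    in which u enters linearly with finite cofactors. *)
Lemma spec_adj0 u f g : spec u 0 -> spec f g -> spec (adj u f) 0.
Proof.
move=> Hu Hf m; rewrite cf0 cf_adj // -[0](mul0r ((zcm m)%:R^-1)).
apply: resM; last by apply: res_natV; rewrite ?zcm_gt0.
have Hw : spec (u * X m) 0 by rewrite -[0](mul0r (X m)); apply: specM => //; exact: specX.
rewrite (@ipEw _ _ (supp f)) // (_ : 0 = \sum_(n <- supp f) (zcm n)%:R * cf n g * 0).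
  apply: res_sum => n _; apply: resM; last by have := Hw n; rewrite cf0.
  by apply: resM => //; exact: res_nat.
by rewrite big1 // => n _; rewrite mulr0.
Qed.

Section Bernstein.
Variable t : F.
Hypothesis t1 : pl t 1.

(** Each summand of Newton's recursion has the factor t^(r+1) - 1, which vanishes at t = 1. *)
Lemma spec_a (n : nat) : spec (aS S t n) (n == 0%N)%:R.
Proof.
have [a0 an] := newton_a S F0 t.
have [N] := ubnP n; elim: N n => // N IH [|n] nN; first by rewrite a0; exact: spec1.
have n0 : n.+1%:R != 0 :> F by rewrite natF0.
rewrite -[aS S t n.+1](scalerK n0) an -[RHS in spec _ RHS]/(0 : T).
rewrite -[0 : T](scaler0 _ n.+1%:R^-1); apply: specZ; first exact: res_natV.
apply: spec_sum0 => r _; apply: (@specZ0 _ _ (X (ucm (r : nat)) * (n.+1 - r.+1 == 0)%N%:R)).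
  rewrite -(subrr 1); apply: resD; last by apply: resN; exact: res1.
  by rewrite -[X in pl _ X](expr1n K r.+1); exact: resX.
apply: specM; first exact: specX.
by apply: IH; rewrite subSS; apply: leq_ltn_trans (leq_subr _ _) _.
Qed.

Lemma spec_bern z f g : spec f g -> spec (bernS t z f) (hz T z * g).
Proof.
move=> H; have [D fD] := wgt_bound f.
rewrite (@bernSE _ _ F0 t D.+1); last by move=> m /fD /leqW.
rewrite big_ord_recl /= -[X in spec _ X]addr0; apply: specD.
  rewrite add0r; apply: specM; first exact: spec_hz.
  by have [-> _] := newton_a S F0 t; rewrite adj1l.
apply: spec_sum0 => i _; rewrite -(mulr0 (hz T ((bump 0 i)%:Z + z))).
apply: specM; first exact: spec_hz.
by apply: spec_adj0 H; exact: spec_a.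
Qed.
End Bernstein.

Definition free_family (k : fieldType) (V : lmodType k) N (v : 'I_N -> V) : Prop :=
  forall c : 'I_N -> k, \sum_i c i *: v i = 0 -> forall i, c i = 0.

Section Coordinates.
Variables (N : nat) (v : 'I_N -> S) (w : 'I_N -> T).
Hypothesis vw : forall i, spec (v i) (w i).
Hypothesis wfree : free_family w.

(** Independence at t = 1 gives the coefficient matrix of w, over finitely many monomials, a right
    inverse. An arbitrary lift B of it to F makes P reduce to the identity, so P is invertible with
    finite inverse. *)
Lemma coord_matrix : exists (n : nat) (s : 'I_n -> mon) (B : 'M[F]_(n, N)),
  let P := \matrix_(i, j) cf (s j) (v i) *m B in
  P \in unitmx /\ forall i j, finite ((B *m invmx P) i j).
Proof.
pose d := flatten [seq enum_fset (supp (w i)) | i <- enum 'I_N].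
pose s (j : 'I_(size d)) := nth (onecm nat) d j.
pose M : 'M[K]_(N, size d) := \matrix_(i, j) cf (s j) (w i).
have /row_freeP[B MB] : row_free M.
  apply: inj_row_free => c cM; apply/rowP => i; rewrite mxE.
  apply: (wfree (c := fun i => c 0 i)); apply: cfP => m; rewrite cf0 cf_sum.
  have [md|md] := boolP (m \in d).
    have /rowP/(_ (Ordinal (etrans (index_mem m d) md))) := cM.
    rewrite !mxE => E; rewrite -[RHS]E; apply: eq_bigr => l _.
    by rewrite cfZ mxE /s nth_index.
  apply: big1 => l _; rewrite cfZ (@cf_notin _ _ (w l)) ?mulr0 //.
  by apply: contra md => ml; apply/flatten_mapP; exists l; rewrite ?mem_enum.
have [L LP] : exists L : K -> F, forall c, pl (L c) c.
  exists (fun c => proj1_sig (constructive_indefinite_description _ (res_surj pl c))).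
  by move=> c; case: constructive_indefinite_description.
exists (size d), s, (map_mx L B) => P.
have PE : pl (\det P) 1.
  rewrite -(det1 K N) -MB; apply: res_det => i j; rewrite !mxE.
  by apply: res_sum => l _; rewrite !mxE; apply: resM; [exact: vw | exact: LP].
have P1 : \det P != 0.
  by apply/eqP => P0; have := res_fun PE; rewrite P0 => /(_ _ res0)/eqP; rewrite oner_eq0.
split=> [|i j]; first by rewrite unitmxE unitfE.
rewrite mxE.
have H l : finite (map_mx L B i l * invmx P l j).
  have [|c Hc] := @finite_invmx _ P _ _ PE (oner_neq0 _) l j.
    move=> a b; exists (1%:M a b); rewrite -MB !mxE.
    by apply: res_sum => e _; rewrite !mxE; apply: resM; [exact: vw | exact: LP].
  by exists (B i l * c); rewrite mxE; apply: resM.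
exists (\sum_l proj1_sig (constructive_indefinite_description _ (H l))).
by apply: res_sum => l _; case: constructive_indefinite_description.
Qed.

Lemma spec_free : free_family v.
Proof.
move=> c c0; have [n [s [B]]] := coord_matrix.
set M := \matrix_(i, j) _ => -[PU _].
suff /rowP E : \row_i c i = 0 by move=> i; have := E i; rewrite !mxE.
rewrite -[\row_i c i](mulmxK PU) mulmxA (_ : _ *m M = 0) ?mul0mx //.
apply/rowP => j; rewrite !mxE -[RHS](cf0 S (s j)) -c0 cf_sum; apply: eq_bigr => i _.
by rewrite !mxE cfZ.
Qed.

(** The coordinates are the coefficients of f times [B *m invmx P], hence finite; their residues
    then express g. *)
Lemma spec_coord c f g : f = \sum_i c i *: v i -> spec f g ->
  exists e : 'I_N -> K, (forall i, pl (c i) (e i)) /\ g = \sum_i e i *: w i.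
Proof.
move=> fE fg; have [n [s [B]]] := coord_matrix.
set M := \matrix_(i, j) _ => -[PU BP].
have Ec : \row_i c i = (\row_j cf (s j) f) *m (B *m invmx (M *m B)).
  rewrite mulmxA -[LHS](mulmxK PU) mulmxA; congr (_ *m _ *m _).
  apply/rowP => j; rewrite !mxE fE cf_sum; apply: eq_bigr => i _.
  by rewrite !mxE cfZ.
have H i : finite (c i).
  have /rowP/(_ i) := Ec; rewrite mxE => ->; rewrite mxE.
  have H l : finite ((\row_j cf (s j) f) 0 l * (B *m invmx (M *m B)) l i).
    by have [b Hb] := BP l i; exists (cf (s l) g * b); apply: resM; rewrite // mxE.
  exists (\sum_l proj1_sig (constructive_indefinite_description _ (H l))).
  by apply: res_sum => l _; case: constructive_indefinite_description.
pose e i := proj1_sig (constructive_indefinite_description _ (H i)).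
have He i : pl (c i) (e i) by rewrite /e; case: constructive_indefinite_description.
exists e; split=> //; apply: spec_fun fg _; rewrite fE.
by apply: spec_sum => i _; apply: specZ.
Qed.
End Coordinates.
End Place.

(** The functionals phi embed A into a space of dimension N, so the matrix of their values on N
    independent vectors is invertible and solves for the coordinates. *)
Lemma dim_span (k : fieldType) (V : lmodType k) (A : V -> Prop) N
    (phi : V -> 'I_N -> k) (v : 'I_N -> V) :
  (forall c f g, A f -> A g -> A (c *: f + g)) ->
  (forall c f g i, phi (c *: f + g) i = c * phi f i + phi g i) ->
  (forall f, A f -> (forall i, phi f i = 0) -> f = 0) ->
  (forall i, A (v i)) -> free_family v ->
  forall f, A f -> exists c : 'I_N -> k, f = \sum_i c i *: v i.
Proof.
move=> AZD phiZD phi_inj Av vfree f Af.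
have phiD g h i : phi (g + h) i = phi g i + phi h i.
  by have := phiZD 1 g h i; rewrite scale1r mul1r.
have phi0 i : phi 0 i = 0 by apply: (addIr (phi 0 i)); rewrite -phiD !add0r.
have phiZ c g i : phi (c *: g) i = c * phi g i.
  by have := phiZD c g 0 i; rewrite phi0 !addr0.
have phi_comb c i : phi (\sum_j c j *: v j) i = \sum_j c j * phi (v j) i.
  rewrite (big_morph (phi^~ i) (id1 := 0) (op1 := +%R)) //.
  by apply: eq_bigr => j _; rewrite phiZ.
(* That 0 lies in A is derived from some v i, so N = 0 is treated apart; there [phi_inj] holds
   vacuously and forces f = 0. *)
have [N0|N0] := posnP N.
  exists (fun _ => 0); rewrite big1 => [|i _]; last by rewrite scale0r.
  by apply: phi_inj => // i; have := ltn_ord i; rewrite {2}N0.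
have A0 : A 0.
  by have := AZD (-1) _ _ (Av (Ordinal N0)) (Av (Ordinal N0)); rewrite scaleN1r addNr.
have Acomb c : A (\sum_j c j *: v j).
  by elim/big_rec: _ => // i g _ Ag; apply: AZD.
pose M := \matrix_(i, j) phi (v i) j.
have MU : M \in unitmx.
  rewrite -row_free_unit; apply: inj_row_free => c cM; apply/rowP => i; rewrite mxE.
  apply: (vfree (fun i => c 0 i)); apply: phi_inj => // j.
  rewrite phi_comb; have /rowP/(_ j) := cM; rewrite !mxE => E; rewrite -[RHS]E.
  by apply: eq_bigr => l _; rewrite mxE.
pose c := (\row_j phi f j) *m invmx M.
exists (fun i => c 0 i).
have : f - \sum_i c 0 i *: v i = 0.
  apply: phi_inj.
    by rewrite addrC -scaleN1r; apply: AZD.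
  move=> j; rewrite addrC -scaleN1r phiZD phi_comb mulN1r.
  have : c *m M = \row_j phi f j by rewrite mulmxKV.
  move=> /rowP/(_ j); rewrite !mxE => <-; apply/eqP; rewrite addrC subr_eq0; apply/eqP.
  by apply: eq_bigr => l _; rewrite !mxE.
by move/eqP; rewrite subr_eq0 => /eqP.
Qed.

(** * Leading terms *)

Section MonomialOrder.
Implicit Types m n l : mon.

(** A part a stands for h_a, so a = 0 gives the unit monomial and a > 0 the variable of index a -
    1. *)
Definition um (a : nat) : mon := if a is b.+1 then ucm b else onecm nat.
Definition bigcm (I : Type) (r : seq I) (f : I -> mon) : mon :=
  \big[@mulcm nat/onecm nat]_(i <- r) f i.
Definition pm (la : seq nat) : mon := bigcm la um.

Lemma wsum_bigcm w (I : Type) (r : seq I) (f : I -> mon) :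
  wsum w (bigcm r f) = (\sum_(i <- r) wsum w (f i))%N.
Proof. by rewrite /bigcm (big_morph _ (wsumM w) (wsum1 w)). Qed.

Lemma wsum_um w a : wsum w (um a) = if a is b.+1 then w b else 0%N.
Proof. by case: a => [|a]; [exact: wsum1 | exact: wsumU]. Qed.

Lemma cmwgt_um a : cmwgt (um a) = a.
Proof. by rewrite [LHS](wsum_um succn); case: a. Qed.

Lemma cmwgt_bigcm (I : Type) (r : seq I) (f : I -> mon) :
  cmwgt (bigcm r f) = (\sum_(i <- r) cmwgt (f i))%N.
Proof. exact: (wsum_bigcm succn). Qed.

Lemma bigcm_cat (I : Type) (r s : seq I) (f : I -> mon) :
  bigcm (r ++ s) f = mulcm (bigcm r f) (bigcm s f).
Proof.
rewrite /bigcm; elim: r => [|i r IH] /=; first by rewrite big_nil mul0cm.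
by rewrite !big_cons IH mulcmA.
Qed.

Lemma bigcmE (I : Type) (r : seq I) (f : I -> mon) j :
  bigcm r f j = (\sum_(i <- r) f i j)%N.
Proof.
rewrite /bigcm; elim: r => [|i r IH]; first by rewrite !big_nil onecmE.
by rewrite !big_cons mulcmE IH.
Qed.

Lemma pm_cat la mu : pm (la ++ mu) = mulcm (pm la) (pm mu).
Proof. exact: bigcm_cat. Qed.

Lemma pmE la j : pm la j = count_mem j.+1 la.
Proof.
rewrite /pm bigcmE; elim: la => [|a la IH]; first by rewrite big_nil.
rewrite big_cons IH /=; congr (_ + _)%N; case: a => [|a] /=; rewrite ?onecmE //.
by rewrite ucmE eqSS.
Qed.

Lemma cmwgt_pm la : cmwgt (pm la) = sumn la.
Proof. by rewrite cmwgt_bigcm sumnE; apply: eq_bigr => a _; rewrite cmwgt_um. Qed.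

Lemma pm_ord la : pm la = bigcm (index_enum 'I_(size la)) (fun i => um (nth 0%N la i)).
Proof. by rewrite /pm /bigcm (big_nth 0%N) big_mkord. Qed.

Lemma pm_inj la mu : is_part la -> is_part mu -> pm la = pm mu -> la = mu.
Proof.
move=> /andP[sl l0] /andP[sm m0] E; apply: (sorted_eq (leT := geq)) => //.
- by move=> a b c /= ab bc; exact: leq_trans bc ab.
- by move=> a b /= /anti_leq.
apply/allP => -[|a] _ /=; last by rewrite -!pmE E.
by rewrite (count_memPn l0) (count_memPn m0).
Qed.

Definition plist m : seq nat :=
  sort geq (flatten [seq nseq (m i) i.+1 | i <- enum_fset (finsupp m)]).

Lemma plist_part m : is_part (plist m).
Proof.
rewrite /is_part /plist sort_sorted; last by move=> a b; exact: leq_total.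
rewrite mem_sort; apply/flatten_mapP => -[i _]; rewrite mem_nseq => /andP[_ /eqP].
by [].
Qed.

Lemma plistK m : pm (plist m) = m.
Proof.
apply/eqP/cmP => j; rewrite pmE /plist.
set L := flatten _; have /seq.permP -> : perm_eq (sort geq L) L by rewrite perm_sort.
rewrite {}/L.
rewrite count_flatten -map_comp sumnE big_map.
rewrite (eq_bigr (fun i => (m i * (i == j))%N)); last first.
  by move=> i _; rewrite /= count_nseq /= eqSS mulnC.
have [jm|jm] := boolP (j \in finsupp m).
  rewrite (bigD1_seq j) ?fset_uniq //= eqxx muln1 big1 ?addn0 // => i /negPf ->.
  exact: muln0.
rewrite big1_seq => [|i /andP[_ im]]; first by move: jm; rewrite -cmE_eq0 => /eqP.
by case: eqP => [E|_]; rewrite ?muln0 //; rewrite -E im in jm.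
Qed.

Lemma pmK la : is_part la -> plist (pm la) = la.
Proof. by move=> pl; apply: pm_inj; rewrite ?plist_part ?plistK. Qed.

Definition kmon (k : nat) m : bool := all (gtn k) (enum_fset (finsupp m)).

Lemma kmonP (k : nat) m : reflect (forall i, m i != 0%N -> (i < k)%N) (kmon k m).
Proof.
apply: (iffP allP) => H i; first by rewrite cmE_neq0 => /H.
by move=> im; apply: H; rewrite cmE_neq0.
Qed.

Lemma kmonM k m n : kmon k (mulcm m n) = kmon k m && kmon k n.
Proof.
apply/kmonP/andP => [H|[/kmonP Hm /kmonP Hn] i].
  by split; apply/kmonP => i mi; apply: H; rewrite mulcmE addn_eq0 negb_and mi ?orbT.
by rewrite mulcmE addn_eq0 negb_and => /orP[/Hm|/Hn].
Qed.

Lemma kmon1 k : kmon k (onecm nat).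
Proof. by apply/kmonP => i; rewrite onecmE. Qed.

Lemma kmon_um k a : (a <= k)%N -> kmon k (um a).
Proof.
case: a => [|a] ak; first exact: kmon1.
by apply/kmonP => i; rewrite /= ucmE; have [<-|] := eqVneq a i.
Qed.

Lemma kmon_bigcm k (I : eqType) (r : seq I) (f : I -> mon) :
  (forall i, i \in r -> kmon k (f i)) -> kmon k (bigcm r f).
Proof.
move=> H; rewrite /bigcm big_seq; elim/big_rec: _ => [|i m ir km]; first exact: kmon1.
by rewrite kmonM H.
Qed.

Lemma kbounded_all k la : kbounded k la -> all (geq k) la.
Proof.
case: la => // a la /andP[/andP[/= pla _] ak]; rewrite /= ak /=.
have : all (geq a) la.
  by apply: order_path_min pla => x y z /= xy yz; exact: leq_trans yz xy.
by apply: sub_all => b /leq_trans; apply.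
Qed.

Lemma kmon_pm k la : is_part la -> kmon k (pm la) = kbounded k la.
Proof.
move=> pl; apply/idP/idP => [/kmonP H|/kbounded_all kla].
  rewrite /kbounded pl; case: la pl H => // -[|a] la /andP[_ a0] H //=; apply: H.
  by rewrite pmE /= eqxx.
by apply: kmon_bigcm => a /(allP kla); exact: kmon_um.
Qed.

Lemma kbounded_plist k m : kbounded k (plist m) = kmon k m.
Proof. by rewrite -kmon_pm ?plist_part // plistK. Qed.

Definition key (W : nat) m : nat := wsum (fun i => W ^ i)%N m.

(* Monomials of the same weight in lexicographic order, the highest variable
   dominating: for W large, m i is the i-th digit of key W m in base W. *)
Definition mlt m n : Prop :=
  cmwgt m = cmwgt n /\ forall W, (cmwgt m < W)%N -> (key W m < key W n)%N.

Lemma mlt_irr m : ~ mlt m m.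
Proof. by case=> _ /(_ (cmwgt m).+1 (ltnSn _)); rewrite ltnn. Qed.

Lemma mlt_trans n m l : mlt m n -> mlt n l -> mlt m l.
Proof.
move=> [E1 H1] [E2 H2]; split=> [|W HW]; first by rewrite E1.
by apply: ltn_trans (H1 W HW) (H2 W _); rewrite -E1.
Qed.

Lemma mltMr l m n : mlt m n -> mlt (mulcm m l) (mulcm n l).
Proof.
move=> [E H]; split=> [|W]; rewrite !cmwgtM ?E // => HW.
rewrite /key !wsumM ltn_add2r; apply: H; rewrite E.
exact: leq_ltn_trans (leq_addr _ _) HW.
Qed.

Lemma mltMl l m n : mlt m n -> mlt (mulcm l m) (mulcm l n).
Proof. by rewrite ![mulcm l _]mulcmC; exact: mltMr. Qed.

End MonomialOrder.

Section Triangular.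
Implicit Types m n l : mon.
Variables (F : fieldType) (S : symCopy F).
Implicit Types (f g u w : S).

Definition kpoly (k : nat) f : Prop := forall m, cf m f != 0 -> kmon k m.
Definition above (k : nat) n f : Prop := forall m, cf m f != 0 -> kmon k m /\ mlt n m.

(** The distinguished term is the smallest one and has coefficient 1; compatibility of [mlt] with
    products makes this form multiplicative. *)
Definition trail (k : nat) n f : Prop :=
  kmon k n /\ exists2 u, f = X n + u & above k n u.

Lemma aboveD k n f g : above k n f -> above k n g -> above k n (f + g).
Proof. by move=> Hf Hg m /cfD_neq0[/Hf|/Hg]. Qed.
Lemma aboveZ k n c f : above k n f -> above k n (c *: f).
Proof. by move=> Hf m; rewrite cfZ mulf_eq0 negb_or => /andP[_ /Hf]. Qed.
Lemma above0 k n : above k n 0.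
Proof. by move=> m; rewrite cf0 eqxx. Qed.
Lemma above_sum k n (I : eqType) (r : seq I) (P : pred I) (G : I -> S) :
  (forall i, P i -> above k n (G i)) -> above k n (\sum_(i <- r | P i) G i).
Proof. by move=> H m /cf_sum_neq0[i [_ Pi /(H i Pi)]]. Qed.

Lemma kpoly0 k : kpoly k 0.
Proof. by move=> m; rewrite cf0 eqxx. Qed.
Lemma kpolyD k f g : kpoly k f -> kpoly k g -> kpoly k (f + g).
Proof. by move=> Hf Hg m /cfD_neq0[/Hf|/Hg]. Qed.
Lemma kpolyZ k c f : kpoly k f -> kpoly k (c *: f).
Proof. by move=> Hf m; rewrite cfZ mulf_eq0 negb_or => /andP[_ /Hf]. Qed.
Lemma kpolyM k f g : kpoly k f -> kpoly k g -> kpoly k (f * g).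
Proof. by move=> Hf Hg m /cfM_neq0[n [l [/Hf Hn /Hg Hl ->]]]; rewrite kmonM Hn. Qed.
Lemma kpolyX k m : kmon k m -> kpoly k (X m).
Proof. by move=> km n; rewrite cfX; have [<-|] := eqVneq m n; rewrite ?eqxx. Qed.
Lemma kpoly_sum k (I : eqType) (r : seq I) (P : pred I) (G : I -> S) :
  (forall i, i \in r -> P i -> kpoly k (G i)) -> kpoly k (\sum_(i <- r | P i) G i).
Proof. by move=> H m /cf_sum_neq0[i [ir Pi /(H i ir Pi)]]. Qed.

Lemma trail_cf k n f : trail k n f -> cf n f = 1.
Proof.
move=> [_ [u -> uH]]; rewrite cfD cfX eqxx (_ : cf n u = 0) ?addr0 //.
by apply/eqP/negPn/negP => /uH[_ /mlt_irr].
Qed.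

Lemma trail_above k n f m : trail k n f -> cf m f != 0 -> m = n \/ mlt n m.
Proof.
move=> [_ [u -> uH]] /cfD_neq0[|/uH[_]]; last by right.
by rewrite cfX; have [->|] := eqVneq n m; rewrite ?eqxx //; left.
Qed.

Lemma trail_kpoly k n f : trail k n f -> kpoly k f.
Proof.
move=> [kn [u -> uH]]; apply: kpolyD; first exact: kpolyX.
by move=> m /uH[].
Qed.

Lemma trailE k n f : kmon k n -> kpoly k f -> cf n f = 1 ->
  (forall m, cf m f != 0 -> m = n \/ mlt n m) -> trail k n f.
Proof.
move=> kn kf f1 H; split=> //; exists (f - X n); first by rewrite addrC subrK.
move=> m; rewrite cfD cfN cfX; have [<-|nm] := eqVneq n m; first by rewrite f1 subrr eqxx.
rewrite subr0 => fm; split; first exact: kf.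
by case: (H m fm) => // E; rewrite E eqxx in nm.
Qed.

Lemma trail1 k : trail k (onecm nat) 1.
Proof. by split; [exact: kmon1 | exists 0; [rewrite X1 addr0 | exact: above0]]. Qed.

Lemma trailX k n : kmon k n -> trail k n (X n).
Proof. by move=> kn; split=> //; exists 0; [rewrite addr0 | exact: above0]. Qed.

Lemma trailM k n m f g : trail k n f -> trail k m g -> trail k (mulcm n m) (f * g).
Proof.
move=> [kn [u -> uH]] [km [w -> wH]]; split; first by rewrite kmonM kn.
exists (X n * w + u * X m + u * w).
  by rewrite XM mulrDl !mulrDr -!addrA; congr (_ + (_ + _)); rewrite addrA.
apply: aboveD; first apply: aboveD.
- move=> l /cfM_neq0[a [b [+ /wH[kb mb] ->]]]; rewrite cfX.
  have [<- _|] := eqVneq n a; last by rewrite eqxx.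
  by rewrite kmonM kn; split=> //; exact: mltMl.
- move=> l /cfM_neq0[a [b [/uH[ka na] + ->]]]; rewrite cfX.
  have [<- _|] := eqVneq m b; last by rewrite eqxx.
  by rewrite kmonM ka km; split=> //; exact: mltMr.
- move=> l /cfM_neq0[a [b [/uH[ka na] /wH[kb mb] ->]]].
  rewrite kmonM ka; split=> //; apply: (mlt_trans (mltMr _ na)); exact: mltMl.
Qed.

Lemma trail_prod k (I : eqType) (r : seq I) (n : I -> mon) (G : I -> S) :
  (forall i, i \in r -> trail k (n i) (G i)) ->
  trail k (bigcm r n) (\prod_(i <- r) G i).
Proof.
rewrite /bigcm; elim: r => [|i r IH] H; first by rewrite !big_nil; exact: trail1.
rewrite !big_cons; apply: trailM; first by apply: H; rewrite mem_head.
by apply: IH => j jr; apply: H; rewrite in_cons jr orbT.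
Qed.

Lemma X_bigcm (I : Type) (r : seq I) (f : I -> mon) :
  X (bigcm r f) = \prod_(i <- r) X (f i) :> S.
Proof. by rewrite /bigcm (big_morph _ (@XM F S) (X1 S)). Qed.

(** The preimage of h_z under p_i -> h_i, equal to 1 at z = 0 and to 0 for negative z. *)
Definition pz (z : int) : S := if z is Posz a then X (um a) else 0.

(* Both the Jacobi-Trudi determinant and the product of the 1 - t e_ab at t = 1
   expand into such terms, except for the leading one. *)
Lemma above_pz k (la : seq nat) (gam : 'I_(size la) -> int) (c : 'I_(size la)) :
  is_part la -> (forall i, gam i <= k%:Z) ->
  \sum_i gam i = (sumn la)%:Z ->
  (forall i : 'I_(size la), (i < c)%N -> gam i = (nth 0%N la i)%:Z) ->
  (nth 0%N la c)%:Z < gam c ->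
  above k (pm la) (\prod_i pz (gam i)).
Proof.
move=> /andP[sla la0] gk gsum glt gc.
have [neg|pos] := boolP [exists i, gam i < 0].
  have [i gi] := existsP neg; rewrite (bigD1 i) //= /pz; case: (gam i) gi => // a _.
  by rewrite mul0r; exact: above0.
have {}pos i : gam i = `|gam i|%N.
  by rewrite gez0_abs // leNgt; apply: contra pos => H; apply/existsP; exists i.
pose g i := `|gam i|%N.
have lapos i : (i < size la)%N -> (0 < nth 0 la i)%N.
  by move=> il; rewrite lt0n; apply: contraNneq la0 => <-; exact: mem_nth.
have lale i : (c <= i)%N -> (i < size la)%N -> (nth 0 la i <= nth 0 la c)%N.
  move=> ci il; apply: (sorted_leq_nth (leT := geq)) => //.
  - by move=> x y z /= xy yz; exact: leq_trans yz xy.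
  - by move=> x /=.
  - by rewrite inE ltn_ord.
have -> : \prod_i pz (gam i) = X (bigcm (index_enum 'I_(size la)) (fun i => um (g i))).
  by rewrite X_bigcm; apply: eq_bigr => i _; rewrite (pos i) /pz.
move=> m; rewrite cfX; have [<- _|] := eqVneq (bigcm _ _) m; last by rewrite eqxx.
split.
  by apply: kmon_bigcm => i _; apply: kmon_um; rewrite -lez_nat -pos.
have wE : cmwgt (bigcm (index_enum 'I_(size la)) (fun i => um (g i))) = sumn la.
  rewrite cmwgt_bigcm; apply/eqP; rewrite -eqz_nat -gsum; apply/eqP.
  rewrite (big_morph Posz PoszD (erefl _)).
  by apply: eq_bigr => i _; rewrite cmwgt_um pos.
rewrite /mlt wE cmwgt_pm; split=> // W HW.
pose A i := wsum (fun i => W ^ i)%N (um (nth 0%N la i)).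
pose B i := wsum (fun i => W ^ i)%N (um (g i)).
rewrite /key pm_ord !wsum_bigcm -/A.
rewrite (bigID (fun i : 'I_(size la) => (i < c)%N)) /=.
rewrite [X in (_ < X)%N](bigID (fun i : 'I_(size la) => (i < c)%N)) /=.
have -> : (\sum_(i < size la | (i < c)%N) wsum (fun i => W ^ i) (um (g i)) =
  \sum_(i < size la | (i < c)%N) wsum (fun i => W ^ i) (um (nth 0 la i)))%N.
  by apply: eq_bigr => i ic; rewrite /g glt.
(* From row c on, [la] has fewer than W parts, each of key at most W^(la_c - 1), so their total is
   below W^(la_c). The single part gam_c > la_c already reaches that. *)
rewrite ltn_add2l; apply: (@leq_ltn_trans (\sum_(i < size la) W ^ (nth 0 la c).-1)%N).
  rewrite [X in (_ <= X)%N](bigID (fun i : 'I_(size la) => (i < c)%N)) /=.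
  apply: leq_trans (leq_addl _ _); apply: leq_sum => i; rewrite -leqNgt => ci.
  rewrite wsum_um; case E: (nth 0%N la i) => [|a] //; apply: leq_pexp2l.
    by apply: leq_ltn_trans HW.
  by have := lale i ci (ltn_ord i); rewrite E; case: (nth 0%N la c).
rewrite sum_nat_const card_ord.
apply: (@leq_trans (W * W ^ (nth 0 la c).-1)%N).
  rewrite ltn_pmul2r; last by rewrite expn_gt0 (leq_ltn_trans _ HW).
  apply: leq_ltn_trans HW.
  elim: (la) la0 => //= a l IH; rewrite in_cons negb_or => /andP[a0 /IH H].
  by rewrite -add1n leq_add // lt0n eq_sym.
rewrite -expnS prednK ?lapos // (bigD1 c) /= ?ltnn //.
apply: leq_trans (leq_addr _ _); rewrite wsum_um.
have : (nth 0 la c < g c)%N by rewrite -ltz_nat -pos.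
case: (g c) => // b; rewrite ltnS => lb; apply: leq_pexp2l lb.
exact: leq_ltn_trans HW.
Qed.

End Triangular.

Lemma exists_min (T : eqType) (s : seq T) (kap : T -> int) : s != [::] ->
  exists2 x, x \in s & forall y, y \in s -> kap x <= kap y.
Proof.
elim: s => // x s IH _; have [->|/IH[y ys ymin]] := eqVneq s [::].
  by exists x => [|y]; rewrite ?mem_head // inE => /eqP ->.
have [xy|yx] := leP (kap x) (kap y).
  exists x; rewrite ?mem_head // => z; rewrite inE => /orP[/eqP -> //|/ymin].
  exact: le_trans.
exists y; rewrite ?inE ?ys ?orbT // => z; rewrite inE => /orP[/eqP ->|/ymin //].
exact: ltW.
Qed.

Section LeadingTerms.
Implicit Types m n l : mon.
Variables (F : fieldType) (S : symCopy F).
Implicit Types (f g u w : S).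

(** At a monomial m of f with minimal [kap], the coefficient of [lin E f] comes from E m alone.
    Integer values of [kap] admit both the key, for smallest terms, and its negative, for largest
    terms. *)
Lemma lin_inj (E : mon -> S) (kap : mon -> int) f :
  (forall m, cf m f != 0 -> cf m (E m) != 0) ->
  (forall m l, cf m f != 0 -> cf l (E m) != 0 -> l = m \/ kap m < kap l) ->
  lin E f = 0 -> f = 0.
Proof.
move=> E1 E2 Ef; have [s0|s0] := eqVneq (enum_fset (supp f)) [::].
  by rewrite [f]expandX s0 big_nil.
have [m mf mmin] := exists_min kap s0; exfalso.
have fm : cf m f != 0 by rewrite -supp_cf.
have := cf0 S m; rewrite -Ef /lin cf_sum (bigD1_seq m) ?fset_uniq //= big1_seq.
  by rewrite addr0 cfZ => /eqP; rewrite mulf_eq0 (negPf fm) (negPf (E1 m fm)).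
move=> l /andP[lm lf]; have fl : cf l f != 0 by rewrite -supp_cf.
rewrite cfZ; have [->|mEl] := eqVneq (cf m (E l)) 0; first by rewrite mulr0.
have [ml|lt_lm] := E2 l m fl mEl; first by rewrite ml eqxx in lm.
by have := lt_le_trans lt_lm (mmin l lf); rewrite ltxx.
Qed.

Lemma supp_bound f : exists W : nat, forall m, cf m f != 0 -> (cmwgt m < W)%N.
Proof.
exists (\sum_(m <- supp f) (cmwgt m).+1)%N => m; rewrite -supp_cf => mf.
by rewrite (bigD1_seq m) ?fset_uniq //= leq_addr.
Qed.

Section Basis.
Variables (k : nat) (E : mon -> S).
Hypothesis ET : forall m, kmon k m -> trail k m (E m).

Lemma lin_trail_inj f : kpoly k f -> lin E f = 0 -> f = 0.
Proof.
move=> kf; have [W WH] := supp_bound f.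
apply: (@lin_inj _ (fun m => (key W m)%:Z)) => [m /kf km|m l mf].
  by rewrite (trail_cf (ET km)) oner_neq0.
move=> /(trail_above (ET (kf m mf)))[->|[_ H]]; first by left.
by right; rewrite ltz_nat; apply: H; exact: WH.
Qed.

Lemma lin_above n f : above k n f -> above k n (lin E f).
Proof.
move=> fn m; rewrite /lin => /cf_sum_neq0[l [lf _]].
rewrite cfZ mulf_eq0 negb_or => /andP[_ ml].
have [kl nl] := fn l ltac:(by rewrite -supp_cf).
split; first exact: trail_kpoly (ET kl) m ml.
by have [->|] := trail_above (ET kl) ml => //; exact: mlt_trans.
Qed.

Lemma trail_lin n g : trail k n g -> trail k n (lin E g).
Proof.
move=> [kn [u -> uH]]; have [_ [v Ev vH]] := ET kn; split=> //.
exists (v + lin E u); first by rewrite linD linX Ev addrA.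
by apply: aboveD => //; exact: lin_above.
Qed.

(** Within one degree the keys are bounded, so an induction towards larger monomials ends. *)
Lemma key_bound W m : (cmwgt m < W)%N -> (key W m <= cmwgt m * W ^ cmwgt m)%N.
Proof.
move=> mW; have H (e : nat -> nat) := wsum_ord e (@cmwgt_lt m).
rewrite /key H; apply: (@leq_trans ((\sum_(i < cmwgt m) m i * i.+1) * W ^ cmwgt m)).
  rewrite big_distrl /=; apply: leq_sum => i _; rewrite -mulnA leq_mul2l; apply/orP; right.
  rewrite (@leq_trans (W ^ cmwgt m)) ?leq_pmull //.
  rewrite leq_pexp2l ?(leq_ltn_trans _ mW) //; exact: ltnW.
by rewrite -(H succn).
Qed.

Lemma above_span n u : (forall l, mlt n l -> kmon k l ->
    exists g : S, trail k l g /\ X l = lin E g) ->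
  above k n u -> exists2 g : S, above k n g & u = lin E g.
Proof.
move=> H uH; rewrite [u]expandX big_seq; elim/big_rec: _ => [|l f lu [g gH ->]].
  by exists 0; [exact: above0 | rewrite lin0].
have [kl nl] := uH l ltac:(by rewrite -supp_cf).
have [h [hT ->]] := H l nl kl.
exists (cf l u *: h + g); last by rewrite linD linZ.
apply: aboveD => //; apply: aboveZ => m hm; split; first exact: trail_kpoly hT m hm.
by have [->|] := trail_above hT hm => //; exact: mlt_trans.
Qed.

(** Inversion of a unitriangular matrix: X m is E m minus larger monomials of the same degree,
    expressible by induction. The measure is the gap between the key of m and its bound. *)
Lemma X_span m : kmon k m -> exists g : S, trail k m g /\ X m = lin E g.
Proof.
have [N] := ubnP (cmwgt m * (cmwgt m).+1 ^ cmwgt m - key (cmwgt m).+1 m)%N.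
elim: N m => // N IH m HN km; have [_ [u Eu uH]] := ET km.
have [l ml kl|g gH ug] := @above_span m u _ uH.
  have [ld lt_key] := ml.
  apply: IH => //; rewrite -ld.
  have lW : (cmwgt l < (cmwgt m).+1)%N by rewrite -ld.
  have := lt_key _ (ltnSn _); have := key_bound lW; rewrite -ld => H1 H2.
  rewrite ltnS in HN; apply: leq_trans HN; apply: ltn_sub2l => //.
  exact: leq_trans H2 H1.
exists (X m - g); split; last by rewrite -scaleN1r linD linX linZ -ug Eu scaleN1r addrK.
split=> //; exists (- g) => //; rewrite -scaleN1r; exact: aboveZ.
Qed.

Lemma kpoly_span f : kpoly k f -> exists2 g : S, kpoly k g & f = lin E g.
Proof.
move=> kf; rewrite [f]expandX big_seq; elim/big_rec: _ => [|l h lf [g gH ->]].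
  by exists 0; [exact: kpoly0 | rewrite lin0].
have [|w [wT ->]] := @X_span l; first by apply: kf; rewrite -supp_cf.
exists (cf l f *: w + g); last by rewrite linD linZ.
by apply: kpolyD => //; apply: kpolyZ; exact: trail_kpoly wT.
Qed.

(** Converse of [trail_lin]: the inverse change of coordinates is again unitriangular. *)
Lemma trail_span n f : trail k n f -> exists2 g : S, trail k n g & f = lin E g.
Proof.
move=> [kn [u -> uH]]; have [h [[_ [v Ev vH]] ->]] := X_span kn.
have [|g gH ->] := @above_span n u _ uH; first by move=> l _; exact: X_span.
exists (h + g); last by rewrite linD.
split=> //; exists (v + g); first by rewrite Ev addrA.
exact: aboveD.
Qed.
End Basis.

Hypothesis F0 : [pchar F] =i pred0.

(* The ring map p_i |-> h_i: a polynomial in the power sums stands for the same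
   polynomial in the complete functions. *)
Definition Phi : S -> S := subst (fun i => hS S i.+1).

(** The shape of products of the h_i in power sums: opposite to [trail], the distinguished term is
    the largest one, and its coefficient is only nonzero. *)
Definition low n f : Prop := exists a u,
  [/\ a != 0, f = a *: X n + u & forall m, cf m u != 0 -> mlt m n].

Lemma lowM n m f g : low n f -> low m g -> low (mulcm n m) (f * g).
Proof.
move=> [a [u [a0 -> uH]]] [b [w [b0 -> wH]]].
exists (a * b), (a *: (X n * w) + b *: (u * X m) + u * w); split.
- by rewrite mulf_neq0.
- rewrite mulrDl !mulrDr -!scalerAl -!scalerAr XM scalerA -!addrA; congr (_ + (_ + _)).
- move=> l /cfD_neq0[/cfD_neq0[]|].
  + rewrite cfZ mulf_eq0 negb_or => /andP[_ /cfM_neq0[c [d [+ /wH md ->]]]].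
    by rewrite cfX; have [<- _|] := eqVneq n c; [exact: mltMl | rewrite eqxx].
  + rewrite cfZ mulf_eq0 negb_or => /andP[_ /cfM_neq0[c [d [/uH nc + ->]]]].
    by rewrite cfX; have [<- _|] := eqVneq m d; [exact: mltMr | rewrite eqxx].
  + move=> /cfM_neq0[c [d [/uH nc /wH md ->]]].
    exact: mlt_trans (mltMr _ nc) (mltMl _ md).
Qed.

Lemma low_h i : low (ucm i) (hS S i.+1).
Proof.
exists (zcm (ucm i))%:R^-1, (hS S i.+1 - (zcm (ucm i))%:R^-1 *: X (ucm i)); split.
- by rewrite invr_neq0 // zcmF0.
- by rewrite addrC subrK.
move=> m; rewrite cfD cfN cfZ cfX cf_h //.
have [<-|im] := eqVneq (ucm i) m; first by rewrite cmwgtU eqxx mulr1 subrr eqxx.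
rewrite mulr0n mulr0 subr0; have [wm|_] := eqVneq (cmwgt m) i.+1; last by rewrite eqxx.
move=> _; split=> [|W]; rewrite wm ?cmwgtU // => HW.
have mi : m i = 0%N.
  apply/eqP/negPn/negP => /cmD_ucm[n En]; case/eqP: im.
  have : cmwgt n = 0%N by move: wm; rewrite En cmwgtM cmwgtU; lia.
  by move/eqP; rewrite cmwgt_eq0 En => /eqP ->; rewrite mul0cm.
rewrite /key wsumU; case: i => [|i] in wm mi HW im *.
  have : m = onecm nat.
    apply/eqP/cmP => -[|j]; rewrite onecmE //; apply/eqP/negPn/negP => /cmwgt_lt.
    by rewrite wm.
  by move=> E; move: wm; rewrite E cmwgt1.
(* Here m has degree i + 2 and avoids variable i + 1, so its variables have index at most i and its
   key is at most (i + 2) W^i < W^(i+1). *)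
apply: (@leq_ltn_trans (\sum_(j <- finsupp m) m j * j.+1 * W ^ i)%N).
  rewrite /wsum big_seq [X in (_ <= X)%N]big_seq; apply: leq_sum => j jm.
  rewrite -mulnA leq_mul2l; apply/orP; right.
  rewrite (@leq_trans (W ^ i)) ?leq_pmull // leq_pexp2l //; first exact: leq_ltn_trans HW.
  have : m j != 0%N by rewrite cmE_neq0.
  move=> /[dup] /cmwgt_lt; rewrite wm ltnS leq_eqVlt ltnS => /orP[/eqP -> |//].
  by rewrite mi.
rewrite -big_distrl /= -/(cmwgt m) wm expnS ltn_pmul2r //.
by rewrite expn_gt0 (leq_ltn_trans _ HW).
Qed.

Lemma low_Phi m : low m (expm (fun i => hS S i.+1) m).
Proof.
elim/cm_ind: m => [|m i IH].
  by exists 1, 0; split=> [||m]; rewrite ?oner_neq0 ?expm1 ?X1 ?scale1r ?addr0 // cf0 eqxx.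
by rewrite expmM expmU; apply: lowM => //; exact: low_h.
Qed.

(** This is the algebraic independence of the h_i. The largest terms decide, hence the negated
    key. *)
Lemma Phi_inj f : Phi f = 0 -> f = 0.
Proof.
have [W WH] := supp_bound f.
apply: (@lin_inj _ (fun m => - (key W m)%:Z)) => [m fm|m l fm].
  have [a [u [a0 -> uH]]] := low_Phi m; rewrite cfD cfZ cfX eqxx mulr1.
  rewrite (_ : cf m u = 0) ?addr0 //; apply/eqP/negPn/negP => /uH; exact: mlt_irr.
have [a [u [a0 -> uH]]] := low_Phi m => /cfD_neq0[|/uH[E H]].
  rewrite cfZ cfX mulf_eq0 negb_or => /andP[_]; have [<-|] := eqVneq m l; last by rewrite eqxx.
  by left.
by right; rewrite ltrN2 ltz_nat; apply: H; rewrite E; exact: WH.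
Qed.

Lemma Phi_pz z : Phi (pz S z) = hz S z.
Proof.
rewrite /pz hzE; case: z => [[|a]|a]; last exact: subst0.
  by rewrite X1 hS0 // /Phi subst1.
by rewrite /Phi substX expmU.
Qed.

Definition jtpoly (la : seq nat) : S :=
  \sum_(s : 'S_(size la)) (-1) ^+ s *:
    \prod_(i < size la) pz S ((nth 0%N la i)%:Z + (s i : nat)%:Z - (i : nat)%:Z).

Lemma Phi_jt la : Phi (jtpoly la) = into (schur F la).
Proof.
rewrite /schur /determinant inS_sum /Phi /jtpoly subst_sum; apply: eq_bigr => s _.
rewrite substZ subst_prod; set P := \prod_i _; set Q := \prod_i _.
have -> : P = into Q.
  by rewrite inS_prod; apply: eq_bigr => i _; rewrite -/(Phi _) Phi_pz mxE.
case: (odd_perm s); last by rewrite !expr0 scale1r mul1r.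
by rewrite !expr1 mulN1r -[- Q]scaleN1r inSZ.
Qed.

Lemma trail_above_sum (I : finType) (k : nat) n (P : pred I) (G : I -> S) (i0 : I) :
  kmon k n -> P i0 -> G i0 = X n -> (forall i, P i -> i != i0 -> above k n (G i)) ->
  trail k n (\sum_(i | P i) G i).
Proof.
move=> kn P0 E0 H; split=> //; rewrite (bigD1 i0) //= E0.
exists (\sum_(i | P i && (i != i0)) G i) => //.
by apply: above_sum => i /andP[]; exact: H.
Qed.

Lemma nth_head_le (la : seq nat) i : is_part la -> (nth 0 la i <= head 0 la)%N.
Proof.
move=> pl; have H : kbounded (head 0%N la) la by rewrite /kbounded pl /=.
have [il|il] := ltnP i (size la); last by rewrite nth_default.
by have /allP := kbounded_all H; apply; exact: mem_nth.
Qed.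

Lemma head_kmon k (la : seq nat) : is_part la -> (head 0 la + size la <= k.+1)%N ->
  kmon k (pm la).
Proof.
move=> pl hk; rewrite kmon_pm // /kbounded pl /=; case: (la) hk => //= a l.
by rewrite addnS ltnS; apply: leq_trans; rewrite leq_addr.
Qed.

Lemma sum_nth la : \sum_(i < size la) (nth 0%N la i)%:Z = (sumn la)%:Z :> int.
Proof.
by rewrite -(big_morph Posz PoszD (erefl _)) sumnE (big_nth 0%N) big_mkord.
Qed.

(** The identity permutation gives h_la. For any other s, the first moved row c has s c > c, because
    the smaller values are already taken; so the first index that changes grows. All indices are at
    most la_1 + size - 1 <= k. *)
Lemma trail_jt k la : is_part la -> (head 0 la + size la <= k.+1)%N ->
  trail k (pm la) (jtpoly la).
Proof.
move=> pl hk; apply: (@trail_above_sum _ k _ _ _ 1%g) => //; first exact: head_kmon.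
  rewrite odd_perm1 scale1r pm_ord X_bigcm; apply: eq_bigr => i _.
  by rewrite perm1 addrK.
move=> s _ s1; apply: aboveZ.
have [c0 sc0] : exists c, s c != c.
  apply: NNPP => N; case/eqP: s1; apply/permP => c; rewrite perm1.
  by apply/eqP/negPn/negP => H; apply: N; exists c.
pose c := [arg min_(i < c0 | s i != i) (i : nat)].
have [sc cmin] : s c != c /\ forall i : 'I_(size la), (i < c)%N -> s i = i.
  rewrite /c; case: arg_minnP => // i si imin; split=> // j ji.
  by apply/eqP/negPn/negP => /imin; rewrite leqNgt ji.
apply: (@above_pz _ _ k la _ c) => //.
- move=> i; have := nth_head_le i pl; have := ltn_ord (s i); lia.
- rewrite -sum_nth sumrB big_split /= -[RHS]addr0 -addrA; congr (_ + _).
  by rewrite [X in X - _](reindex_inj (@perm_inj _ s^-1)) /=;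
    under eq_bigr do rewrite permKV; rewrite subrr.
- by move=> i /cmin ->; rewrite addrK.
have : (c < s c)%N.
  rewrite ltn_neqAle eq_sym sc leqNgt; apply/negP => /cmin /perm_inj E.
  by rewrite E eqxx in sc.
lia.
Qed.

(** Row i is raised at most once for each later row, hence by at most [size la - i - 1]. *)
Lemma raise_le k la (A : {set 'I_(size la) * 'I_(size la)}) i :
  is_part la -> (head 0 la + size la <= k.+1)%N ->
  (forall ab, ab \in A -> (ab.1 < ab.2)%N) -> raise A i <= k%:Z.
Proof.
move=> pl hk Alt; rewrite /raise.
have : (#|[set ab in A | ab.1 == i]| <= size la - i.+1)%N.
  rewrite -(card_in_imset (f := snd)); last first.
    by move=> [a d] [a' d'] /=; rewrite !inE /= => /andP[_ /eqP ->] /andP[_ /eqP ->] ->.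
  apply: (@leq_trans #|[set j : 'I_(size la) | (i < j)%N]|).
    apply: subset_leq_card; apply/subsetP => j /imsetP[[a d]]; rewrite !inE /=.
    by move=> /andP[/Alt /= H /eqP <-] ->.
  rewrite -sum1_card; under eq_bigl do rewrite inE.
  rewrite -(big_mkord (fun j => (i < j)%N) (fun _ => 1%N)).
  rewrite (big_cat_nat (n := i.+1)) //= big_nat_cond big1 ?add0n.
    by apply: leq_trans (_ : (\sum_(i.+1 <= j < size la) 1 <= _)%N);
      [rewrite [X in (X <= _)%N]big_mkcond; apply: leq_sum => j _; case: ifP | rewrite sum_nat_const_nat muln1].
  by move=> j /andP[/andP[_]]; rewrite ltnS leqNgt => /negPf ->.
by have := nth_head_le i pl; have := ltn_ord i; lia.
Qed.

Lemma sum_raise la (A : {set 'I_(size la) * 'I_(size la)}) :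
  \sum_c raise A c = (sumn la)%:Z.
Proof.
rewrite /raise sumrB big_split /= sum_nth -addrA -[RHS]addr0; congr (_ + _).
have part (p : 'I_(size la) * 'I_(size la) -> 'I_(size la)) :
    \sum_(i < size la) #|[set ab in A | p ab == i]|%:Z = #|A|%:Z.
  rewrite -(big_morph Posz PoszD (erefl _)); congr Posz.
  rewrite -[RHS]sum1_card (partition_big p xpredT) //=; apply: eq_bigr => i _.
  by rewrite -sum1_card; apply: eq_bigl => ab; rewrite inE.
by rewrite !part subrr.
Qed.

(** The value of B_la at t = 1, before [Phi]: the raising-operator form of a Schur function. *)
Definition rpoly (la : seq nat) : S :=
  \sum_(A : {set 'I_(size la) * 'I_(size la)} | [forall ab in A, (ab.1 < ab.2)%N])
    (-1) ^+ #|A| *: \prod_c pz S (raise A c).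

Lemma trail_r k la : is_part la -> (head 0 la + size la <= k.+1)%N ->
  trail k (pm la) (rpoly la).
Proof.
move=> pl hk; apply: (@trail_above_sum _ k _ _ _ set0) => //.
- exact: head_kmon.
- by apply/forall_inP => ab; rewrite inE.
- rewrite cards0 scale1r pm_ord X_bigcm; apply: eq_bigr => c _.
  have z (p : pred ('I_(size la) * 'I_(size la))) : #|[set ab in set0 | p ab]| = 0%N.
    by apply: eq_card0 => ab; rewrite !inE.
  by rewrite /raise (z (fun ab => ab.1 == c)) (z (fun ab => ab.2 == c)) addr0 subr0.
move=> A /forall_inP Alt /set0Pn[ab0 abA]; apply: aboveZ.
have ex0 : exists b, (ab0.1, b) \in A by exists ab0.2; rewrite -surjective_pairing.
(* The row c will be the first one that is raised. No row up to c is lowered, since a pair lowering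
   it would raise a row before c. *)
pose Q (a : 'I_(size la)) := [exists b, (a, b) \in A].
have Q0 : Q ab0.1 by apply/existsP.
pose c := [arg min_(i < ab0.1 | Q i) (i : nat)].
have [/existsP[b cb] cmin] : Q c /\ forall i : 'I_(size la), (i < c)%N -> ~~ Q i.
  rewrite /c; case: arg_minnP => // i si imin; split=> // j ji.
  by apply/negP => /imin; rewrite leqNgt ji.
have low2 (i : 'I_(size la)) : (i <= c)%N -> #|[set ab in A | ab.2 == i]| = 0%N.
  move=> ic; apply: eq_card0 => -[a d]; rewrite !inE /=; apply/negP => /andP[adA /eqP di].
  have := Alt _ adA; rewrite /= di => ai.
  by have /cmin/negP := leq_trans ai ic; apply; apply/existsP; exists d.
have low1 (i : 'I_(size la)) : (i < c)%N -> #|[set ab in A | ab.1 == i]| = 0%N.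
  move=> /cmin/existsPn H; apply: eq_card0 => -[a d]; rewrite !inE /=.
  by apply/negP => /andP[adA /eqP ai]; have := H d; rewrite -ai adA.
apply: (@above_pz _ _ k la _ c) => //.
- by move=> i; exact: raise_le.
- exact: sum_raise.
- by move=> i ic; rewrite /raise (low1 i ic) (low2 i (ltnW ic)) addr0 subr0.
rewrite /raise (low2 c (leqnn c)) subr0.
have : (0 < #|[set ab in A | ab.1 == c]|)%N.
  by apply/card_gt0P; exists (c, b); rewrite inE cb eqxx.
lia.
Qed.

(** A full block starting with a has k + 1 - a rows; the last block may be shorter, whence an
    inequality. *)
Lemma ksplit_blocks k la : kbounded k la -> forall b, b \in ksplit k la ->
  is_part b && (head 0 b + size b <= k.+1)%N.
Proof.
rewrite /ksplit; move: {1}(size la) => N; elim: N la => // N IH [|a la] // kla b.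
have pla : is_part (a :: la) by case/andP: kla.
rewrite inE => /orP[/eqP ->|]; last first.
  apply: IH; move: kla; rewrite -kmon_pm //.
  have pd : is_part (drop (k.+1 - a) (a :: la)).
    case/andP: pla => sl l0; rewrite /is_part drop_sorted //=.
    by apply: contra l0; exact: mem_drop.
  by rewrite -[kbounded _ _]kmon_pm // -{1}(cat_take_drop (k.+1 - a) (a :: la)) pm_cat kmonM => /andP[].
case/andP: kla => /andP[sl l0] ak; rewrite /= in ak.
have -> : is_part (take (k.+1 - a) (a :: la)).
  by rewrite /is_part take_sorted //; apply: contra l0; exact: mem_take.
have -> : head 0%N (take (k.+1 - a) (a :: la)) = a by rewrite subSn.
by rewrite /= size_take_min -leq_subRL ?(leqW ak) // geq_minl.
Qed.

Definition gpoly (k : nat) la : S := \prod_(b <- ksplit k la) rpoly b.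

Lemma trail_g k la : kbounded k la -> trail k (pm la) (gpoly k la).
Proof.
move=> kla; have [fl _ _] := ksplitP kla.
have -> : pm la = bigcm (ksplit k la) pm.
  rewrite -{1}fl; elim: (ksplit k la) => [|b s IH] /=; first by rewrite /pm /bigcm !big_nil.
  by rewrite pm_cat IH /bigcm big_cons.
apply: trail_prod => b /(ksplit_blocks kla)/andP[pb hb]; exact: trail_r.
Qed.

End LeadingTerms.

(** * The k-split basis and the operators T_j *)

(** The length of this list is the dimension against which A in degree d is measured. *)
Lemma kmon_enum (k d : nat) : exists L : seq mon,
  uniq L /\ forall m, (m \in L) = kmon k m && (cmwgt m == d).
Proof.
pose step (s : seq (seq nat)) := [::] :: [seq a :: p | a <- iota 0 k.+1, p <- s].
(* Sequences of length below N with entries at most k; a partition of d has at most d parts. *)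
pose all_seqs N := iter N step [::].
have mem_all N (l : seq nat) : (size l < N)%N -> all (geq k) l -> l \in all_seqs N.
  elim: N l => // N IH [|a l] /=; first by rewrite mem_head.
  move=> lN /andP[ak kl]; rewrite [all_seqs _]/= /step in_cons; apply/orP; right.
  apply/allpairsP; exists (a, l); split; [by rewrite mem_iota | exact: IH | by []].
exists (undup [seq m <- map pm (all_seqs d.+1) | kmon k m && (cmwgt m == d)]).
split=> [|m]; first exact: undup_uniq.
rewrite mem_undup mem_filter; have [/andP[km /eqP wm]|//] := boolP (kmon k m && (cmwgt m == d)).
rewrite andTb.
apply/mapP; exists (plist m); last by rewrite plistK.
have kp : kbounded k (plist m) by rewrite kbounded_plist.
apply: mem_all; last exact: kbounded_all.
rewrite ltnS -wm -[X in cmwgt X]plistK cmwgt_pm.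
have /andP[_] := plist_part m; elim: (plist m) => //= a l IH.
by rewrite inE negb_or => /andP[a0 /IH]; rewrite -add1n; apply: leq_add; rewrite lt0n eq_sym.
Qed.

Section Generic.
Implicit Types m n l : mon.
Variables (F K : fieldType) (pl : place F K) (S : symCopy F) (T : symCopy K) (t : F).
Hypothesis F0 : [pchar F] =i pred0.
Hypothesis K0 : [pchar K] =i pred0.
Hypothesis t1 : pl t 1.
Hypothesis tgen : forall r : nat, 1 - t ^+ r.+1 != 0.
Implicit Types (f g u : S) (w : T).

Lemma PhiD w1 w2 : Phi (w1 + w2) = Phi w1 + Phi w2 :> T.
Proof. exact: substD. Qed.
Lemma PhiM w1 w2 : Phi (w1 * w2) = Phi w1 * Phi w2 :> T.
Proof. exact: substM. Qed.
Lemma PhiZ c w : Phi (c *: w) = c *: Phi w :> T.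
Proof. exact: substZ. Qed.
Lemma Phi_sum (I : Type) (r : seq I) (P : pred I) (G : I -> T) :
  Phi (\sum_(i <- r | P i) G i) = \sum_(i <- r | P i) Phi (G i).
Proof. exact: subst_sum. Qed.
Lemma Phi_prod (I : Type) (r : seq I) (P : pred I) (G : I -> T) :
  Phi (\prod_(i <- r | P i) G i) = \prod_(i <- r | P i) Phi (G i).
Proof. exact: subst_prod. Qed.
Lemma Phi_eq w1 w2 : Phi w1 = Phi w2 -> w1 = w2.
Proof.
move=> E; apply/eqP; rewrite -subr_eq0; apply/eqP; apply: (Phi_inj K0).
by rewrite -scaleN1r PhiD PhiZ scaleN1r E subrr.
Qed.

Lemma into_foldr_bern (gam : seq int) f :
  into (foldr (bern t) (out f) gam) = foldr (bernS t) f gam.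
Proof. by elim: gam => [|z gam IH] /=; rewrite ?outSK // -IH /bernS inSK. Qed.

Definition bpartS la f : S := into (bpart t la (out f)).

Lemma bpartSE la f : bpartS la f =
  \sum_(A : {set 'I_(size la) * 'I_(size la)} | [forall ab in A, (ab.1 < ab.2)%N])
    (- t) ^+ #|A| *: foldr (bernS t) f [seq raise A c | c <- enum 'I_(size la)].
Proof. by rewrite /bpartS /bpart inS_sum; apply: eq_bigr => A _; rewrite inSZ into_foldr_bern. Qed.

Lemma bernS_D z f g : bernS t z (f + g) = bernS t z f + bernS t z g.
Proof. by have := bernSD F0 t z 1 f g; rewrite !scale1r. Qed.

Lemma bernS0 z : bernS t z (0 : S) = 0.
Proof. by apply: (addIr (bernS t z 0)); rewrite -bernS_D !add0r. Qed.

(** Degrees are integers because intermediate indices of [bern] may be negative; a negative degree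
    forces the element to be 0. *)
Definition homz (d : int) f : Prop := forall m, cf m f != 0 -> (cmwgt m)%:Z = d.

Lemma homzE (d : nat) f : homz d%:Z f <-> hom d f.
Proof. by split=> H m /H => [[->]|->]. Qed.

Lemma homz_bern d z f : homz d f -> homz (d + z) (bernS t z f).
Proof.
case: d => d hf; first by apply: hom_bernS => //; apply/homzE.
suff -> : f = 0 by rewrite bernS0 => m; rewrite cf0 eqxx.
by apply: cfP => m; rewrite cf0; apply/eqP/negPn/negP => /hf.
Qed.

Lemma homz_foldr d f (gam : seq int) : homz d f ->
  homz (d + \sum_(z <- gam) z) (foldr (bernS t) f gam).
Proof.
move=> hf; elim: gam => [|z gam IH] /=; first by rewrite big_nil addr0.
rewrite big_cons [z + _]addrC addrA; exact: homz_bern.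
Qed.

Lemma qbounded0 k : qbounded t k (0 : S).
Proof. by move=> n _; rewrite adj0r. Qed.
Lemma qboundedD k f g : qbounded t k f -> qbounded t k g -> qbounded t k (f + g).
Proof. by move=> Hf Hg n kn; rewrite adjDr // Hf // Hg // addr0. Qed.
Lemma qboundedZ k c f : qbounded t k f -> qbounded t k (c *: f).
Proof. by move=> Hf n kn; rewrite adjZr // Hf // scaler0. Qed.
Lemma qbounded_sum k (I : eqType) (r : seq I) (P : pred I) (G : I -> S) :
  (forall i, i \in r -> P i -> qbounded t k (G i)) ->
  qbounded t k (\sum_(i <- r | P i) G i).
Proof.
move=> H; rewrite big_seq_cond; elim/big_rec: _ => [|i f /andP[ir Pi] Hf].
  exact: qbounded0.
by apply: qboundedD => //; exact: H.
Qed.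
Lemma qbounded1 k : qbounded t k (1 : S).
Proof.
move=> n kn; apply: cfP => m; rewrite cf0; apply/eqP/negPn/negP.
move=> /(hom_adj F0 (hom_newton F0 (newton_q S F0 t) (n := n)) (@hom1 _ _)) /eqP.
by rewrite addn_eq0 => /andP[/eqP n0]; rewrite n0 in kn.
Qed.

Lemma qbounded_foldr k f (gam : seq int) : all (fun z => z <= k%:Z) gam ->
  qbounded t k f -> qbounded t k (foldr (bernS t) f gam).
Proof.
by elim: gam => //= z gam IH /andP[zk gk] kf; apply: qbounded_bern => //; exact: IH.
Qed.

Lemma spec_foldr f w (gam : seq int) : spec pl f w ->
  spec pl (foldr (bernS t) f gam) ((\prod_(z <- gam) hz T z) * w).
Proof.
move=> H; elim: gam => [|z gam IH] /=; first by rewrite big_nil mul1r.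
by rewrite big_cons -mulrA; apply: spec_bern.
Qed.

Section Block.
Variables (k : nat) (b : seq nat).
Hypotheses (pb : is_part b) (hb : (head 0 b + size b <= k.+1)%N).

Lemma qbounded_bpart f : qbounded t k f -> qbounded t k (bpartS b f).
Proof.
move=> kf; rewrite bpartSE; apply: qbounded_sum => A _ /forall_inP Alt.
apply: qboundedZ; apply: qbounded_foldr => //.
by apply/allP => z /mapP[c _ ->]; exact: raise_le.
Qed.

Lemma hom_bpart d f : hom d f -> hom (sumn b + d) (bpartS b f).
Proof.
move=> hf; rewrite bpartSE; apply: hom_sum => A _ _; apply: homZ; apply/homzE.
rewrite addnC PoszD -(sum_raise A) -big_enum -(big_map (raise A) xpredT id).
by apply: homz_foldr; apply/homzE.
Qed.

Lemma spec_bpart f w : spec pl f w -> spec pl (bpartS b f) (Phi (rpoly T b) * w).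
Proof.
move=> H; rewrite bpartSE /rpoly Phi_sum mulr_suml; apply: spec_sum => A _.
rewrite PhiZ -scalerAl; apply: specZ; first by apply: resX; exact: resN.
rewrite Phi_prod; under eq_bigr do rewrite Phi_pz //.
by rewrite -big_enum -(big_map (raise A) xpredT (hz T)); exact: spec_foldr.
Qed.
End Block.

Variable k : nat.

Definition hlS la : S := into (hlpoly t la).
Definition gS la : S := into (ksplit_poly t k la).

Lemma hlSE la : hlS la = foldr (bernS t) 1 [seq r%:Z | r <- la].
Proof.
rewrite /hlS /hlpoly -into_foldr_bern outS1; congr into.
by elim: la => //= a la ->.
Qed.

Lemma gSE la : gS la = foldr bpartS 1 (ksplit k la).
Proof.
rewrite /gS /ksplit_poly; elim: (ksplit k la) => [|b s IH] /=; first exact: inS1.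
by rewrite -IH /bpartS inSK.
Qed.

Lemma qbounded_hl la : kbounded k la -> qbounded t k (hlS la).
Proof.
move=> /kbounded_all kla; rewrite hlSE; apply: qbounded_foldr; last exact: qbounded1.
by rewrite all_map; apply: sub_all kla => a /=; rewrite lez_nat.
Qed.

Lemma hom_hl la : hom (sumn la) (hlS la).
Proof.
rewrite hlSE; apply/homzE.
have := @homz_foldr 0 1 [seq r%:Z | r <- la]; rewrite add0r.
rewrite big_map -(big_morph Posz PoszD (erefl _)) -sumnE; apply.
by apply/homzE; exact: hom1.
Qed.

Lemma spec_hl la : spec pl (hlS la) (Phi (X (pm la) : T)).
Proof.
rewrite hlSE X_bigcm Phi_prod -[X in spec _ _ X]mulr1.
rewrite (eq_bigr (fun a : nat => hz T a%:Z)); last by move=> a _; rewrite -Phi_pz.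
by rewrite -(big_map Posz xpredT (hz T)); apply: spec_foldr; exact: spec1.
Qed.

Section KSplit.
Variable la : seq nat.
Hypothesis kla : kbounded k la.

Lemma qbounded_g : qbounded t k (gS la).
Proof.
rewrite gSE; have := ksplit_blocks kla.
elim: (ksplit k la) => [_|b s IH H] /=; first exact: qbounded1.
have /andP[pb hb] := H b (mem_head _ _).
by apply: qbounded_bpart => //; apply: IH => c cs; apply: H; rewrite in_cons cs orbT.
Qed.

Lemma hom_g : hom (sumn la) (gS la).
Proof.
have [fl _ _] := ksplitP kla; rewrite -{1}fl gSE.
elim: (ksplit k la) => [|b s IH] /=; first exact: hom1.
by rewrite sumn_cat; exact: hom_bpart.
Qed.

Lemma spec_g : spec pl (gS la) (Phi (gpoly T k la)).
Proof.
rewrite gSE /gpoly Phi_prod; elim: (ksplit k la) => [|b s IH] /=.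
  by rewrite big_nil; exact: spec1.
by rewrite big_cons; exact: spec_bpart.
Qed.
End KSplit.

Definition Psi : S -> S := subst (fun i => qS S t i.+1).

Lemma PsiM f g : Psi (f * g) = Psi f * Psi g.
Proof. exact: substM. Qed.

(** Newton's recursion for q_(i+1) contains p_(i+1) with the factor 1 - t^(i+1), nonzero for generic
    t, and can be solved for it. *)
Lemma psum_Psi i : exists f, X (ucm i) = Psi f.
Proof.
have [N] := ubnP i; elim: N i => // N IH i iN.
have [q0 qn] := newton_q S F0 t.
have PsiX (r : nat) : qS S t r = Psi (pz S r%:Z).
  by case: r => [|r] /=; rewrite /Psi /pz ?X1 ?subst1 ?q0 // substX expmU.
have [g Eg] : exists g, \sum_(r < i) (1 - t ^+ r.+1) *: (X (ucm (r : nat)) * qS S t (i.+1 - r.+1)%N) = Psi g.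
  elim/big_ind: _ => [|f g [f' ->] [g' ->]|r _].
  - by exists 0; rewrite /Psi subst0.
  - by exists (f' + g'); rewrite /Psi substD.
  have [f ->] : exists f, X (ucm (r : nat)) = Psi f.
    by apply: IH; apply: leq_trans (ltn_ord r) _; rewrite -ltnS.
  by exists ((1 - t ^+ r.+1) *: (f * pz S (i.+1 - r.+1)%N%:Z)); rewrite /Psi substZ -/Psi PsiM -PsiX.
exists ((1 - t ^+ i.+1)^-1 *: (i.+1%:R *: pz S i.+1%:Z - g)).
have := qn i.+1; rewrite big_ord_recr /= subnn q0 mulr1 Eg => E.
rewrite /Psi substZ -scaleN1r substD !substZ -/Psi scaleN1r.
rewrite -(PsiX i.+1 : _ = Psi (X (ucm i))) E addrAC subrr add0r.
by rewrite scalerA mulVf // scale1r.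
Qed.

Lemma Psi_surj f : exists g, f = Psi g.
Proof.
elim/symind: f => [|c m f [g ->]]; first by exists 0; rewrite /Psi subst0.
have [h ->] : exists h, X m = Psi h.
  elim/cm_ind: m => [|m i [h Eh]]; first by exists 1; rewrite /Psi subst1 X1.
  by have [p Ep] := psum_Psi i; exists (h * p); rewrite XM Eh Ep PsiM.
by exists (c *: h + g); rewrite /Psi substD substZ.
Qed.

Lemma hom_Psi m : hom (cmwgt m) (Psi (X m)).
Proof.
rewrite /Psi substX; elim/cm_ind: m => [|m i IH]; first by rewrite cmwgt1 expm1; exact: hom1.
rewrite cmwgtM cmwgtU expmM expmU; apply: homM => //.
exact: hom_newton (newton_q S F0 t) _.
Qed.

(** The products of the q_n span the ring. Those of another degree are orthogonal to f, and a factor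
    q_n with n > k moves across the pairing as q_n^perp, which kills f. *)
Lemma qbounded_inj d f : qbounded t k f -> hom d f ->
  (forall m, kmon k m -> cmwgt m = d -> ip (Psi (X m)) f = 0) -> f = 0.
Proof.
move=> kf hf H; apply: ip_inj => // u; rewrite ip0l ipC; have [g ->] := Psi_surj u.
elim/symind: g => [|c m g IH]; first by rewrite /Psi subst0 ip0l.
rewrite /Psi substD substZ -/Psi ipDl ipZl IH addr0.
suff -> : ip (Psi (X m)) f = 0 by rewrite mulr0.
have [wm|/eqP wm] := eqVneq (cmwgt m) d; last exact: ip_hom (hom_Psi (m := m)) hf wm.
have [/H|/kmonP km] := boolP (kmon k m); first exact.
have [i mi ki] : exists2 i, m i != 0%N & (k <= i)%N.
  apply: NNPP => N; apply: km => i mi; rewrite ltnNge; apply/negP => ki.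
  by apply: N; exists i.
have [l ->] := cmD_ucm mi; rewrite XM PsiM mulrC ipC -[X in ip f X]mulr1 -mulrA.
rewrite [X in X * _]/Psi substX expmU -adjP // kf ?ip0l //.
Qed.

(** * Families in A with unitriangular specialization *)

Section System.
Variables (G : mon -> S) (W : mon -> T).
Hypothesis Gq : forall m, kmon k m -> qbounded t k (G m).
Hypothesis Gh : forall m, kmon k m -> hom (cmwgt m) (G m).
Hypothesis GW : forall m, kmon k m -> spec pl (G m) (Phi (W m)).
Hypothesis WT : forall m, kmon k m -> trail k m (W m).

Lemma free_PhiW N (s : 'I_N -> mon) : injective s -> (forall i, kmon k (s i)) ->
  free_family (fun i => Phi (W (s i))).
Proof.
move=> sI ks c c0 i.
have kc : kpoly k (\sum_i c i *: X (s i) : T).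
  by apply: kpoly_sum => j _ _; apply: kpolyZ; exact: kpolyX.
have : \sum_i c i *: X (s i) = 0 :> T.
  apply: (lin_trail_inj WT kc); apply: (Phi_inj K0).
  rewrite lin_sum Phi_sum -[RHS]c0; apply: eq_bigr => j _.
  by rewrite linZ linX PhiZ.
move=> /(congr1 (cf (s i))); rewrite cf0 cf_sum (bigD1 i) //= cfZ cfX eqxx mulr1.
rewrite big1 ?addr0 // => j ji; rewrite cfZ cfX (inj_eq sI) (negPf ji).
by rewrite mulr0.
Qed.

Definition smon (g : S) (i : 'I_(size (enum_fset (supp g)))) : mon :=
  nth (onecm nat) (enum_fset (supp g)) i.

Lemma smon_inj g : injective (@smon g).
Proof.
move=> i j /eqP; rewrite nth_uniq ?fset_uniq // => /eqP; exact: val_inj.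
Qed.

Lemma smon_supp g i : cf (@smon g i) g != 0.
Proof. by rewrite -supp_cf; exact: mem_nth. Qed.

Lemma lin_smon g : lin G g = \sum_i cf (@smon g i) g *: G (smon i).
Proof. by rewrite /lin (big_nth (onecm nat)) big_mkord. Qed.

Lemma system_inj g : kpoly k g -> lin G g = 0 -> g = 0.
Proof.
move=> kg; rewrite lin_smon => g0.
have ks i : kmon k (@smon g i) by apply: kg; exact: smon_supp.
have H := spec_free (fun i => GW (ks i)) (free_PhiW (@smon_inj g) ks) g0.
apply: cfP => m; rewrite cf0; have [//|mg] := eqVneq (cf m g) 0.
have ms : m \in enum_fset (supp g) by rewrite supp_cf.
have := H (Ordinal (etrans (index_mem _ _) ms)).
by rewrite /smon /= nth_index.
Qed.

(** The test products of the q_n and the family itself are both indexed by the k-bounded monomials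
    of degree d, so [dim_span] applies. *)
Lemma system_span d f : qbounded t k f -> hom d f ->
  exists g, [/\ kpoly k g, hom d g & f = lin G g].
Proof.
move=> kf hf; have [L [uL LE]] := kmon_enum k d.
pose s (i : 'I_(size L)) := nth (onecm nat) L i.
have sL i : kmon k (s i) && (cmwgt (s i) == d) by rewrite -LE mem_nth.
have ks i : kmon k (s i) by case/andP: (sL i).
have ws i : cmwgt (s i) = d by case/andP: (sL i) => _ /eqP.
have sI : injective s by move=> i j /eqP; rewrite nth_uniq // => /eqP; exact: val_inj.
have [c ->] : exists c : 'I_(size L) -> F, f = \sum_i c i *: G (s i).
apply: (@dim_span F S (fun f => qbounded t k f /\ hom d f) (size L)
  (fun f i => ip (Psi (X (s i))) f) (fun i => G (s i))).
- by move=> c g h [kg hg] [kh hh]; split; [apply: qboundedD => //; exact: qboundedZ | apply: homD => //; exact: homZ].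
- by move=> c g h i; rewrite ipDr ipZr.
- move=> g [kg hg] H; apply: (qbounded_inj kg hg) => m km wm.
  have mL : m \in L by rewrite LE km wm eqxx.
  have := H (Ordinal (etrans (index_mem _ _) mL)); rewrite /s /= nth_index //.
- by move=> i; split; [exact: Gq | rewrite -(ws i); exact: Gh].
- exact: spec_free (fun i => GW (ks i)) (free_PhiW sI ks).
- by split.
exists (\sum_i c i *: X (s i)); split.
- by apply: kpoly_sum => i _ _; apply: kpolyZ; exact: kpolyX.
- by apply: hom_sum => i _ _; apply: homZ; rewrite -(ws i); exact: homX.
- by rewrite lin_sum; apply: eq_bigr => i _; rewrite linZ linX.
Qed.

Lemma spec_lin g w : kpoly k g -> kpoly k w -> spec pl g w ->
  spec pl (lin G g) (Phi (lin W w)).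
Proof.
move=> kg kw gw; set d := (supp g `|` supp w)%fset.
rewrite (@linEw _ _ _ G d) ?fsubsetUl // (@linEw _ _ _ W d) ?fsubsetUr //.
rewrite Phi_sum big_seq [X in spec _ _ X]big_seq; apply: spec_sum => m md.
rewrite PhiZ; apply: specZ => //; apply: GW.
by move: md; rewrite in_fsetU !supp_cf => /orP[/kg|/kw].
Qed.

Lemma system_coord g w : kpoly k g -> spec pl (lin G g) w ->
  exists e : T, [/\ kpoly k e, spec pl g e & w = Phi (lin W e)].
Proof.
move=> kg gw; have ks i : kmon k (@smon g i) by apply: kg; exact: smon_supp.
have [e [He ->]] := spec_coord (fun i => GW (ks i)) (free_PhiW (@smon_inj g) ks)
  (lin_smon g) gw.
exists (\sum_i e i *: X (smon i)); split.
- by apply: kpoly_sum => i _ _; apply: kpolyZ; exact: kpolyX.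
- rewrite {1}(expandX g) (big_nth (onecm nat)) big_mkord.
  by apply: spec_sum => i _; apply: specZ; [exact: He | exact: specX].
- by rewrite lin_sum Phi_sum; apply: eq_bigr => i _; rewrite linZ linX PhiZ.
Qed.
End System.

Definition hM m := hlS (plist m).
Definition gM m := gS (plist m).
Definition gT m : T := gpoly T k (plist m).

Lemma hM_q m : kmon k m -> qbounded t k (hM m).
Proof. by rewrite -kbounded_plist; exact: qbounded_hl. Qed.
Lemma hM_h m : kmon k m -> hom (cmwgt m) (hM m).
Proof. by move=> _; rewrite -{1}(plistK m) cmwgt_pm; exact: hom_hl. Qed.
Lemma hM_s m : kmon k m -> spec pl (hM m) (Phi (X m : T)).
Proof. by move=> _; rewrite -{2}(plistK m); exact: spec_hl. Qed.
Lemma gM_q m : kmon k m -> qbounded t k (gM m).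
Proof. by rewrite -kbounded_plist; exact: qbounded_g. Qed.
Lemma gM_h m : kmon k m -> hom (cmwgt m) (gM m).
Proof. by rewrite -kbounded_plist -{2}(plistK m) cmwgt_pm; exact: hom_g. Qed.
Lemma gM_s m : kmon k m -> spec pl (gM m) (Phi (gT m)).
Proof. by move=> _; exact: spec_g. Qed.
Lemma gT_t m : kmon k m -> trail k m (gT m).
Proof. by rewrite -kbounded_plist -{2}(plistK m); exact: trail_g. Qed.

Let g_span := system_span gM_q gM_h gM_s gT_t.
Let g_inj := system_inj gM_s gT_t.

Definition symkS f : Prop := symkt t k (out f).

Lemma symkSP f : symkS f <-> exists2 l : seq (F * seq nat),
  all (fun x => kbounded k x.2) l & f = \sum_(x <- l) x.1 *: hlS x.2.
Proof.
split=> [[l kl E]|[l kl ->]]; exists l => //.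
  by rewrite -[f]outSK E inS_sum; apply: eq_bigr => x _; rewrite inSZ.
by rewrite outS_sum; apply: eq_bigr => x _; rewrite outSZ inSK.
Qed.

Lemma symkS0 : symkS 0.
Proof. by apply/symkSP; exists [::]; rewrite ?big_nil. Qed.

Lemma symkS_lin c f g : symkS f -> symkS g -> symkS (c *: f + g).
Proof.
move=> /symkSP[l kl ->] /symkSP[l' kl' ->]; apply/symkSP.
exists ([seq (c * x.1, x.2) | x <- l] ++ l').
  by rewrite all_cat kl' andbT all_map.
rewrite big_cat big_map scaler_sumr; congr (_ + _).
by apply: eq_bigr => x _; rewrite scalerA.
Qed.

Lemma lin_closed (P : S -> Prop) (G : mon -> S) g : P 0 ->
  (forall c f u, P f -> P u -> P (c *: f + u)) -> (forall m, cf m g != 0 -> P (G m)) ->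
  P (lin G g).
Proof.
move=> P0 PD PG; rewrite /lin big_seq; elim/big_rec: _ => // m u mg Pu.
by apply: PD => //; apply: PG; rewrite -supp_cf.
Qed.

(** Spanning of A by the H_rho; it places the G_rho, which lie in A, inside the domain on which T_j
    is prescribed. *)
Lemma qbounded_symkS d f : qbounded t k f -> hom d f -> symkS f.
Proof.
move=> kf hf; have [g [kg _ ->]] := system_span hM_q hM_h hM_s (@trailX _ T k) kf hf.
apply/symkSP; exists [seq (cf m g, plist m) | m <- enum_fset (supp g)].
  by rewrite all_map; apply/allP => m; rewrite supp_cf /= kbounded_plist => /kg.
by rewrite /lin big_map.
Qed.

Lemma symkS_span f : symkS f -> exists2 g : S, kpoly k g & f = lin gM g.
Proof.
move=> /symkSP[l kl ->]; elim: l kl => [_|x l IH /= /andP[kx /IH[g kg Eg]]].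
  by exists 0; [exact: kpoly0 | rewrite big_nil lin0].
have [h [kh _ Eh]] := g_span (qbounded_hl kx) (@hom_hl x.2).
exists (x.1 *: h + g); first by apply: kpolyD => //; exact: kpolyZ.
by rewrite big_cons Eg linD linZ -Eh.
Qed.

(* T_j in coordinates with respect to the k-split basis. *)
Definition restr (R : fieldType) (U : symCopy R) (j : nat) : U -> U :=
  lin (fun m => if head 0%N (plist m) == j then X m else 0).

Lemma cf_restr (R : fieldType) (U : symCopy R) j m (g : U) :
  cf m (restr j g) = if head 0%N (plist m) == j then cf m g else 0.
Proof.
elim/symind: g => [|c l g IH]; first by rewrite /restr lin0 cf0; case: ifP.
rewrite /restr linD linZ linX !cfD !cfZ -/(restr j g) IH.
have [<-|lm] := eqVneq l m.
  by case: ifP => _; rewrite ?cf0 ?mulr0 ?addr0 ?add0r.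
rewrite cfX (negPf lm) mulr0 add0r; case: (head _ (plist l) == j).
  by rewrite cfX (negPf lm) mulr0 add0r.
by rewrite cf0 mulr0 add0r.
Qed.

Lemma kpoly_restr (R : fieldType) (U : symCopy R) j (g : U) :
  kpoly k g -> kpoly k (restr j g).
Proof. by move=> kg m; rewrite cf_restr; case: ifP => [_ /kg|]; rewrite ?eqxx. Qed.

(** T_j is read off from coordinates with respect to the G_rho, chosen by [epsilon] and unique by
    independence. Existence gives the [epsilon] in [ktop] its specification. *)
Lemma is_ktop_exists j : exists T0, is_ktop t k j T0.
Proof.
pose co (f : S) : S := epsilon (inhabits 0) (fun g => kpoly k g /\ f = lin gM g).
have coP (f : S) : symkS f -> kpoly k (co f) /\ f = lin gM (co f).
  move=> /symkS_span[g kg Eg].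
  by apply: (epsilon_spec (inhabits 0) (fun g => kpoly k g /\ f = lin gM g)); exists g.
have co_eq (f g : S) : symkS f -> kpoly k g -> f = lin gM g -> co f = g.
  move=> /coP[kf Ef] kg Eg; apply/eqP; rewrite -subr_eq0; apply/eqP.
  rewrite addrC -scaleN1r; apply: g_inj; first by apply: kpolyD => //; exact: kpolyZ.
  by rewrite linD linZ -Ef Eg scaleN1r addNr.
exists (fun f : sym F => out (lin gM (restr j (co (into f))))); split=> [a f g kf kg|la kla].
  have kfS : symkS (into f) by rewrite /symkS inSK.
  have kgS : symkS (into g) by rewrite /symkS inSK.
  rewrite inSD inSZ -outSZD -linZ -linD /restr -linZ -linD.
  have [kf' Ef] := coP _ kfS; have [kg' Eg] := coP _ kgS.
  rewrite (co_eq _ (a *: co (into f) + co (into g))) //.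
  - exact: symkS_lin.
  - by apply: kpolyD => //; exact: kpolyZ.
  - by rewrite linD linZ -Ef -Eg.
have pla : is_part la by case/andP: kla.
have -> : co (into (ksplit_poly t k la)) = X (pm la).
  apply: co_eq; last by rewrite linX /gM pmK.
    exact: qbounded_symkS (qbounded_g kla) (hom_g kla).
  by apply: kpolyX; rewrite kmon_pm.
rewrite /restr linX pmK //; case: ifP => _; last by rewrite lin0 outS0.
by rewrite linX /gM pmK // inSK.
Qed.

Definition ktopS j f : S := into (ktop t k j (out f)).

Lemma ktopS_lin j c f g : symkS f -> symkS g ->
  ktopS j (c *: f + g) = c *: ktopS j f + ktopS j g.
Proof.
have [Tlin _] : is_ktop t k j (ktop t k j) by exact: epsilon_spec (is_ktop_exists j).
by move=> kf kg; rewrite /ktopS outSZD Tlin // inSD inSZ.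
Qed.

Lemma ktopS_g j m : kmon k m ->
  ktopS j (gM m) = if head 0%N (plist m) == j then gM m else 0.
Proof.
have [_ Tval] : is_ktop t k j (ktop t k j) by exact: epsilon_spec (is_ktop_exists j).
rewrite -kbounded_plist => km; rewrite /ktopS /gM /gS inSK Tval //.
by case: ifP => // _; rewrite inS0.
Qed.

(** The operator is known to be linear only on Lambda_t^(k), so the induction over the terms also
    carries that the partial sums lie there. *)
Lemma ktopSE j g : kpoly k g -> ktopS j (lin gM g) = lin gM (restr j g).
Proof.
move=> kg; have -> : lin gM (restr j g) = \sum_(m <- supp g)
    lin gM (cf m g *: (if head 0%N (plist m) == j then X m : S else 0)).
  by rewrite /restr {2}/lin lin_sum.
rewrite {1}/lin.
have : all (kmon k) (enum_fset (supp g)) by apply/allP => m; rewrite supp_cf => /kg.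
suff H s : all (kmon k) s -> symkS (\sum_(m <- s) cf m g *: gM m) /\
    ktopS j (\sum_(m <- s) cf m g *: gM m) =
    \sum_(m <- s) lin gM (cf m g *: (if head 0%N (plist m) == j then X m : S else 0)).
  by case/H.
elim: s => [_|m s IH /= /andP[km /IH[ks Es]]].
  rewrite !big_nil; split; first exact: symkS0.
  have := ktopS_lin j 1 symkS0 symkS0; rewrite !scale1r addr0 => E.
  by apply: (addIr (ktopS j 0)); rewrite -E add0r.
have kgm : symkS (gM m) := qbounded_symkS (gM_q km) (gM_h km).
rewrite !big_cons; split; first exact: symkS_lin.
rewrite ktopS_lin // Es ktopS_g // linZ; congr (_ *: _ + _).
by case: ifP => _; rewrite ?linX ?lin0.
Qed.

Lemma spec_restr j (g : S) (w : T) : spec pl g w -> spec pl (restr j g) (restr j w).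
Proof. by move=> H m; rewrite !cf_restr; case: ifP => _; [exact: H | exact: res0]. Qed.

(** Restriction to the first part of n keeps the leading term and discards only higher ones. *)
Lemma trail_restr n (w : T) : trail k n w -> trail k n (restr (head 0%N (plist n)) w).
Proof.
move=> wn; apply: trailE; first by case: wn.
- exact: kpoly_restr (trail_kpoly wn).
- by rewrite cf_restr eqxx (trail_cf wn).
- by move=> m; rewrite cf_restr; case: ifP => [_ /(trail_above wn)|] //; rewrite eqxx.
Qed.

(** Membership in A and homogeneity are carried along so that T_j acts through coordinates. At t = 1
    a step multiplies by h_a, passes to coordinates in [gT], restricts to first part a and passes
    back; each stage preserves the leading form. *)
Lemma kschur_t_trail la : kbounded k la ->
  [/\ qbounded t k (into (kschur_t t k la) : S),
      hom (sumn la) (into (kschur_t t k la) : S) &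
      exists Q : T, trail k (pm la) Q /\ spec pl (into (kschur_t t k la) : S) (Phi Q)].
Proof.
elim: la => [_|a la IH kla].
  rewrite /= inS1; split; [exact: qbounded1 | exact: hom1 |].
  exists 1; rewrite /Phi subst1; split; last exact: spec1.
  by rewrite (_ : pm [::] = onecm nat) /pm /bigcm ?big_nil //; exact: trail1.
have pla : is_part (a :: la) by case/andP: kla.
have ak : (a <= k)%N by case/andP: kla.
have kla' : kbounded k la.
  have pla' : is_part la.
    case/andP: pla => /path_sorted sl; rewrite inE negb_or => /andP[_ l0].
    by rewrite /is_part sl l0.
  by have := kla; rewrite -!kmon_pm // (pm_cat [:: a] la) kmonM => /andP[].
have [qf hf [Q [QT fQ]]] := IH kla'; set f := into _ in qf hf fQ.
have -> : into (kschur_t t k (a :: la)) = ktopS a (bernS t a%:Z f).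
  by rewrite /= /ktopS /bernS !inSK.
set u := bernS t a%:Z f.
have qu : qbounded t k u by apply: qbounded_bern; rewrite ?lez_nat.
have hu : hom (sumn (a :: la)) u.
  by apply/homzE; rewrite /= addnC PoszD; apply: homz_bern; apply/homzE.
have su : spec pl u (Phi (pz T a%:Z * Q)) by rewrite PhiM Phi_pz //; exact: spec_bern.
have [g [kg hg Eu]] := g_span qu hu.
have QT' : trail k (pm (a :: la)) (pz T a%:Z * Q).
  rewrite (pm_cat [:: a] la); apply: trailM => //.
  have -> : pm [:: a] = um a by rewrite /pm /bigcm big_cons big_nil mulcm0.
  by apply: trailX; exact: kmon_um.
rewrite Eu in su *; have [e [ke ge /Phi_eq Ee]] := system_coord gM_s gT_t kg su.
have [h hT Eh] := trail_span gT_t QT'.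
(* The residues of the generic coordinates are the coordinates at t = 1, by independence of [gT],
   and thus inherit the leading form. *)
have eh : e = h.
  apply/eqP; rewrite -subr_eq0; apply/eqP.
  rewrite addrC -scaleN1r; apply: (lin_trail_inj gT_t).
    by apply: kpolyD => //; apply: kpolyZ; exact: trail_kpoly hT.
  by rewrite linD linZ -Ee -Eh scaleN1r addNr.
rewrite ktopSE //; have kr := kpoly_restr (j := a) kg.
split.
- apply: lin_closed => [|c x y Hx Hy|m /kr]; first exact: qbounded0.
  + by apply: qboundedD => //; exact: qboundedZ.
  + exact: gM_q.
- apply: lin_closed => [|c x y Hx Hy|m mg]; first exact: hom0.
  + by apply: homD => //; exact: homZ.
  + rewrite -(hg m); first exact: gM_h (kr m mg).
    by move: mg; rewrite cf_restr; case: ifP => //; rewrite eqxx.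
exists (lin gT (restr a e)); split.
  apply: (trail_lin gT_t); rewrite eh -[a]/(head 0%N (a :: la)) -{2}(pmK pla).
  exact: trail_restr.
apply: (spec_lin gM_s) => //; first exact: kpoly_restr.
exact: spec_restr.
Qed.

End Generic.

(** * Rectangles *)

Section Rectangles.
Implicit Types m n : mon.

Definition pw (n : mon) (c : nat) : mon := iter c (mulcm n) (onecm nat).

Lemma pwE n c j : pw n c j = (c * n j)%N.
Proof. by elim: c => [|c IH]; rewrite ?onecmE //= mulcmE IH mulSn. Qed.

Lemma trail_pw (F : fieldType) (S : symCopy F) k n (f : S) (c : nat) :
  trail k n f -> trail k (pw n c) (f ^+ c).
Proof.
move=> nf; elim: c => [|c IH] /=; first exact: trail1.
by rewrite exprS; exact: trailM.
Qed.

Definition remm (k : nat) m : mon :=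
  bigcm (index_enum 'I_k) (fun i : 'I_k => pw (ucm (i : nat)) (m i %% (k - i))).

Lemma sum_ucm (k : nat) (c : nat -> nat) j :
  (\sum_(i < k) c i * (i == j :> nat) = if (j < k)%N then c j else 0)%N.
Proof.
case: ltnP => jk; last first.
  by rewrite big1 // => i _; case: eqP => [E|_]; rewrite ?muln0 //; have := ltn_ord i; rewrite E ltnNge jk.
rewrite (bigD1 (Ordinal jk)) //= eqxx muln1 big1 ?addn0 // => i ij.
by case: eqP => [E|_]; rewrite ?muln0 //; case/eqP: ij; apply: val_inj.
Qed.

Lemma remmE k m j : remm k m j = if (j < k)%N then (m j %% (k - j))%N else 0%N.
Proof.
rewrite /remm bigcmE -(sum_ucm k (fun i => m i %% (k - i))%N).
by apply: eq_bigr => i _; rewrite pwE ucmE.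
Qed.

Definition rect (k l : nat) : seq nat := nseq (k.+1 - l) l.

Lemma rect_part k l : (0 < l)%N -> is_part (rect k l).
Proof.
move=> l0; rewrite /is_part /rect mem_nseq; apply/andP; split; last first.
  by case: l l0 => [|l] //; rewrite andbF.
by case: (k.+1 - l)%N => //= n; elim: n => //= n ->; rewrite leqnn.
Qed.

Lemma rect_head k l : (l <= k)%N -> (head 0 (rect k l) + size (rect k l) <= k.+1)%N.
Proof. by move=> lk; rewrite size_nseq /rect subSn //= addnS subnKC. Qed.

Lemma pm_rect k i j : (i < k)%N -> pm (rect k i.+1) j = ((k - i) * (i == j))%N.
Proof. by move=> ik; rewrite pmE count_nseq /= eqSS subSS mulnC. Qed.

Definition reducible (k : nat) m : bool := [exists i : 'I_k, (k - i <= m i)%N].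

Lemma kirreducibleE k la : is_part la ->
  kirreducible k la = kmon k (pm la) && ~~ reducible k (pm la).
Proof.
move=> pla; rewrite /kirreducible kmon_pm //; congr (_ && _).
(* Both directions use i -> k - i - 1: the variable of that index counts the parts k - i, and its
   rectangle has i + 1 rows. *)
rewrite negb_exists; apply/forallP/forallP => H i.
  have ik := ltn_ord i; have := H (Ordinal (_ : k - i.+1 < k)%N).
  rewrite /= pmE -ltnNge => /(_ ltac:(by rewrite ltn_subrL (leq_ltn_trans _ ik))).
  by rewrite subKn //; move=> /leq_ltn_trans -> //; rewrite -subSn // subSS.
have ik := ltn_ord i; have := H (Ordinal (_ : k - i.+1 < k)%N).
rewrite /= pmE -ltnNge => /(_ ltac:(by rewrite ltn_subrL (leq_ltn_trans _ ik))).
by rewrite -subSn // subSS subKn ?(ltnW ik).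
Qed.

End Rectangles.

(** * The quotient by the rectangle ideal *)

Section Quotient.
Implicit Types m n : mon.
Variables (F : fieldType) (T : symCopy F) (k : nat).
Variable Q : seq nat -> T.
Hypothesis QT : forall la, kbounded k la -> trail k (pm la) (Q la).
Implicit Types (f g u : T).

Definition jtR (l : nat) : T := jtpoly T (rect k l).

Lemma trail_jtR l : (0 < l)%N -> (l <= k)%N -> trail k (pm (rect k l)) (jtR l).
Proof. by move=> l0 lk; apply: trail_jt; [exact: rect_part | exact: rect_head]. Qed.

(* Dividing m i by the number k - i of rows of the rectangle of width i + 1, the
   quotients count rectangles and the remainders form an irreducible partition. *)
Definition Eb m : T :=
  (\prod_(i < k) jtR i.+1 ^+ (m i %/ (k - i))) * Q (plist (remm k m)).

Lemma trail_Eb m : kmon k m -> trail k m (Eb m).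
Proof.
move=> km.
have Em : m = mulcm (bigcm (index_enum 'I_k)
    (fun i : 'I_k => pw (pm (rect k i.+1)) (m i %/ (k - i)))) (pm (plist (remm k m))).
  apply/eqP/cmP => j; rewrite mulcmE bigcmE plistK remmE.
  rewrite (eq_bigr (fun i : 'I_k => (m i %/ (k - i) * (k - i)) * (i == j :> nat))%N); last first.
    by move=> i _; rewrite pwE pm_rect // mulnA.
  rewrite (sum_ucm k (fun i => m i %/ (k - i) * (k - i))%N).
  case: ltnP => jk; first by rewrite -divn_eq.
  by apply/eqP/negPn/negP => /(kmonP _ _ km); rewrite ltnNge jk.
rewrite [X in trail k X _]Em; apply: trailM; last first.
  apply: QT; rewrite kbounded_plist; apply/kmonP => j; rewrite remmE.
  by case: ifP.
by apply: trail_prod => i _; apply: trail_pw; exact: trail_jtR.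
Qed.

(** The rectangle adds k - i to the exponent of variable i, which raises its quotient by one and
    leaves all remainders. *)
Lemma Eb_rect (i : 'I_k) m : jtR i.+1 * Eb m = Eb (mulcm m (pm (rect k i.+1))).
Proof.
have ki : (0 < k - i)%N by rewrite subn_gt0.
rewrite /Eb; have -> : remm k (mulcm m (pm (rect k i.+1))) = remm k m.
  apply/eqP/cmP => j; rewrite !remmE mulcmE pm_rect //.
  by case: eqP => [<-|_]; rewrite ?muln0 ?addn0 // muln1 modnDr.
rewrite mulrA; congr (_ * _); rewrite (bigD1 i) //= [RHS](bigD1 i) //=.
rewrite mulrA -exprS mulcmE pm_rect // eqxx muln1 divnDr ?dvdnn // divnn ki addn1.
congr (_ * _); apply: eq_bigr => j ji; rewrite mulcmE pm_rect //.
by rewrite eq_sym (negPf ji : (j == i :> nat) = false) muln0 addn0.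
Qed.

Lemma lin_Eb_rect (i : 'I_k) f :
  jtR i.+1 * lin Eb f = lin Eb (f * X (pm (rect k i.+1))).
Proof.
elim/symind: f => [|c m f IH]; first by rewrite mul0r !lin0 mulr0.
by rewrite mulrDl !linD mulrDr IH -scalerAl -XM !linZ !linX -scalerAr Eb_rect.
Qed.

Lemma Eb_irr la : kirreducible k la -> Eb (pm la) = Q la.
Proof.
move=> irr; have pla : is_part la by case/andP: irr => /andP[].
move: irr; rewrite kirreducibleE // => /andP[km /existsPn irr].
have lt j : (j < k)%N -> (pm la j < k - j)%N.
  by move=> jk; have := irr (Ordinal jk); rewrite -ltnNge.
rewrite /Eb big1 ?mul1r => [|i _]; last by rewrite divn_small ?lt // expr0.
rewrite -[in RHS](pmK pla); congr (Q (plist _)); apply/eqP/cmP => j; rewrite remmE.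
case: ltnP => jk; first by rewrite modn_small ?lt.
by apply/esym/eqP/negPn/negP => /(kmonP _ _ km); rewrite ltnNge jk.
Qed.

Definition rideal f : Prop := exists2 a : nat -> T, (forall l, kpoly k (a l)) &
  f = \sum_(1 <= l < k.+1) a l * jtR l.

Lemma rideal0 : rideal 0.
Proof.
exists (fun _ => 0) => [l|]; first exact: kpoly0.
by rewrite big1 // => l _; rewrite mul0r.
Qed.

Lemma rideal_lin c f g : rideal f -> rideal g -> rideal (c *: f + g).
Proof.
move=> [a ka ->] [b kb ->]; exists (fun l => c *: a l + b l) => [l|].
  by apply: kpolyD => //; exact: kpolyZ.
rewrite scaler_sumr -big_split; apply: eq_bigr => l _.
by rewrite mulrDl scalerAl.
Qed.

Lemma rideal_rect l a : (0 < l)%N -> (l <= k)%N -> kpoly k a -> rideal (a * jtR l).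
Proof.
move=> l0 lk ka; exists (fun j => if j == l then a else 0) => [j|].
  by case: ifP => _ //; exact: kpoly0.
rewrite (bigD1_seq l) ?mem_index_iota ?iota_uniq ?l0 ?ltnS //= eqxx.
by rewrite big1 ?addr0 // => j /negPf ->; rewrite mul0r.
Qed.

(** Expand the coefficients in the basis [Eb]: multiplication by a rectangle translates the index by
    that rectangle, so only reducible indices occur. *)
Lemma rideal_lin_Eb f : rideal f -> exists2 b : T, kpoly k b &
  f = lin Eb b /\ forall m, cf m b != 0 -> reducible k m.
Proof.
move=> [a ka ->]; rewrite big_add1 /= big_mkord.
elim/big_ind: _ => [|f1 f2 [b kb [-> Hb]] [c kc [-> Hc]]|i _].
- by exists 0; [exact: kpoly0 | split=> [|m]; rewrite ?lin0 // cf0 eqxx].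
- exists (b + c); first exact: kpolyD.
  by rewrite linD; split=> // m /cfD_neq0[/Hb|/Hc].
have [b kb ->] := kpoly_span trail_Eb (ka i.+1).
exists (b * X (pm (rect k i.+1))).
  apply: kpolyM => //; apply: kpolyX.
  by have [] := trail_jtR (ltn0Sn i) (ltn_ord i).
rewrite mulrC lin_Eb_rect; split=> // m /cfM_neq0[n [l [_ + ->]]].
rewrite cfX; have [<- _|] := eqVneq (pm _) l; last by rewrite eqxx.
by apply/existsP; exists i; rewrite mulcmE pm_rect // eqxx muln1 leq_addl.
Qed.

Lemma rideal_Eb m : kmon k m -> reducible k m -> rideal (Eb m).
Proof.
move=> km /existsP[i im].
have Em : m = mulcm (divcm m (pm (rect k i.+1))) (pm (rect k i.+1)).
  apply/eqP/cmP => j; rewrite mulcmE divcmE pm_rect // subnK //.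
  by have [<-|] := eqVneq (i : nat) j; rewrite ?muln1 ?muln0.
have km' : kmon k (divcm m (pm (rect k i.+1))).
  by move: km; rewrite {1}Em kmonM => /andP[].
rewrite Em -Eb_rect mulrC; apply: rideal_rect => //.
exact: trail_kpoly (trail_Eb km').
Qed.

(** An ideal element involves only reducible indices, a combination of the Q la only irreducible
    ones; uniqueness of coordinates in [Eb] separates the two. *)
Lemma irr_independent (s : seq (seq nat)) (c : seq nat -> F) : uniq s ->
  all (kirreducible k) s -> rideal (\sum_(la <- s) c la *: Q la) ->
  forall la, la \in s -> c la = 0.
Proof.
move=> us sirr /rideal_lin_Eb[b kb [Eb_b bred]] la ls.
have irr_la mu : mu \in s -> kirreducible k mu by move/(allP sirr).
have part_la mu : mu \in s -> is_part mu by move/irr_la => /andP[/andP[]].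
pose f : T := \sum_(mu <- s) c mu *: X (pm mu).
have kf : kpoly k f.
  apply: kpoly_sum => mu ms _; apply: kpolyZ; apply: kpolyX.
  by have := irr_la mu ms; rewrite kirreducibleE ?part_la // => /andP[].
have : lin Eb (- 1 *: b + f) = 0.
  rewrite linD linZ -Eb_b /f lin_sum scaleN1r; apply/eqP; rewrite addrC subr_eq0; apply/eqP.
  rewrite big_seq [RHS]big_seq; apply: eq_bigr => mu ms.
  by rewrite linZ linX Eb_irr // irr_la.
move=> /(lin_trail_inj trail_Eb) E.
have {E} : - 1 *: b + f = 0 by apply: E; apply: kpolyD => //; exact: kpolyZ.
move=> /(congr1 (cf (pm la))); rewrite cf0 cfD cfZ.
have -> : cf (pm la) b = 0.
  apply/eqP/negPn/negP => /bred.
  by have := irr_la la ls; rewrite kirreducibleE ?part_la // => /andP[_ /negP].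
rewrite mulr0 add0r /f cf_sum (bigD1_seq la) //= cfZ cfX eqxx mulr1.
rewrite big1_seq ?addr0 // => mu /andP[mula ms]; rewrite cfZ cfX.
case: eqP => [E|_]; last by rewrite mulr0.
by case/eqP: mula; apply: pm_inj E; exact: part_la.
Qed.

Lemma irr_generate f : kpoly k f -> exists (s : seq (seq nat)) (c : seq nat -> F),
  all (kirreducible k) s /\ rideal (f - \sum_(la <- s) c la *: Q la).
Proof.
move=> /(kpoly_span trail_Eb)[b kb ->].
(* These are the irreducible indices of the expansion in [Eb]; each reducible term lies in the
   ideal. *)
exists [seq plist m | m <- enum_fset (supp b) & ~~ reducible k m], (fun la => cf (pm la) b).
split.
  rewrite all_map; apply/allP => m; rewrite mem_filter supp_cf => /andP[mr /kb km].
  by rewrite /= kirreducibleE ?plist_part // plistK km.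
have -> : lin Eb b - \sum_(la <- [seq plist m | m <- enum_fset (supp b) & ~~ reducible k m])
      cf (pm la) b *: Q la =
    \sum_(m <- supp b | reducible k m) cf m b *: Eb m.
  rewrite big_map big_filter /lin (bigID (reducible k)) /= -addrA.
  rewrite [X in _ + X](_ : _ = 0) ?addr0 //; apply/eqP; rewrite subr_eq0; apply/eqP.
  rewrite big_seq_cond [RHS]big_seq_cond; apply: eq_bigr => m; rewrite supp_cf => /andP[/kb km mr].
  by rewrite plistK -Eb_irr ?plistK // kirreducibleE ?plist_part // plistK km.
rewrite big_seq_cond; elim/big_rec: _ => [|m u /andP[mb mr] Hu]; first exact: rideal0.
by apply: rideal_lin => //; apply: rideal_Eb => //; apply: kb; rewrite -supp_cf.
Qed.

End Quotient.

(** * Evaluation of rational functions at t = 1 *)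

Section FractionPlace.
Variables (A K : fieldType) (io : {rmorphism K -> A}).
Local Notation Ft := {fraction {poly A}}.

Definition frac_const : {rmorphism A -> Ft} := (@tofrac {poly A}) \o (@polyC A).

Lemma frac_char0 : [pchar A] =i pred0 -> [pchar Ft] =i pred0.
Proof. by move=> A0 p; rewrite (fmorph_pchar frac_const) A0. Qed.

Lemma at1_neq0 (d : {poly A}) : d.[1] != 0 -> tofrac d != 0 :> Ft.
Proof. by apply: contraNneq => /eqP; rewrite tofrac_eq0 => /eqP ->; rewrite horner0. Qed.

Definition value_at1 (r : Ft) (c : K) : Prop := exists n d : {poly A},
  [/\ d.[1] != 0, r = tofrac n / tofrac d & n.[1] / d.[1] = io c].

(** The value is unique because two representations cross-multiply to an identity of polynomials,
    which can be evaluated at 1. *)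
Lemma value_at1_place : { p : place Ft K | forall r c, p r c <-> value_at1 r c }.
Proof.
unshelve eexists.
  exists value_at1.
  - by exists 1, 1; rewrite hornerC oner_neq0 !rmorph1 !divr1.
  - move=> a b c e [n1 [d1 [d10 -> E1]]] [n2 [d2 [d20 -> E2]]].
    exists (n1 * d2 + n2 * d1), (d1 * d2); split.
    + by rewrite hornerM mulf_neq0.
    + by rewrite rmorphD !rmorphM /= addf_div ?at1_neq0.
    + by rewrite hornerD !hornerM -addf_div // E1 E2 rmorphD.
  - move=> a c [n1 [d1 [d10 -> E1]]]; exists (- n1), d1; split=> //.
    + by rewrite rmorphN mulNr.
    + by rewrite hornerN mulNr E1 rmorphN.
  - move=> a b c e [n1 [d1 [d10 -> E1]]] [n2 [d2 [d20 -> E2]]].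
    exists (n1 * n2), (d1 * d2); split.
    + by rewrite hornerM mulf_neq0.
    + by rewrite !rmorphM /= mulf_div.
    + by rewrite !hornerM -mulf_div E1 E2 rmorphM.
  - move=> a c c0 [n1 [d1 [d10 -> E1]]]; exists d1, n1.
    have n10 : n1.[1] != 0.
      apply: contraNneq c0 => n0; move: E1; rewrite n0 mul0r => /esym/eqP.
      by rewrite fmorph_eq0.
    split=> //; first by rewrite invf_div.
    by rewrite -invf_div E1 fmorphV.
  - move=> a c e [n1 [d1 [d10 -> E1]]] [n2 [d2 [d20 E E2]]].
    have H : n1 * d2 = n2 * d1.
      apply/eqP; rewrite -tofrac_eq !rmorphM /=; move/eqP: E.
      by rewrite eqr_div ?at1_neq0.
    apply: (fmorph_inj io); rewrite -E1 -E2; apply/eqP.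
    by rewrite eqr_div // -!hornerM H.
  - move=> c; exists (tofrac (io c)%:P), (io c)%:P, 1.
    by rewrite !hornerC oner_neq0 rmorph1 !divr1.
by [].
Qed.

Lemma value_at1_X : value_at1 (tofrac 'X) 1.
Proof. by exists 'X, 1; rewrite hornerC oner_neq0 hornerX !rmorph1 !divr1. Qed.

Lemma tofracX_neq1 (r : nat) : 1 - tofrac 'X ^+ r.+1 != 0 :> Ft.
Proof.
rewrite -rmorphXn -(rmorph1 (@tofrac {poly A})) -rmorphB tofrac_eq0.
(* The polynomial 1 - X^(r+1) has value 1 at 0. *)
apply/eqP => /(congr1 (fun p => p.[0])).
rewrite hornerD hornerN hornerC hornerXn expr0n /= subr0 horner0 => /eqP.
by rewrite oner_eq0.
Qed.
End FractionPlace.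

Lemma into_monom (F : fieldType) (S : symCopy F) a (m : mon) : into << a *g m >> = a *: X m :> S.
Proof.
rewrite XE -inSZ; congr into; apply/malgP => n.
by rewrite [RHS]mcoeffZ [LHS]mcoeffU (mcoeffU m 1 n) mulr_natr.
Qed.

(** A monomial outside the support of f has residue 0, so leaving it out of the sum is harmless. *)
Lemma into_residue (F K : fieldType) (pl : place F K) (S : symCopy F) (T : symCopy K)
    (v : F -> K) (f : sym F) (w : T) :
  (forall a c, pl a c -> v a = c) -> spec pl (into f : S) w ->
  into (\sum_(m <- msupp f) << v f@_m *g m >>) = w.
Proof.
move=> vP fw; have H n : pl f@_n (cf n w) by have := fw n; rewrite [cf n (into _)]cfE inSK.
rewrite inS_sum (eq_bigr (fun m => v f@_m *: X m)); last by move=> m _; rewrite into_monom.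
apply: cfP => m; rewrite cf_sum.
have [mf|mf] := boolP (m \in msupp f).
  rewrite (bigD1_seq m) ?fset_uniq //= cfZ cfX eqxx mulr1 (vP _ _ (H m)) big1 ?addr0 // => n nm.
  by rewrite cfZ cfX (negPf nm) mulr0.
rewrite big1_seq => [|n /andP[_ nf]].
  by have := H m; rewrite (mcoeff_outdom mf) => /(res_fun (res0 pl)).
rewrite cfZ cfX; case: eqP => [E|_]; rewrite ?mulr0 //.
by rewrite -E nf in mf.
Qed.

(** * Transport of the algebra and the ideal along [Phi] *)

Section Ideal.
Implicit Types m n : mon.
Variables (F : fieldType) (T : symCopy F) (k : nat).

Lemma symkP (f : sym F) : symk k f <-> exists2 P : T, kpoly k P & into f = Phi P.
Proof.
split=> [[P ->]|[P kP Ef]].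
  exists (\sum_(m <- msupp P) P@_m *: \prod_(i < k) X (ucm (i : nat)) ^+ m i).
    apply: kpoly_sum => m _ _; apply: kpolyZ.
    elim/big_ind: _ => [|p q Hp Hq|i _]; first by rewrite -X1; apply: kpolyX; exact: kmon1.
      exact: kpolyM.
    elim: (m i) => [|c IH]; first by rewrite expr0 -X1; apply: kpolyX; exact: kmon1.
    rewrite exprS; apply: kpolyM => //; apply: kpolyX; apply/kmonP => j.
    by rewrite ucmE; have [<-|] := eqVneq (i : nat) j.
  rewrite /mmap inS_sum /Phi subst_sum; apply: eq_bigr => m _.
  rewrite mul_malgC inSZ inS_prod substZ subst_prod; congr (_ *: _).
  by apply: eq_bigr => i _; rewrite inSX substXn substX expmU.
(* Truncation to k variables; nothing is lost on the support of P, which is k-bounded. *)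
pose r (m : mon) : 'X_{1..k} := [cmonom m (nat_of_ord i) | i in [fset j | j in 'I_k]]%M.
have rE m i : r m i = m i by rewrite cmE fsfunE in_fset.
exists (\sum_(m <- supp P) << cf m P *g r m >>).
apply: (can_inj (@inSK _ T)); rewrite Ef raddf_sum /= inS_sum /Phi /subst /lin.
rewrite big_seq [RHS]big_seq; apply: eq_bigr => m; rewrite supp_cf => mP.
rewrite -[mmap _ _ _]/(mmap _ _ _) mmapU mul_malgC inSZ inS_prod; congr (_ *: _).
rewrite (expm_ord _ (n := k)); last by apply/kmonP; exact: kP.
by apply: eq_bigr => i _; rewrite inSX rE.
Qed.

Lemma rect_idealP (f : sym F) : rect_ideal k f <->
  exists2 P : T, rideal k P & into f = Phi P.
Proof.
split=> [[a ka ->]|[P [a ka ->] Ef]].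
  have [b kb] : exists b : nat -> T, forall l, kpoly k (b l) /\ into (a l) = Phi (b l).
    have H l : exists P : T, kpoly k P /\ into (a l) = Phi P.
      by have /symkP[P kP E] := ka l; exists P.
    exists (fun l => proj1_sig (constructive_indefinite_description _ (H l))) => l.
    by case: constructive_indefinite_description.
  exists (\sum_(1 <= l < k.+1) b l * jtR T k l).
    by exists b => // l; case: (kb l).
  rewrite inS_sum Phi_sum; apply: eq_bigr => l _.
  rewrite inSM PhiM; case: (kb l) => _ ->; congr (_ * _).
  by rewrite /jtR Phi_jt.
exists (fun l => out (Phi (a l))) => [l|].
  by apply/symkP; exists (a l); rewrite ?outSK.
apply: (can_inj (@inSK _ T)); rewrite Ef inS_sum Phi_sum; apply: eq_bigr => l _.
rewrite inSM PhiM outSK; congr (_ * _).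
by rewrite /jtR Phi_jt.
Qed.

End Ideal.

(** * The k-Schur functions over the rationals *)

Section KSchur.
Let ratQq : {rmorphism rat -> Qq} := frac_const rat.
Let pl : place Qqt rat := proj1_sig (value_at1_place ratQq).

Lemma rat_char0 : [pchar rat] =i pred0.
Proof. exact: Num.Theory.pchar_num. Qed.

Lemma has_value_at_t1E r c : pl r c <-> has_value_at_t1 r c.
Proof.
have ratrE b : ratr b = ratQq b.
  by rewrite -{2}(divq_num_den b) fmorph_div !rmorph_int.
rewrite /pl; case: value_at1_place => p /= ->.
by split=> -[n [d [d1 rE E]]]; exists n, d; split=> //; rewrite E ratrE.
Qed.

(** Values are unique by [res_fun], so the choice made by [epsilon] is the residue. *)
Lemma at_t1E r c : pl r c -> at_t1 r = c.
Proof.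
move=> rc; apply: (res_fun (p := pl)) (rc); apply/has_value_at_t1E.
by apply: (epsilon_spec (inhabits 0) (has_value_at_t1 r)); exists c; apply/has_value_at_t1E.
Qed.

Lemma kschur_trail (T : symCopy rat) k la : kbounded k la ->
  exists2 Q : T, trail k (pm la) Q & into (kschur k la) = Phi Q.
Proof.
move=> kla; have X1 : pl tvar 1.
  by rewrite /pl; case: value_at1_place => p /= ->; exact: value_at1_X.
have [_ _ [Q [QT fQ]]] := @kschur_t_trail _ _ pl (symCopy_exists Qqt) T _
  (frac_char0 (frac_char0 rat_char0)) rat_char0 X1 (@tofracX_neq1 _) k la kla.
exists Q => //; exact: into_residue at_t1E fQ.
Qed.
End KSchur.

Theorem theorem4 (k : nat) (k_gt0 : (0 < k)%N) :
  basis_of_quotient (V := sym rat)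
    (symk k) (rect_ideal k) (kirreducible k) (kschur k).
Proof.
pose T := symCopy_exists rat.
(* One function collects the preimages of all k-Schur functions; its values off the k-bounded
   partitions are arbitrary. *)
have [Q HQ] : exists Q : seq nat -> T, forall la, kbounded k la ->
    trail k (pm la) (Q la) /\ into (kschur k la) = Phi (Q la).
  exists (fun la => epsilon (inhabits 0) (fun Q : T => trail k (pm la) Q /\ into (kschur k la) = Phi Q)).
  move=> la kla; have [Q QT QE] := kschur_trail T kla.
  by apply: (epsilon_spec (inhabits 0) (fun Q : T => trail k (pm la) Q /\ into (kschur k la) = Phi Q)); exists Q.
have QT la kla := (HQ la kla).1; have QE la kla := (HQ la kla).2.
have comb (s : seq (seq nat)) (c : seq nat -> rat) : all (kirreducible k) s ->
    into (\sum_(la <- s) c la *: kschur k la) = Phi (\sum_(la <- s) c la *: Q la).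
  move=> /allP irr; rewrite inS_sum Phi_sum big_seq [RHS]big_seq; apply: eq_bigr => la ls.
  by rewrite inSZ PhiZ QE //; case/andP: (irr la ls).
split.
- move=> la /andP[kla _]; apply/(@symkP _ T); exists (Q la); last exact: QE.
  exact: trail_kpoly (QT la kla).
- move=> s c us sirr /(@rect_idealP _ T)[P idP].
  rewrite (comb s c sirr) => /(Phi_eq rat_char0) EP.
  by apply: (irr_independent QT us sirr); rewrite EP.
- move=> f /(@symkP _ T)[P kP Ef]; have [s [c [sirr sid]]] := irr_generate QT kP.
  exists s, c; split=> //; apply/(@rect_idealP _ T).
  exists (P - \sum_(la <- s) c la *: Q la) => //.
  by rewrite -scaleN1r inSD inSZ Ef (comb s c sirr) -[in RHS]scaleN1r PhiD PhiZ.
Qed.
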